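(* Suppose that $\eta$ is a convex function on $(0,\infty)$ and, moreover, $$\int_1^\infty \eta^{-1}\left(\frac{t}{\varphi^{-1}(g(t))}\right)\frac{dt}{t}<\infty$$ and $$\int_{r_0}^\infty \eta\left(\frac{r}{\eta^{-1}\left(\varphi^{-1}\left(\frac{1}{f(r)}\right)\right)}\right)\frac{dr}{r}=\infty,$$ where the integrand in the last integral is by definition equal to $0$ at those $r$ for which $f(r)=0$. Then any non-negative weak solution $u$ of the problem $$\mathcal L_\varphi u\ge F(x,u)\ \text{ in }\Omega,\qquad u|_{\partial\Omega}=0,$$ is identically equal to zero (i.e. $u=0$ a.e. in $\Omega$).
   Context: Let $n\ge 2$ and let $\Omega\neq\emptyset$ be an unbounded open subset of $\mathbb R^n$. $B_r$ and $S_r$ denote the open ball and the sphere in $\mathbb R^n$ of radius $r>0$ centered at zero. There is a real number $r_0>0$ such that $\Omega\cap S_r\ne\emptyset$ for all $r\ge r_0$. For $r>0$, $\sigma>1$ put $\Omega_{r,\sigma}=\Omega\cap B_{\sigma r}\setminus\overline{B_{r/\sigma}}$. Operator. $\varphi:[0,\infty)\to[0,\infty)$ is an increasing one-to-one (onto) function such that $\left(\frac{\varphi(|\xi|)}{|\xi|}\xi-\frac{\varphi(|\zeta|)}{|\zeta|}\zeta\right)(\xi-\zeta)>0$ for all $\xi,\zeta\in\mathbb R^n$, $\xi\ne\zeta$ (the vector $\frac{\varphi(|\xi|)}{|\xi|}\xi$ is understood as $0$ for $\xi=0$), and $\mathcal L_\varphi u=\operatorname{div}\left(\frac{\varphi(|\nabla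 u|)}{|\nabla u|}\nabla u\right)$. Almost semi-multiplicative functions. A function $h:(0,\infty)\to(0,\infty)$ is almost semi-multiplicative if there is a constant $c>0$ such that $h(t_1)h(t_2)\ge c\,h(t_1t_2)$ for all $t_1,t_2\in(0,\infty)$. Assumptions on $F$. $F=F(x,t)$ is a non-negative function of $x\in\Omega$, $t\ge 0$, and for some real number $\sigma>1$ $$\inf_{x\in\Omega_{r,\sigma}}F(x,t)\ge f(r)g(t)\quad\text{for all } r\ge r_0,\ t>0,$$ where $f\in L_{\infty,loc}([r_0,\infty))$ and $g\in L_{\infty,loc}(0,\infty)$ are non-negative functions, $g$ is bounded above on every compact subset of $(0,\infty)$, and $\inf_K g>0$ for any compact set $K\subset(0,\infty)$. The function $g$ and the inverse function $\varphi^{-1}$ (on $(0,\infty)$) are almost semi-multiplicative. The function $\eta$. $\eta(t)=\dfrac{t}{\varphi^{-1}(1/t)}$, $t>0$; it is an increasing one-to-one mapping of $(0,\infty)$ onto itself, and $\eta^{-1}$ is its inverse. Function spaces. $f\in W^1_{p,loc}(\Omega)$ (resp. $L_{p,loc}(\Omega)$), $p\ge1$, means $f\in W^1_p(\Omega\cap B_r)$ (resp. $L_p(\Omega\cap B_r)$) for every $r>0$; $L_{\infty,loc}(\Omega)$ similarly. $\stackrel{\circ}{W}{}^1_1(\Omega)$ is the closure of $C_0^\infty(\Omega)$ in $W^1_1(\Omega)$. Weak solutions. $u\in W^1_{1,loc}(\Omega)\cap L_{\infty,loc}(\Omega)$ is a weak solution of $\mathcal L_\varphi u\ge F(x,u)$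 in $\Omega$ if $F(x,u)\in L_{1,loc}(\Omega)$, $\varphi(|\nabla u|)|\nabla u|\in L_{1,loc}(\Omega)$, and $$-\int_\Omega\frac{\varphi(|\nabla u|)}{|\nabla u|}\nabla u\nabla\psi\,dx\ge\int_\Omega F(x,u)\psi\,dx$$ for any non-negative $\psi\in\stackrel{\circ}{W}{}^1_1(\Omega)\cap L_\infty(\Omega)$ with compact support (support taken in $\mathbb R^n$ after extending $\psi$ by zero outside $\Omega$) such that $\int_\Omega\varphi(|\nabla u|)|\nabla\psi|\,dx<\infty$. The condition $u|_{\partial\Omega}=0$ means that $\gamma u\in\stackrel{\circ}{W}{}^1_1(\Omega)$ for all $\gamma\in C_0^\infty(\mathbb R^n)$. *)

(* Defs.v *)
From HB Require Import structures.
From mathcomp Require Import all_boot all_order all_algebra.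
From mathcomp Require Import all_classical all_reals all_analysis.

Set Implicit Arguments.
Unset Strict Implicit.
Unset Printing Implicit Defensive.

Import Order.TTheory GRing.Theory Num.Theory.
Import numFieldNormedType.Exports.

Local Open Scope classical_set_scope.
Local Open Scope ring_scope.

(** Lebesgue measure on R^n: the product of [n] copies of the one-dimensional Lebesgue measure is built
    on tuples, transported to row vectors, and then completed, so that the
    measurable sets are all Lebesgue measurable sets. *)

Section lebesgue_tuple.
Context {R : realType}.
Local Notation mR := (measurableTypeR R).

Definition cons_pair n (p : mR * n.-tuple mR) : n.+1.-tuple mR :=
  [the n.+1.-tuple mR of p.1 :: p.2].

Lemma measurable_cons_pair n : measurable_fun setT (@cons_pair n).
Proof. exact: measurable_cons. Qed.

HB.instance Definition _ n :=
  isMeasurableFun.Build _ _ _ _ (@cons_pair n) (@measurable_cons_pair n).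

Definition lebesgue_cons n
    (m : {sigma_finite_measure set (n.-tuple mR) -> \bar R}) :=
  pushforward (@lebesgue_measure R \x m)%E (@cons_pair n).

Section lebesgue_cons.
Variables (n : nat) (m : {sigma_finite_measure set (n.-tuple mR) -> \bar R}).

Let lebesgue_cons0 : lebesgue_cons m set0 = 0%E.
Proof. exact: measure0. Qed.

Let lebesgue_cons_ge0 A : (0 <= lebesgue_cons m A)%E.
Proof. exact: measure_ge0. Qed.

Let lebesgue_cons_sigma_additive : semi_sigma_additive (lebesgue_cons m).
Proof. exact: measure_semi_sigma_additive. Qed.

HB.instance Definition _ := isMeasure.Build _ _ _ (lebesgue_cons m)
  lebesgue_cons0 lebesgue_cons_ge0 lebesgue_cons_sigma_additive.

Let lebesgue_cons_sigma_finite : sigma_finite setT (lebesgue_cons m).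
Proof.
have /sigma_finiteP[F [TF ndF Foo]] := sigma_finiteT (@lebesgue_measure R).
have /sigma_finiteP[G [TG ndG Goo]] := sigma_finiteT m.
pose hd (t : n.+1.-tuple mR) : mR := tnth t ord0.
pose tl (t : n.+1.-tuple mR) : n.-tuple mR := [tuple of behead t].
have mhd : measurable_fun setT hd := @measurable_tnth _ mR n.+1 ord0.
have mtl : measurable_fun setT tl := @measurable_behead _ mR n.
exists (fun k => hd @^-1` F k `&` tl @^-1` G k).
  apply/esym; rewrite -subTset => t _.
  have [i _ Fit] : (\bigcup_k F k) (hd t) by rewrite -TF.
  have [j _ Gjt] : (\bigcup_k G k) (tl t) by rewrite -TG.
  exists (maxn i j) => //; split => /=.
  - by move: (hd t) Fit; exact/subsetPset/ndF/leq_maxl.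
  - by move: (tl t) Gjt; exact/subsetPset/ndG/leq_maxr.
move=> k; have [mF Fk] := Foo k; have [mG Gk] := Goo k; split.
  apply: measurableI; rewrite -[X in measurable X]setTI.
    exact: mhd.
  exact: mtl.
rewrite /lebesgue_cons /pushforward (_ : _ @^-1` _ = F k `*` G k).
  by rewrite product_measure1E// lte_mul_pinfty// ge0_fin_numE.
apply/seteqP; split => -[x t] [/= Fx Gt]; split => //=.
  by rewrite (_ : t = tl (cons_pair (x, t)))//; exact/val_inj.
by rewrite /= (_ : tl _ = t)//; exact/val_inj.
Qed.

HB.instance Definition _ := Measure_isSigmaFinite.Build _ _ _ (lebesgue_cons m)
  lebesgue_cons_sigma_finite.

End lebesgue_cons.

Fixpoint lebesgue_tuple n : {sigma_finite_measure set (n.-tuple mR) -> \bar R} :=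
  if n is n'.+1 then lebesgue_cons (lebesgue_tuple n')
  else (\d_ [tuple of [::]])%E.

End lebesgue_tuple.

Section lebesgue_rV.
Context (R : realType) (n : nat).
Local Notation mR := (measurableTypeR R).

Definition tuple_of_rV (x : 'rV[R]_n) : n.-tuple mR := [tuple x 0 i | i < n].

Definition rV_of_tuple (t : n.-tuple mR) :
    g_sigma_algebra_preimageType tuple_of_rV :=
  \row_i tnth t i.

Lemma measurable_rV_of_tuple : measurable_fun setT rV_of_tuple.
Proof.
move=> _ _ [B mB <-]; rewrite !setTI -comp_preimage.
rewrite (_ : _ \o _ = id) ?preimage_id//.
by apply/funext => t; apply: eq_from_tnth => i; rewrite /= tnth_mktuple mxE.
Qed.

HB.instance Definition _ :=
  isMeasurableFun.Build _ _ _ _ rV_of_tuple measurable_rV_of_tuple.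

Definition borel_lebesgue_rV := pushforward (@lebesgue_tuple R n) rV_of_tuple.

Let borel_lebesgue_rV0 : borel_lebesgue_rV set0 = 0%E.
Proof. exact: measure0. Qed.

Let borel_lebesgue_rV_ge0 A : (0 <= borel_lebesgue_rV A)%E.
Proof. exact: measure_ge0. Qed.

Let borel_lebesgue_rV_sigma_additive : semi_sigma_additive borel_lebesgue_rV.
Proof. exact: measure_semi_sigma_additive. Qed.

HB.instance Definition _ := isMeasure.Build _ _ _ borel_lebesgue_rV
  borel_lebesgue_rV0 borel_lebesgue_rV_ge0 borel_lebesgue_rV_sigma_additive.

Definition lebesgue_rV :=
  @completed_measure_extension _ _ _ borel_lebesgue_rV.

HB.instance Definition _ := Measure.on lebesgue_rV.

End lebesgue_rV.
Arguments lebesgue_rV {R n}.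

Section euclidean.
Context {R : realType} {n : nat}.
Implicit Types (x y : 'rV[R]_n) (r s : R) (Om : set 'rV[R]_n).

Definition dotv x y : R := \sum_i x 0 i * y 0 i.

(** The library norm [`|x|] on ['rV[R]_n] is the sup norm. *)
Definition enorm x : R := Num.sqrt (dotv x x).

Definition eball r : set 'rV[R]_n := [set x | enorm x < r].

Definition esphere r : set 'rV[R]_n := [set x | enorm x = r].

Definition annulus Om s r : set 'rV[R]_n :=
  Om `&` eball (s * r) `\` closure (eball (r / s)).

End euclidean.

(** Functions on a subset of R^n are total functions on ['rV[R]_n] whose values
    off the subset are irrelevant. *)

Section function_spaces.
Context {R : realType} {n : nat}.
Local Notation E := 'rV[R]_n.
Local Notation mu := (@lebesgue_rV R n).
Implicit Types (A Om : set E) (u v f : E -> R) (G : E -> E).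

Definition partial (i : 'I_n) f : E -> R := fun x => 'D_(delta_mx 0 i) f x.

Definition grad f : E -> E := fun x => \row_i partial i f x.

Definition iter_partial (s : seq 'I_n) f : E -> R := foldr partial f s.

Definition smooth f := forall s : seq 'I_n,
  continuous (iter_partial s f) /\
  forall i x, derivable (iter_partial s f) x (delta_mx 0 i).

(** [C_0^oo(A)] *)
Definition test_function A f :=
  [/\ smooth f, compact (closure [set x | f x != 0]) &
      closure [set x | f x != 0] `<=` A].

Definition L1 A f := mu.-integrable A (EFin \o f).

Definition L1loc Om f := forall r, 0 < r -> L1 (Om `&` eball r) f.

Definition Linfty d (T : measurableType d) (m : {measure set T -> \bar R})
    (A : set T) (f : T -> R) :=
  measurable_fun A f /\
  exists M : R, {ae m, forall x, A x -> `|f x| <= M}.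

Definition Linfty_loc Om f := forall r, 0 < r -> Linfty mu (Om `&` eball r) f.

(** [u] belongs to [W^1_1(A)] and [G] is its weak gradient, which is unique up
    to a null set. *)
Definition W11_grad A u G :=
  [/\ L1 A u, forall i, L1 A (fun x => G x 0 i) &
      forall f, test_function A f -> forall i,
        (\int[mu]_(x in A) (u x * partial i f x)%:E =
         - \int[mu]_(x in A) (G x 0 i * f x)%:E)%E].

(** Weak gradients on the sets [Om `&` eball r] are restrictions of each other,
    so they are given by a single [G]. *)
Definition W11loc_grad Om u G :=
  forall r, 0 < r -> W11_grad (Om `&` eball r) u G.

(** The norm in [W^1_1(A)] of a function [u] with weak gradient [G]. *)
Definition W11_norm A u G : \bar R :=
  (\int[mu]_(x in A) `|u x|%:E + \int[mu]_(x in A) (enorm (G x))%:E)%E.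

(** [v] is in the closure of [C_0^oo(A)] in [W^1_1(A)]; the weak gradient of
    [v - f] is [G - grad f]. *)
Definition W11_0 A v := exists2 G, W11_grad A v G &
  forall e : R, 0 < e -> exists2 f, test_function A f &
    (W11_norm A (v \- f)%R (fun x => G x - grad f x)%R < e%:E)%E.

(** The complement of the largest open set on which [f = 0] a.e. *)
Definition ess_support f : set E :=
  [set x | ~ exists U, [/\ open U, U x & {ae mu, forall y, U y -> f y = 0}]].

End function_spaces.

Section inequality.
Context {R : realType} {n : nat}.
Local Notation E := 'rV[R]_n.
Local Notation mu := (@lebesgue_rV R n).
Implicit Types (Om : set E) (phi : R -> R) (F : E -> R -> R) (u : E -> R).

(** This is [0] at [xi = 0] since then [_ *: xi] is. *)
Definition flux phi (xi : E) : E := (phi (enorm xi) / enorm xi) *: xi.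

Definition weak_solution Om phi F u :=
  Linfty_loc Om u /\
  exists G, [/\ W11loc_grad Om u G,
    L1loc Om (fun x => F x (u x)),
    L1loc Om (fun x => phi (enorm (G x)) * enorm (G x)) &
    forall psi H,
      W11_grad Om psi H -> W11_0 Om psi -> Linfty mu Om psi ->
      {ae mu, forall x, Om x -> 0 <= psi x} ->
      compact (ess_support (patch (fun=> 0) Om psi)) ->
      (\int[mu]_(x in Om) (phi (enorm (G x)) * enorm (H x))%:E < +oo)%E ->
      (\int[mu]_(x in Om) (F x (u x) * psi x)%:E <=
       - \int[mu]_(x in Om) (dotv (flux phi (G x)) (H x))%:E)%E].

Definition zero_on_boundary Om u := forall gamma : E -> R,
  test_function setT gamma -> W11_0 Om (fun x => gamma x * u x).

End inequality.

Section scalar_functions.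
Context {R : realType}.
Implicit Types (f h phi : R -> R) (A : set R).

(** The inverse of the restriction of [f] to [A]; [A] is [[0, +oo[] for [phi]
    and []0, +oo[] for [eta_of phi]. *)
Definition inv_on A f : R -> R := 'pinv_(fun=> 0) A f.

Definition phi_inv phi : R -> R := inv_on `[0, +oo[%classic phi.

Definition eta_of phi (t : R) : R := t / phi_inv phi (1 / t).

Definition eta_inv phi : R -> R := inv_on `]0, +oo[%classic (eta_of phi).

Definition almost_semi_multiplicative h :=
  (forall t, 0 < t -> 0 < h t) /\
  exists2 c, 0 < c &
    forall t1 t2, 0 < t1 -> 0 < t2 -> c * h (t1 * t2) <= h t1 * h t2.

Definition Linfty_loc_itv A f := forall K, compact K -> K `<=` A ->
  Linfty (@completed_lebesgue_measure R) K f.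

End scalar_functions.

(* Main.v *)
(** Let [M r] be the essential supremum of [u] on the ball of radius [r]. On a
    ball [B_h(z)] where [F >= 2q], testing the inequality with smooth truncations
    [Phi (u - v)] of [u] above a radial barrier [v] whose flux is nearly
    [(q / n) (x - z)] shows that [u] stays below [v] near [z]. Choosing [z] near
    the sphere of radius [a] where the maximum principle lets [u] come close to
    [M a], this gives, with [h = b - a],
      [M b - M a >= (h / 4) phi^-1 (kap h f(r) g(M a))]
    whenever [r <= a < b <= lam r] and [M b <= 2 M a]. Almost semi-multiplicativity
    turns this into [eta (r / eta^-1 (phi^-1 (1 / f r))) <= C (P (M (lam r)) - P (M r))],
    where [P] is a primitive of [eta^-1 (t / phi^-1 (g t)) / t], bounded by the
    first integral condition. Summing over the geometric grid [lam^j r1] makes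
    the second integral finite, unless [M] vanishes identically. *)

(* Membership in the closure of [C_0^oo] and weak gradients are accessible only through smooth test
   functions, so all nonlinear operations are made smooth. Because [v >= v0 > 0], [Phi (f - v)] is a
   test function on [Om] whenever [f] is one; letting [f] approach [u] times a cutoff shows that the
   truncation is admissible and has the expected gradient. The ideal barrier has flux exactly
   [(q / n) (x - z)], but its slope [phi^-1 (q s / n)] is merely continuous. A sum of smooth ramps
   of mesh [w] replaces it, at the price of a flux error [2 q w / n]. In [F >= 2 q] one copy of [q]
   balances the divergence of the flux; the other shows that the integral of the truncation is
   [O(w)], and [w] tends to 0. The identity [div (x - z) = n], integrated against the truncation,
   supplies this divergence and also acts as a Poincare inequality in the maximum principle. Across
   an annulus [M] may more than double, and then the growth step no longer applies to the whole
   annulus; the lengths needed for successive doublings are added up instead, and their sum is again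
   controlled by [P]. *)
Require Import Defs.
From HB Require Import structures.
From mathcomp Require Import all_boot all_order all_algebra finmap.
From mathcomp Require Import all_classical all_reals all_analysis.
From mathcomp Require Import measurable_realfun.
From mathcomp Require Import ring lra.

Import Order.TTheory GRing.Theory Num.Theory.
Import numFieldNormedType.Exports.

Local Open Scope classical_set_scope.
Local Open Scope ring_scope.

(** * Integration over row vectors *)

Section tuple_integral.
Context {R : realType}.
Local Notation mR := (measurableTypeR R).

Definition tuple_box n (K : R) : set (n.-tuple mR) :=
  [set t | forall i, `|tnth t i : R| <= K].

Definition tset n (i : 'I_n) (x : R) (t : n.-tuple mR) : n.-tuple mR :=
  [tuple if j == i then x else tnth t j | j < n].

Lemma tset_cons0 n x (y : R) (t : n.-tuple mR) :
  tset n.+1 ord0 x (cons_pair (y, t)) = cons_pair (x, t).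
Proof.
apply: eq_from_tnth => j; rewrite tnth_mktuple.
case: (unliftP ord0 j) => [k|] ->; last by rewrite eqxx !tnth0.
by rewrite !tnthS; case: eqP.
Qed.

Lemma tset_consS n (i : 'I_n) x (y : R) (t : n.-tuple mR) :
  tset n.+1 (lift ord0 i) x (cons_pair (y, t)) = cons_pair (y, tset n i x t).
Proof.
apply: eq_from_tnth => j; rewrite tnth_mktuple.
case: (unliftP ord0 j) => [k|] ->; last by rewrite !tnth0.
by rewrite !tnthS tnth_mktuple (inj_eq lift_inj).
Qed.

Lemma cons_pair_box n (K : R) :
  @cons_pair R n @^-1` tuple_box n.+1 K = `[- K, K]%classic `*` tuple_box n K.
Proof.
apply/seteqP; split => -[x t] /=.
  move=> h; split.
    by have := h ord0; rewrite tnth0 /= in_itv/= -ler_norml.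
  by move=> i; have := h (lift ord0 i); rewrite tnthS.
rewrite in_itv/= -ler_norml => -[hx ht] i.
by case: (unliftP ord0 i) => [k|] ->; rewrite ?tnth0 ?tnthS//; exact: ht.
Qed.

Lemma measurable_tuple_box n K : measurable (tuple_box n K).
Proof.
have -> : tuple_box n K = \bigcap_(i in [set: 'I_n])
    ((fun t : n.-tuple mR => tnth t i) @^-1` `[- K, K]%classic).
  apply/seteqP; split.
    by move=> t h i _; rewrite /= in_itv/= -ler_norml.
  by move=> t h i; have := h i Logic.I; rewrite /= in_itv/= -ler_norml.
apply: fin_bigcap_measurable => // i _.
by rewrite -[X in measurable X]setTI; exact: measurable_tnth.
Qed.

Lemma tuple_box_lty n K : (lebesgue_tuple n (tuple_box n K) < +oo :> \bar R)%E.
Proof.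
elim: n => [|n IH] /=; first by rewrite diracE ltry.
rewrite /lebesgue_cons /pushforward.
rewrite [X in (X < _)%E](_ : _ =
   (@lebesgue_measure R \x lebesgue_tuple n)%E (@cons_pair R n @^-1` tuple_box n.+1 K))//.
rewrite cons_pair_box product_measure1E//; last exact: measurable_tuple_box.
apply: lte_mul_pinfty => //.
have h : @lebesgue_measure R `[- K, K]%classic \is a fin_num.
  by rewrite lebesgue_measure_itv/=; case: ifP => _; rewrite -?EFinB.
exact: h.
Qed.

Lemma integral_derive_compact (H D : R -> R) (K : R) :
  (forall x : R, is_derive x (1 : R) H (D x)) -> continuous D ->
  (forall x, K < `|x| -> H x = 0 /\ D x = 0) ->
  (\int[@lebesgue_measure R]_x (D x)%:E = 0)%E.
Proof.
move=> dH cD sup0.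
(* [K] may be negative; this bound is positive and exceeds [K], so both endpoints of the interval
   lie where [H] vanishes. *)
pose L : R := `|K| + 1.
have L0 : 0 < L by rewrite /L ltr_wpDl.
have KL : K < L by rewrite /L (le_lt_trans (ler_norm _))// ltrDl.
have LL : - L < L by rewrite gtrN.
have -> : (\int[@lebesgue_measure R]_x (D x)%:E =
           \int[@lebesgue_measure R]_(x in `[(- L)%R, L]) (D x)%:E)%E.
  rewrite [RHS]integral_mkcond; apply: eq_integral => x _.
  rewrite patchE; case: ifPn => //; rewrite notin_setE/= in_itv/= -ler_norml => /negP.
  by rewrite -ltNge => /(lt_trans KL)/sup0[_ ->].
rewrite (@continuous_FTC2 _ _ H)//.
- by rewrite !(sup0 _ _).1 ?subee// ?normrN gtr0_norm.
- exact: continuous_subspaceT.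
- have dcH x : {for x, continuous H}.
    by apply: differentiable_continuous; apply/derivable1_diffP; case: (dH x).
  split.
  + by move=> x _; case: (dH x).
  + exact/cvg_at_right_filter/dcH.
  + exact/cvg_at_left_filter/dcH.
- by move=> x _; rewrite derive1E; have [_] := dH x.
Qed.

Lemma integrable_tuple_box n (D : n.-tuple mR -> R) (K C : R) :
  measurable_fun setT D -> (forall t, `|D t| <= C) ->
  (forall t, ~ tuple_box n K t -> D t = 0) ->
  (lebesgue_tuple n).-integrable setT (EFin \o D).
Proof.
move=> mD bD sD.
have -> : EFin \o D = (EFin \o D) \_ (tuple_box n K).
  apply/funext => t; rewrite patchE; case: ifPn => //.
  by rewrite notin_setE => /sD /= ->.
apply/(integrable_mkcond _ (measurable_tuple_box n K)).
apply: measurable_bounded_integrable.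
- exact: measurable_tuple_box.
- exact: tuple_box_lty.
- exact: measurable_funTS.
- by exists C; split; [exact: num_real|move=> y Cy t _; exact: le_trans (bD _) (ltW Cy)].
Qed.

(** Along a line parallel to axis [i] the derivative integrates to 0, and Fubini lets that
    integration come first: the head is kept fixed when [i] lies in the tail, the tail when [i] is
    the head. *)
Lemma integral_tuple_derive n (i : 'I_n) (H D : n.-tuple mR -> R) (K C : R) :
  measurable_fun setT D -> (forall t, `|D t| <= C) ->
  (forall t, ~ tuple_box n K t -> H t = 0 /\ D t = 0) ->
  (forall t x, is_derive (x : R) (1 : R) (fun y : R => H (tset n i y t) : R)
                 (D (tset n i x t))) ->
  (forall t, continuous (fun x => D (tset n i x t))) ->
  (\int[lebesgue_tuple n]_t (D t)%:E = 0)%E.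
Proof.
elim: n => [|n IH] in i H D *; first by case: i.
move=> mD bD sup0 dH cD.
have iD := integrable_tuple_box n.+1 D K C mD bD (fun t h => (sup0 t h).2).
have mDc : measurable_fun setT (D \o @cons_pair R n).
  by apply: measurableT_comp => //; exact: measurable_cons_pair.
have iDc : (@lebesgue_measure R \x lebesgue_tuple n)%E.-integrable setT
    (EFin \o (D \o @cons_pair R n)).
  have -> : EFin \o (D \o @cons_pair R n) =
            (EFin \o (D \o @cons_pair R n)) \_ (`[- K, K]%classic `*` tuple_box n K).
    apply/funext => t; rewrite patchE; case: ifPn => //.
    by rewrite notin_setE -cons_pair_box => /sup0 /= [_ ->].
  have mX : measurable (`[- K, K]%classic `*` tuple_box n K : set (mR * n.-tuple mR)).
    by apply: measurableX => //; exact: measurable_tuple_box.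
  apply/(integrable_mkcond _ mX).
  apply: measurable_bounded_integrable.
  - exact: mX.
  - rewrite -cons_pair_box; exact: (tuple_box_lty n.+1).
  - exact: measurable_funTS.
  - by exists C; split; [exact: num_real|move=> y Cy t _; exact: le_trans (bD _) (ltW Cy)].
have -> : (\int[lebesgue_tuple n.+1]_t (D t)%:E =
    \int[(@lebesgue_measure R \x lebesgue_tuple n)]_p (D (cons_pair p))%:E)%E.
  have := @integral_pushforward _ _ _ _ _ _ (@measurable_cons_pair R n)
   (@lebesgue_measure R \x lebesgue_tuple n)%E setT (EFin \o D).
  apply => //; exact/measurable_EFinP.
have := iDc => /integral12_prod_meas1 e12.
have := iDc => /integral21_prod_meas1 e21.
case: (unliftP ord0 i) => [k ik|i0].
- rewrite -e12; apply: integral0_eq => x _.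
  rewrite /fubini_F; apply: (IH k (fun t => H (cons_pair (x, t)))).
  + by apply: measurableT_comp => //; apply: measurableT_comp => //; exact: measurable_cons_pair.
  + by move=> t; exact: bD.
  + move=> t nb; apply: sup0 => b; apply: nb => j.
    by have := b (lift ord0 j); rewrite tnthS.
  + move=> t y; have := dH (cons_pair (x, t)) y.
    by rewrite ik tset_consS; under eq_fun do rewrite tset_consS.
  + by move=> t; have := cD (cons_pair (x, t)); rewrite ik; under eq_fun do rewrite tset_consS.
- rewrite -e21; apply: integral0_eq => t _.
  rewrite /fubini_G; apply: (integral_derive_compact (fun x => H (cons_pair (x, t))) _ K).
  + move=> x; have := dH (cons_pair (0, t)) x.
    by rewrite i0 tset_cons0; under eq_fun do rewrite tset_cons0.
  + by have := cD (cons_pair (0, t)); rewrite i0; under eq_fun do rewrite tset_cons0.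
  + move=> x Kx; apply: sup0 => b; have := b ord0; rewrite tnth0 /=.
    by rewrite leNgt Kx.
Qed.

End tuple_integral.

(** * Borel and Lebesgue measurability on row vectors *)

Section lebesgue_rV_theory.
Context {R : realType} {n : nat}.
Local Notation E := 'rV[R]_n.
Local Notation mu := (@lebesgue_rV R n).
Local Notation bmu := (@borel_lebesgue_rV R n).
Local Notation LE := (caratheodory_type (mu_ext bmu)).
Local Notation BE := (g_sigma_algebra_preimageType (@tuple_of_rV R n)).

Lemma measurable_coord i : measurable_fun [set: BE] (fun x : E => x 0 i : R).
Proof.
move=> _ Y mY; rewrite setTI.
exists ((fun t : n.-tuple (measurableTypeR R) => tnth t i) @^-1` Y).
  by rewrite -[X in measurable X]setTI; apply: measurable_tnth.
by rewrite setTI; apply/seteqP; split => x /=; rewrite tnth_mktuple.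
Qed.

(** An open set is a countable union of balls with rational centres and radii [1 / k.+1]; in the sup
    norm such a ball is a box, hence a finite intersection of coordinate strips. *)
Lemma open_borel (U : set E) : open U -> measurable (U : set BE).
Proof.
move=> oU.
pose B (p : 'rV[rat]_n * nat) : set E :=
  ball (\row_i ratr (p.1 0 i) : E) (p.2.+1%:R^-1 : R).
have mB p : measurable (B p : set BE).
  have -> : B p = \bigcap_(i in [set: 'I_n])
     ((fun x : E => x 0 i : R) @^-1` ball (ratr (p.1 0 i) : R) (p.2.+1%:R^-1 : R)).
    apply/seteqP; split.
      by move=> x [_ Bx] i _; have := Bx 0 i; rewrite /= mxE.
    move=> x Bx; split => //; move=> i j; rewrite ord1 mxE; exact: (Bx j).
  apply: fin_bigcap_measurable => // i _.
  rewrite -[X in measurable X]setTI; apply: measurable_coord => //.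
  by apply: open_measurable; exact: ball_open.
have -> : U = \bigcup_p (if pselect (B p `<=` U) then B p else set0).
  apply/seteqP; split; last first.
    by move=> x [p _]; case: pselect => // pU /pU.
  move=> x Ux.
  have /nbhs_ballP[e /= e0 xe] := oU x Ux.
  have e20 : 0 < e / 2 by rewrite divr_gt0.
  (* A ball of radius below [e / 2] that contains [x] stays within [e] of [x]. *)
  have [k _ /(_ k (leqnn k)) /= ke] := near_infty_natSinv_lt (PosNum e20).
  have H i : exists q : rat, `|x 0 i - ratr q| < k.+1%:R^-1.
    have k0 : (0 : R) < k.+1%:R^-1 by rewrite invr_gt0.
    have : x 0 i - k.+1%:R^-1 < x 0 i + k.+1%:R^-1.
      by rewrite ltrBlDr -addrA ltrDl addr_gt0.
    move/rat_in_itvoo => [q]; rewrite in_itv/= => /andP[q1 q2].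
    by exists q; rewrite ltr_distlC q1 q2.
  pose c : 'rV[rat]_n := \row_i sval (cid (H i)).
  have Bcx : B (c, k) x.
    split; [by rewrite invr_gt0 | move=> i j; rewrite ord1 !mxE /=; apply: ball_sym; rewrite -ball_normE /=].
    by case: (cid (H j)) => q.
  exists (c, k) => //; case: pselect => // -[] y By; apply: xe.
  apply: le_ball (ball_triangle (ball_sym Bcx) By).
  by rewrite /= [leRHS](splitr e) lerD// ltW.
apply: (@countable_bigcupT_measurable _ BE); first exact: countableP.
by move=> p; case: pselect => ?; [exact: mB|exact: measurable0].
Qed.

Lemma borel_lebesgue (A : set E) :
  measurable (A : set BE) -> measurable (A : set LE).
Proof. exact: caratheodory_measurable_mu_ext. Qed.

Lemma open_lebesgue (U : set E) : open U -> measurable (U : set LE).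
Proof. by move=> oU; apply/borel_lebesgue/open_borel. Qed.

Lemma continuous_borel (f : E -> R) : continuous f ->
  measurable_fun [set: BE] (f : BE -> R).
Proof.
move=> cf mT; apply: (measurability _ (RGenOpens.measurableE R)) => //.
move=> _ [_ [a [b ->]] <-]; rewrite setTI.
apply: open_borel; apply: open_comp; first by move=> x _; exact: cf.
exact: interval_open.
Qed.

Lemma continuous_lebesgue (f : E -> R) : continuous f ->
  measurable_fun [set: LE] (f : LE -> R).
Proof.
move=> cf _ Y mY; rewrite setTI; apply: borel_lebesgue.
by rewrite -[X in measurable X]setTI; exact: continuous_borel.
Qed.

Lemma lebesgue_rV_borel (A : set E) : measurable (A : set BE) -> mu A = bmu A.
Proof. exact: measurable_mu_extE. Qed.

Lemma cube_lty (K : R) : (mu [set x : E | forall i, (`|x 0 i| <= K)%R] < +oo)%E.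
Proof.
rewrite lebesgue_rV_borel.
  rewrite /borel_lebesgue_rV /pushforward.
  rewrite [X in lebesgue_tuple n X](_ : _ = tuple_box n K); first exact: tuple_box_lty.
  by apply/seteqP; split => t h i; have := h i; rewrite /= mxE.
exists (tuple_box n K); first exact: measurable_tuple_box.
by rewrite setTI; apply/seteqP; split => t h i; have := h i; rewrite /= tnth_mktuple.
Qed.

(** Two changes of variables: the identity from the completed sigma-algebra to the Borel one carries
    [mu] to [borel_lebesgue_rV], which is itself the image of the measure on tuples. *)
Lemma integral_rV_tuple (h : E -> R) :
  measurable_fun [set: BE] (h : BE -> R) ->
  (lebesgue_tuple n).-integrable setT (EFin \o h \o @rV_of_tuple R n) ->
  (\int[mu]_x (h x)%:E = \int[lebesgue_tuple n]_t (h (rV_of_tuple t))%:E)%E.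
Proof.
move=> mh ih.
have mid : measurable_fun [set: LE] (idfun : LE -> BE).
  by move=> _ Y mY; rewrite setTI; exact: borel_lebesgue.
have emu (f : BE -> \bar R) :
    (\int[pushforward mu (idfun : LE -> BE)]_x f x = \int[bmu]_x f x)%E.
  by apply: eq_measure_integral => A mA _; apply: lebesgue_rV_borel.
rewrite -(@integral_pushforward _ _ _ _ _ _ (@measurable_rV_of_tuple R n)
   (lebesgue_tuple n) setT (EFin \o h))//; last exact/measurable_EFinP.
rewrite -[RHS](emu (EFin \o h)) integral_pushforward//; first exact/measurable_EFinP.
have ib : bmu.-integrable setT (EFin \o h).
  apply: integrable_pushforward => //; exact/measurable_EFinP.
rewrite preimage_setT; apply/integrableP; split.
  apply/measurable_EFinP => _ Y mY; rewrite setTI; apply: borel_lebesgue.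
  by rewrite -[X in measurable X]setTI; exact: mh.
have /integrableP[_] := ib; rewrite -emu ge0_integral_pushforward//.
by apply: measurableT_comp => //; exact/measurable_EFinP.
Qed.

Lemma integral_partial_compact (i : 'I_n) (f : E -> R) (K C : R) :
  (forall x, derivable f x (delta_mx 0 i : E)) ->
  continuous (partial i f) ->
  (forall x, `|partial i f x| <= C) ->
  (forall (x : E) j, K < `|x 0 j| -> f x = 0 /\ partial i f x = 0) ->
  (\int[mu]_x (partial i f x)%:E = 0)%E.
Proof.
move=> df cf bf sup0.
have mp := continuous_borel _ cf.
have mpt : measurable_fun setT (partial i f \o @rV_of_tuple R n).
  by apply: measurableT_comp mp _ => //; exact: measurable_rV_of_tuple.
have supt (t : n.-tuple (measurableTypeR R)) : ~ tuple_box n K t ->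
    f (rV_of_tuple t) = 0 /\ partial i f (rV_of_tuple t) = 0.
  move=> /existsNP[j /negP]; rewrite -ltNge => Kj.
  by apply: (sup0 _ j); rewrite mxE.
rewrite integral_rV_tuple//; last first.
  apply: (integrable_tuple_box n (partial i f \o @rV_of_tuple R n) K C) => //.
    by move=> t; exact: bf.
  by move=> t /supt[].
have rVtset (t : n.-tuple (measurableTypeR R)) (x y : R) :
    rV_of_tuple (tset n i (x + y) t) =
    rV_of_tuple (tset n i x t) + y *: (delta_mx 0 i : E).
  apply/rowP => j; rewrite !mxE !tnth_mktuple; case: eqP => _ /=.
    by rewrite mulr1.
  by rewrite mulr0 addr0.
apply: (integral_tuple_derive n i (f \o @rV_of_tuple R n)
  (partial i f \o @rV_of_tuple R n) K C) => //.
- by move=> t; exact: bf.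
- move=> t x.
  have := df (rV_of_tuple (tset n i x t)); rewrite /derivable => dfx.
  have eqf : (fun h : R => h^-1 *: (((fun y : R => (f \o @rV_of_tuple R n) (tset n i y t) : R)
        \o shift x) (h *: (1 : R)) - (f \o @rV_of_tuple R n) (tset n i x t))) =
      (fun h : R => h^-1 *: ((f \o shift (rV_of_tuple (tset n i x t)))
        (h *: (delta_mx 0 i : E)) - f (rV_of_tuple (tset n i x t)))).
    apply/funext => h /=; rewrite /GRing.scale /= mulr1.
    by rewrite (addrC h x) rVtset (addrC (h *: _)).
  split; first by rewrite /derivable eqf.
  by rewrite /derive eqf.
- move=> t x; apply: continuous_comp (cf _).
  rewrite /continuous_at.
  have -> : (fun y : R => rV_of_tuple (tset n i y t)) =
     (fun y : R => rV_of_tuple (tset n i 0 t) + y *: (delta_mx 0 i : E)).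
    by apply/funext => y; rewrite -rVtset add0r.
  have h : {for x, continuous ((cst (rV_of_tuple (tset n i 0 t)) : R -> E) +
      (fun y : R => y *: (delta_mx 0 i : E)))}.
    by apply: continuousD; [exact: cst_continuous|exact: scalel_continuous].
  have e0 : rV_of_tuple (tset n i x t) =
      rV_of_tuple (tset n i 0 t) + x *: (delta_mx 0 i : E) by rewrite -rVtset add0r.
  move: h; rewrite /prop_for /continuous_at.
  rewrite [X in _ --> X -> _](_ : _ = rV_of_tuple (tset n i x t)); last by rewrite e0.
  exact: id.
Qed.

End lebesgue_rV_theory.

(** * Smooth functions *)

Section directional.
Context {R : realType} {V : normedModType R}.
Implicit Types (f g : V -> R) (x v : V).

(** On the line [h *: v + x] a directional derivative is an ordinary one, so the chain rule
    [is_derive_comp_dir] is inherited from the real line. *)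
Lemma is_derive_line f x v df :
  is_derive x v f df <-> is_derive (0 : R) (1 : R) (fun h : R => f (h *: v + x)) df.
Proof.
have e : (fun h : R => h^-1 *: (((fun h : R => f (h *: v + x)) \o shift 0) (h *: (1 : R))
     - f (0 *: v + x))) = (fun h : R => h^-1 *: ((f \o shift x) (h *: v) - f x)).
  by apply/funext => h /=; rewrite scale0r add0r addr0 /GRing.scale /= mulr1.
split=> -[dfx vfx].
  by split; [rewrite /derivable e|rewrite /derive e].
by split; [move: dfx; rewrite /derivable e|move: vfx; rewrite /derive e].
Qed.

Lemma is_derive1_comp_R (f g : R -> R) (x df dg : R) :
  is_derive x (1 : R) f df -> is_derive (f x) (1 : R) g dg ->
  is_derive x (1 : R) (g \o f) (dg * df).
Proof.
move=> [df1 df2] [dg1 dg2]; split.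
  apply/derivable1_diffP; apply: differentiable_comp; exact/derivable1_diffP.
by rewrite -derive1E derive1_comp// !derive1E df2 dg2.
Qed.

Lemma is_derive_comp_dir f (g : R -> R) x v (df dg : R) :
  is_derive x v f df -> is_derive (f x) (1 : R) g dg ->
  is_derive x v (g \o f) (dg * df).
Proof.
move=> /is_derive_line h1 h2; apply/is_derive_line.
apply: (is_derive1_comp_R (fun h : R => f (h *: v + x)) g) => //.
by rewrite scale0r add0r.
Qed.

Lemma is_derive1_continuous (f : R -> R) (x df : R) :
  is_derive x (1 : R) f df -> {for x, continuous f}.
Proof.
by move=> [df1 _]; apply: differentiable_continuous; exact/derivable1_diffP.
Qed.

Lemma is_derive_MVT (f df : R -> R) (a b : R) : a < b ->
  (forall x : R, is_derive x (1 : R) f (df x)) ->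
  exists2 c, a < c < b & f b - f a = df c * (b - a).
Proof.
move=> ab dff; have [|c] := @MVT R f df a b ab (fun (x : R) _ => dff x).
  by apply: continuous_subspaceT => x; exact: is_derive1_continuous (dff x).
by rewrite in_itv/= => h1 h2; exists c.
Qed.

End directional.

Section Ck.
Context {R : realType} {V : normedModType R} {I : Type} (e : I -> V).
Implicit Types (f g : V -> R).

(** Recursion on [k] lets sums, products and compositions be treated by induction. The directions
    [e] are a parameter: the coordinate axes give smoothness on R^n ([smoothP]), the single
    direction [1] gives functions on the real line. *)
Fixpoint Ck k f : Prop := continuous f /\
  if k is k'.+1 then forall i, (forall x, derivable f x (e i)) /\
    Ck k' (fun x => 'D_(e i) f x)
  else True.

Lemma Ck_cont k f : Ck k f -> continuous f.
Proof. by case: k => [|k] []. Qed.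

Lemma CkW k f : Ck k.+1 f -> Ck k f.
Proof.
elim: k f => [|k IH] f; first by case.
case=> cf h; split => // i; have [h1 h2] := h i; split=> //; exact: IH.
Qed.

Lemma Ck_cst k (a : R) : Ck k (fun=> a).
Proof.
elim: k a => [|k IH] a; split => //; [exact: cst_continuous|exact: cst_continuous|].
move=> i; split; first by move=> x; exact: derivable_cst.
by under eq_fun do rewrite derive_cst; exact: IH.
Qed.

Lemma CkD k f g : Ck k f -> Ck k g -> Ck k (fun x => f x + g x).
Proof.
elim: k f g => [|k IH] f g [cf hf] [cg hg]; split.
- by move=> x; apply: continuousD; [exact: cf|exact: cg].
- by [].
- by move=> x; apply: continuousD; [exact: cf|exact: cg].
move=> i; have [h1 h2] := hf i; have [h3 h4] := hg i; split.
  by move=> x; apply: derivableD.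
rewrite (_ : (fun x => _) = (fun x => 'D_(e i) f x + 'D_(e i) g x)).
  exact: IH.
by apply/funext => x; rewrite -deriveD.
Qed.

Lemma CkM k f g : Ck k f -> Ck k g -> Ck k (fun x => f x * g x).
Proof.
elim: k f g => [|k IH] f g.
  move=> [cf hf] [cg hg]; split => //.
  by move=> x; apply: continuousM; [exact: cf|exact: cg].
move=> Cf Cg; have [cf hf] := Cf; have [cg hg] := Cg; split.
  by move=> x; apply: continuousM; [exact: cf|exact: cg].
move=> i; have [h1 h2] := hf i; have [h3 h4] := hg i; split.
  by move=> x; apply: derivableM.
rewrite (_ : (fun x => _) = (fun x => f x * 'D_(e i) g x + g x * 'D_(e i) f x)).
  by apply: CkD; apply: IH => //; exact: CkW.
by apply/funext => x; apply: (deriveM (h1 x) (h3 x)).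
Qed.

Lemma CkN k f : Ck k f -> Ck k (fun x => - f x).
Proof.
move=> Cf; rewrite (_ : (fun x => _) = (fun x => -1 * f x)).
  exact: CkM (Ck_cst _ _) _.
by apply/funext => x; rewrite mulN1r.
Qed.

Lemma Ck_sum k (J : Type) (s : seq J) (F : J -> V -> R) :
  (forall j, Ck k (F j)) -> Ck k (fun x => \sum_(j <- s) F j x).
Proof.
move=> CF; elim: s => [|j s IH].
  by under eq_fun do rewrite big_nil; exact: Ck_cst.
by under eq_fun do rewrite big_cons; exact: CkD.
Qed.

(** [D] lists the successive derivatives of the outer function on a set [U] containing the values of
    [f]. Differentiating [D m \o f] produces the factor [D m.+1 \o f], so the induction runs for all
    [m] at once. *)
Lemma Ck_comp (U : set R) (D : nat -> R -> R) k m f :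
  (forall m (y : R), U y -> is_derive y (1 : R) (D m) (D m.+1 y)) ->
  (forall x, U (f x)) -> Ck k f -> Ck k (D m \o f).
Proof.
move=> dD Uf; elim: k m f Uf => [|k IH] m f Uf Cf.
  split => //; move=> x; apply: continuous_comp; first exact: (Ck_cont _ _ Cf).
  exact: is_derive1_continuous (dD m _ (Uf x)).
have [cf hf] := Cf; split.
  move=> x; apply: continuous_comp; first exact: cf.
  exact: is_derive1_continuous (dD m _ (Uf x)).
move=> i; have [h1 h2] := hf i.
have h x : is_derive x (e i) (D m \o f) (D m.+1 (f x) * 'D_(e i) f x).
  by apply: is_derive_comp_dir; [exact: derivableP|exact: dD].
split; first by move=> x; case: (h x).
rewrite (_ : (fun x => _) = (fun x => (D m.+1 \o f) x * 'D_(e i) f x)).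
  apply: CkM => //; apply: IH => //; exact: CkW.
by apply/funext => x; have [_ ->] := h x.
Qed.

End Ck.

Section CkR.
Context {R : realType}.

Lemma Ck_id k : Ck (fun _ : unit => 1 : R) k (idfun : R -> R).
Proof.
case: k => [|k]; split => //; [by move=> x|by move=> x|].
move=> i; split; first by move=> x; exact: derivable_id.
rewrite (_ : (fun x => _) = (fun=> 1)); first exact: Ck_cst.
by apply/funext => x; exact: derive_id.
Qed.

Definition D1 (f : R -> R) m := iter m (fun g x => 'D_(1 : R) g x) f.

Lemma Ck_D1 f : (forall k, Ck (fun _ : unit => 1 : R) k f) ->
  forall m (y : R), [set: R] y -> is_derive y (1 : R) (D1 f m) (D1 f m.+1 y).
Proof.
move=> Cf m y _.
have : forall k, Ck (fun _ : unit => 1 : R) k (D1 f m).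
  elim: m => [|m IH] k //=; by have [_ /(_ tt)[]] := IH k.+1.
by move=> /(_ 1)[_ /(_ tt)[h _]]; exact: derivableP.
Qed.

(** The coefficients are the falling factorials [p (p - 1) ... (p - m + 1)]. The case [p = -1]
    serves for the quotient in [chi], the case [p = 2^-1] for the smoothed distance. *)
Lemma powR_D (p : R) : exists D : nat -> R -> R, (D 0 = fun x : R => x `^ p) /\
  forall m (y : R), [set y : R | 0 < y] y -> is_derive y (1 : R) (D m) (D m.+1 y).
Proof.
exists (fun m x => (\prod_(k < m) (p - k%:R)) * x `^ (p - m%:R)); split.
  by apply/funext => x; rewrite big_ord0 mul1r subr0.
move=> m y /= y0; rewrite big_ord_recr /= -mulrA.
have -> : p - m.+1%:R = p - m%:R - 1 by rewrite -natr1; ring.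
by apply: is_deriveZ; exact: is_derive1_powR.
Qed.

End CkR.

(** * A smooth step and its primitive *)

Section smooth_step.
Context {R : realType}.
Implicit Types (p : {poly R}) (x y : R).

(** By induction on the polynomial: half of the exponent absorbs the new factor [y], since
    [y <= (2 / eps) exp (eps y / 2)]. This is what makes all derivatives of the flat function vanish
    at 0. *)
Lemma horner_le_expR p (eps : R) : 0 < eps ->
  exists2 C, 0 <= C & forall y, 0 < y -> `|p.[y]| <= C * expR (eps * y).
Proof.
elim/poly_ind: p eps => [|p c IH] eps e0.
  by exists 0 => // y _; rewrite horner0 normr0 mul0r.
have e20 : 0 < eps / 2 by rewrite divr_gt0.
have [C C0 hC] := IH _ e20; exists (C * (2 / eps) + `|c|).
  by rewrite addr_ge0// mulr_ge0// divr_ge0// ltW.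
move=> y y0; rewrite hornerMXaddC (le_trans (ler_normD _ _))// mulrDl lerD//; last first.
  rewrite ler_peMr// -expR0 ler_expR; apply: mulr_ge0; exact: ltW.
rewrite normrM (gtr0_norm y0).
have yE : y <= 2 / eps * expR (eps / 2 * y).
  have := expR_ge1Dx (eps / 2 * y) => h.
  have -> : y = 2 / eps * (eps / 2 * y) by field; rewrite gt_eqF.
  rewrite ler_pM2l ?divr_gt0//.
  have -> : eps / 2 * (2 / eps * (eps / 2 * y)) = eps / 2 * y by field; rewrite gt_eqF.
  lra.
have -> : eps * y = eps / 2 * y + eps / 2 * y by field.
rewrite expRD; apply: le_trans (ler_pM _ _ (hC y y0) yE) _ => //; first exact: ltW.
by rewrite le_eqVlt; apply/orP; left; apply/eqP; ring.
Qed.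

Lemma is_derive0_quadratic (f : R -> R) (C : R) :
  (forall h, `|f h| <= C * h ^+ 2) -> is_derive (0 : R) (1 : R) f 0.
Proof.
move=> fC; have f0 : f 0 = 0.
  by apply/eqP; rewrite -normr_le0 (le_trans (fC 0))// expr0n mulr0.
have C0 : 0 <= C by have := fC 1; rewrite expr1n mulr1; apply: le_trans.
suff h : (fun h : R => h^-1 *: ((f \o shift 0) (h *: (1 : R)) - f 0)) @ 0^' --> (0 : R).
  by split; [apply/cvg_ex; exists 0|apply/cvg_lim].
apply/cvgrPdist_le => /= e e0.
near=> t.
have t0 : t != 0 by near: t; exact: nbhs_dnbhs_neq.
rewrite f0 /= addr0 sub0r subr0 normrN /GRing.scale /= mulr1 normrM normfV.
rewrite ler_pdivrMl ?normr_gt0//.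
apply: le_trans (fC t) _; rewrite -normr_id -real_normK ?num_real// expr2 mulrCA.
rewrite normr_id ler_pM2l ?normr_gt0//.
have : `|t| <= e / (C + 1).
  near: t; apply: dnbhs0_le; rewrite divr_gt0// ltr_wpDl//.
rewrite ler_pdivlMr ?ltr_wpDl// => h.
by apply: le_trans h; rewrite mulrC ler_wpM2l// lerDl.
Unshelve. all: by end_near. Qed.

(** The [m]-th derivative of [exp (- 1 / x)] is [p (1 / x) exp (- 1 / x)] with [p] this polynomial:
    one differentiation replaces [p] by [X^2 (p - p')]. *)
Definition flat_poly m : {poly R} :=
  iter m (fun p => 'X ^+ 2 * (p - p^`())) 1.

Definition flatD m x : R :=
  if 0 < x then (flat_poly m).[x^-1] * expR (- x^-1) else 0.

Lemma is_derive_flatD m x : is_derive x (1 : R) (flatD m) (flatD m.+1 x).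
Proof.
case: (ltgtP 0 x) => [x0|x0|<-].
- have dV : is_derive x (1 : R) (fun y : R => y^-1) (- x ^- 2).
    split; first by apply: (derivableV (f := idfun)); [rewrite gt_eqF|exact: derivable_id].
    rewrite (deriveV (f := idfun)); [|by rewrite gt_eqF|exact: derivable_id].
    by rewrite derive_id /GRing.scale /= mulr1.
  have d1 := is_derive1_comp_R _ _ _ _ _ dV (is_derive_poly (flat_poly m) x^-1).
  have d2 : is_derive x (1 : R) (fun y : R => expR (- y^-1)) (expR (- x^-1) * x ^- 2).
    apply: (is_derive1_comp_R (fun y : R => - y^-1) (@expR R)).
    by have := is_deriveN dV; rewrite opprK.
  apply: (@near_eq_is_derive _ _ _
     (fun y : R => (flat_poly m).[y^-1] * expR (- y^-1))).
    near=> y; rewrite /flatD ifT//.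
    by near: y; exact: lt_nbhsr.
  have d3 := is_deriveM d1 d2.
  apply: (is_derive_eq d3).
  rewrite /flatD x0 /= !hornerE /= /GRing.scale /= exprVn; ring.
- have -> : flatD m.+1 x = 0 by rewrite /flatD ltNge (ltW x0).
  apply: (@near_eq_is_derive _ _ _ (cst 0)).
    near=> y; rewrite /flatD ifF//.
    by apply/negbTE; rewrite -leNgt ltW//; near: y; exact: lt_nbhsl.
- have -> : flatD m.+1 0 = 0 by rewrite /flatD ltxx.
  (* At the origin an estimate is needed: the extra factor ['X ^+ 2] turns the exponential bound
     into [|flatD m h| <= C h^2]. *)
  have [C C0 hC] := horner_le_expR ('X ^+ 2 * flat_poly m) 1 ltr01.
  apply: (is_derive0_quadratic _ C) => h; rewrite /flatD.
  case: ifPn => h0; last by rewrite normr0 mulr_ge0// sqr_ge0.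
  have hV : 0 < h^-1 by rewrite invr_gt0.
  have := hC _ hV; rewrite mul1r hornerM hornerXn => k.
  rewrite normrM (gtr0_norm (expR_gt0 _)) expRN ler_pdivrMr ?expR_gt0//.
  rewrite normrM (gtr0_norm (exprn_gt0 _ hV)) in k.
  have -> : `|(flat_poly m).[h^-1]| = h ^+ 2 * (h^-1 ^+ 2 * `|(flat_poly m).[h^-1]|).
    by rewrite mulrA -exprMn divff ?expr1n ?mul1r// gt_eqF.
  rewrite (_ : C * h ^+ 2 * expR h^-1 = h ^+ 2 * (C * expR h^-1)); last by ring.
  by rewrite ler_pM2l ?exprn_gt0.
Unshelve. all: by end_near. Qed.

Lemma flat_ge0 x : 0 <= flatD 0 x.
Proof. by rewrite /flatD; case: ifP => // _; rewrite hornerE mul1r expR_ge0. Qed.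

Lemma flat_gt0 x : 0 < x -> 0 < flatD 0 x.
Proof. by move=> x0; rewrite /flatD x0 hornerE mul1r expR_gt0. Qed.

Lemma flat_le0 x : x <= 0 -> flatD 0 x = 0.
Proof. by move=> x0; rewrite /flatD ltNge x0. Qed.

Definition step_den x : R := flatD 0 x + flatD 0 (1 - x).

Lemma step_den_gt0 x : 0 < step_den x.
Proof.
have [x0|x0] := ltP 0 x; first by rewrite ltr_pwDl ?flat_gt0// flat_ge0.
by rewrite ltr_wpDl ?flat_ge0// flat_gt0//; lra.
Qed.

(** The usual smooth step, 0 for [x <= 0] and 1 for [x >= 1]. The quotient is written with a real
    power so that [powR_D] gives its smoothness; the lock prevents unfolding. *)
Definition chi : R -> R := locked (fun x => flatD 0 x * (step_den x) `^ (-1)).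

Lemma chiE x : chi x = flatD 0 x / step_den x.
Proof. by rewrite /chi -lock powR_inv1// ltW// step_den_gt0. Qed.

Lemma Ck_chi k : Ck (fun _ : unit => 1 : R) k chi.
Proof.
rewrite /chi -lock.
have Cflat (f : R -> R) : Ck (fun _ : unit => 1 : R) k f ->
    Ck (fun _ : unit => 1 : R) k (fun x => flatD 0 (f x)).
  move=> Cf; apply: (Ck_comp _ setT flatD k 0 f) => // m y _.
  exact: is_derive_flatD.
have C1 : Ck (fun _ : unit => 1 : R) k (fun x : R => flatD 0 x) by apply: Cflat; exact: Ck_id.
have Cden : Ck (fun _ : unit => 1 : R) k step_den.
  apply: CkD => //; apply: (Cflat (fun x => 1 - x)).
  by apply: CkD; [exact: Ck_cst|apply: CkN; exact: Ck_id].
apply: CkM => //.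
have [D [D0 hD]] := @powR_D R (-1).
rewrite (_ : (fun x => _) = D 0 \o step_den); last by rewrite D0.
apply: Ck_comp hD _ Cden; exact: step_den_gt0.
Qed.

Lemma chi_le0 x : x <= 0 -> chi x = 0.
Proof. by move=> x0; rewrite chiE flat_le0// mul0r. Qed.

Lemma chi_ge1 x : 1 <= x -> chi x = 1.
Proof.
move=> x1; rewrite chiE /step_den (@flat_le0 (1 - x)) ?subr_le0// addr0 divff//.
by rewrite gt_eqF// flat_gt0// (lt_le_trans _ x1).
Qed.

Lemma chi_ge0 x : 0 <= chi x.
Proof. by rewrite chiE divr_ge0 ?flat_ge0// ltW// step_den_gt0. Qed.

Lemma chi_le1 x : chi x <= 1.
Proof. by rewrite chiE ler_pdivrMr ?step_den_gt0// mul1r lerDl flat_ge0. Qed.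

Lemma chi_gt0 x : 0 < x -> 0 < chi x.
Proof. by move=> x0; rewrite chiE divr_gt0 ?flat_gt0// step_den_gt0. Qed.

Definition chiD := D1 chi.

Lemma is_derive_chiD m x : is_derive x (1 : R) (chiD m) (chiD m.+1 x).
Proof. by apply: Ck_D1 => // k; exact: Ck_chi. Qed.

Lemma continuous_chi : continuous chi.
Proof. exact: Ck_cont (Ck_chi 0). Qed.

(** The derivative is continuous and vanishes off [[0, 1]], so it is bounded and the mean value
    theorem applies. *)
Lemma chi_lipschitz : exists2 L : R, 0 <= L &
  forall x y, `|chi x - chi y| <= L * `|x - y|.
Proof.
have cD : continuous (chiD 1).
  by move=> x; exact: is_derive1_continuous (is_derive_chiD 1 x).
have near_cst0 x (c : R) : (\near x, chi x = c) -> chiD 1 x = 0.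
  move=> h; have : is_derive x (1 : R) chi 0.
    apply: near_eq_is_derive (is_derive_cst c x (1 : R)).
    by near do apply/esym.
  by move=> [_ <-].
have [L hL] : exists L : R, forall x, `|chiD 1 x| <= L.
  have [c _ hc] := EVT_max (@ler01 R) (continuous_subspaceT (fun x => continuous_comp (cD x) (@norm_continuous _ R (chiD 1 x)))).
  exists `|chiD 1 c| => x.
  have [x0|x0] := ltP x 0.
    rewrite (near_cst0 _ 0) ?normr0//; near=> y; apply: chi_le0; apply: ltW.
    by near: y; exact: lt_nbhsl.
  have [x1|x1] := ltP 1 x.
    rewrite (near_cst0 _ 1) ?normr0//; near=> y; apply: chi_ge1; apply: ltW.
    by near: y; exact: lt_nbhsr.
  by apply: hc; rewrite in_itv/= x0.
exists L; first exact: le_trans (hL 0).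
have main x y : x < y -> `|chi x - chi y| <= L * `|x - y|.
  move=> xy; have [c _ hc] := is_derive_MVT chi (chiD 1) _ _ xy (is_derive_chiD 0).
  by rewrite distrC hc normrM (distrC x y) ler_wpM2r.
move=> x y; have [/main//|yx|->] := ltgtP x y.
  by rewrite distrC (distrC x); exact: main.
by rewrite !subrr !normr0 mulr0.
Unshelve. all: by end_near. Qed.

(** A smooth substitute for the positive part: it vanishes for [x <= 0], satisfies
    [x - 1 <= Phi x <= x] for [x >= 0], and has its derivative [chi] in [[0, 1]]. *)
Definition Phi : R -> R :=
  locked (fun x => (\int[@lebesgue_measure R]_(t in `]-oo, x]) chi t)%R).

Lemma is_derive_Phi x : is_derive x (1 : R) Phi (chi x).
Proof.
rewrite /Phi -lock.
have xu : x < x + 1 by rewrite ltrDl.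
have ichi : (@lebesgue_measure R).-integrable `]-oo, (x + 1)] (EFin \o chi).
  have -> : EFin \o chi = (EFin \o chi) \_ `[0, +oo[%classic.
    apply/funext => t; rewrite patchE; case: ifPn => //.
    by rewrite notin_setE/= in_itv/= andbT => /negP; rewrite -ltNge => t0; rewrite /= chi_le0// ltW.
  apply/integrable_restrict => //.
  have icc : (@lebesgue_measure R).-integrable `[0, (x + 1)] (EFin \o chi).
    apply: continuous_compact_integrable; first exact: segment_compact.
    exact: continuous_subspaceT continuous_chi.
  apply: integrableS icc => //.
    exact: measurableI.
  by move=> t /=; rewrite !in_itv/= andbT => -[-> ->].
have [] := continuous_FTC1 xu ichi _ (continuous_chi x); first by rewrite ltNyr.
by move=> h1 h2; split => //; rewrite -derive1E.
Qed.

Lemma Phi_le0 x : x <= 0 -> Phi x = 0.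
Proof.
move=> x0; rewrite /Phi -lock /Rintegral integral0_eq// => t /=; rewrite in_itv/= => tx.
by rewrite chi_le0// (le_trans tx).
Qed.

Lemma Phi_lipschitz x y : `|Phi x - Phi y| <= `|x - y|.
Proof.
have main s t : s < t -> `|Phi s - Phi t| <= `|s - t|.
  move=> st; have [c _ hc] := is_derive_MVT Phi chi _ _ st is_derive_Phi.
  by rewrite distrC hc normrM (distrC s t) ler_piMl// ger0_norm ?chi_ge0// chi_le1.
have [/main//|yx|->] := ltgtP x y.
  by rewrite distrC (distrC x); exact: main.
by rewrite !subrr !normr0.
Qed.

Lemma Phi_gt0 x : 0 < x -> 0 < Phi x.
Proof.
move=> x0; have [c /andP[c0 _] hc] := is_derive_MVT Phi chi _ _ x0 is_derive_Phi.
move: hc; rewrite (Phi_le0 0)// !subr0 => ->.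
by rewrite mulr_gt0// chi_gt0.
Qed.

Lemma Phi_ge0 x : 0 <= Phi x.
Proof. by have [/Phi_gt0/ltW//|/Phi_le0->] := ltP 0 x. Qed.

Lemma Phi_le x : 0 <= x -> Phi x <= x.
Proof.
move=> x0; have := Phi_lipschitz x 0; rewrite (Phi_le0 0)// !subr0.
by rewrite !ger0_norm// Phi_ge0.
Qed.

Lemma Phi_ge x : x - 1 <= Phi x.
Proof.
have [x1|x1] := leP x 1; first by apply: le_trans (Phi_ge0 x); rewrite subr_le0.
have [c /andP[c1 _] hc] := is_derive_MVT Phi chi _ _ x1 is_derive_Phi.
move: hc; rewrite chi_ge1 ?mul1r; last exact: ltW.
by move/eqP; rewrite subr_eq => /eqP ->; rewrite lerDl Phi_ge0.
Qed.

Definition PhiD m : R -> R := if m is m'.+1 then chiD m' else Phi.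

Lemma is_derive_PhiD m x : is_derive x (1 : R) (PhiD m) (PhiD m.+1 x).
Proof. by case: m => [|m]; [exact: is_derive_Phi|exact: is_derive_chiD]. Qed.

End smooth_step.

(** * The Euclidean norm on row vectors *)

Section euclidean_theory.
Context {R : realType} {n : nat}.
Implicit Types (x y z : 'rV[R]_n) (a : R).

Lemma dotvC x y : dotv x y = dotv y x.
Proof. by apply: eq_bigr => i _; rewrite mulrC. Qed.

Lemma dotvDl x y z : dotv (x + y) z = dotv x z + dotv y z.
Proof. by rewrite /dotv -big_split; apply: eq_bigr => i _; rewrite mxE mulrDl. Qed.

Lemma dotvZl a x y : dotv (a *: x) y = a * dotv x y.
Proof. by rewrite /dotv mulr_sumr; apply: eq_bigr => i _; rewrite mxE mulrA. Qed.

Lemma dotvDr x y z : dotv x (y + z) = dotv x y + dotv x z.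
Proof. by rewrite dotvC dotvDl !(dotvC x). Qed.

Lemma dotvZr a x y : dotv x (a *: y) = a * dotv x y.
Proof. by rewrite dotvC dotvZl dotvC. Qed.

Lemma dotvNl x y : dotv (- x) y = - dotv x y.
Proof. by rewrite -scaleN1r dotvZl mulN1r. Qed.

Lemma dotvNr x y : dotv x (- y) = - dotv x y.
Proof. by rewrite dotvC dotvNl dotvC. Qed.

Lemma dotv_ge0 x : 0 <= dotv x x.
Proof. by apply: sumr_ge0 => i _; rewrite -expr2 sqr_ge0. Qed.

Lemma enorm_ge0 x : 0 <= enorm x.
Proof. exact: sqrtr_ge0. Qed.

Lemma enorm2 x : enorm x ^+ 2 = dotv x x.
Proof. by rewrite sqr_sqrtr// dotv_ge0. Qed.

Lemma enorm0 : enorm (0 : 'rV[R]_n) = 0.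
Proof. by rewrite /enorm /dotv big1 ?sqrtr0// => i _; rewrite mxE mul0r. Qed.

Lemma enorm_eq0 x : enorm x = 0 -> x = 0.
Proof.
move=> x0; have : dotv x x = 0 by rewrite -enorm2 x0 expr0n.
move/psumr_eq0P => h; apply/rowP => i; rewrite mxE.
have /h : forall j : 'I_n, true -> 0 <= x 0 j * x 0 j by move=> j _; rewrite -expr2 sqr_ge0.
by move=> /(_ i isT)/eqP; rewrite mulf_eq0 orbb => /eqP.
Qed.

Lemma enormZ a x : enorm (a *: x) = `|a| * enorm x.
Proof.
by rewrite /enorm dotvZl dotvZr mulrA -expr2 sqrtrM ?sqr_ge0// sqrtr_sqr.
Qed.

Lemma enormN x : enorm (- x) = enorm x.
Proof. by rewrite -scaleN1r enormZ normrN1 mul1r. Qed.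

Lemma enormB x y : enorm (x - y) = enorm (y - x).
Proof. by rewrite -enormN opprB. Qed.

(** The square of [enorm y *: x - enorm x *: y] expands to [2 |x| |y| (|x| |y| - x . y)]; the cases
    of norm 0 are split off so that one can divide. *)
Lemma dotv_le x y : dotv x y <= enorm x * enorm y.
Proof.
have [x0|x0] := eqVneq (enorm x) 0.
  by rewrite x0 (enorm_eq0 _ x0) /dotv big1 ?mul0r// => i _; rewrite mxE mul0r.
have [y0|y0] := eqVneq (enorm y) 0.
  by rewrite y0 (enorm_eq0 _ y0) /dotv big1 ?mulr0// => i _; rewrite mxE mulr0.
have xp : 0 < enorm x by rewrite lt_def x0 enorm_ge0.
have yp : 0 < enorm y by rewrite lt_def y0 enorm_ge0.
have := dotv_ge0 (enorm y *: x - enorm x *: y).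
rewrite !(dotvDl, dotvDr, dotvNl, dotvNr, dotvZl, dotvZr) (dotvC y x) -!enorm2.
move=> h; have : 0 <= 2 * (enorm x * enorm y) * (enorm x * enorm y - dotv x y).
  by apply: le_trans h _; rewrite le_eqVlt; apply/orP; left; apply/eqP; ring.
by rewrite pmulr_rge0 ?subr_ge0// mulr_gt0// mulr_gt0.
Qed.

Lemma normr_dotv x y : `|dotv x y| <= enorm x * enorm y.
Proof. by rewrite ler_norml dotv_le andbT lerNl -dotvNl -(enormN x) dotv_le. Qed.

Lemma enormD x y : enorm (x + y) <= enorm x + enorm y.
Proof.
rewrite -(@ler_pXn2r _ 2%N)// ?nnegrE ?addr_ge0 ?enorm_ge0//.
rewrite enorm2 dotvDl !dotvDr (dotvC y x) sqrrD -!enorm2.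
have := dotv_le x y; rewrite mulr2n; lra.
Qed.

Lemma enorm_dist x y z : enorm (x - z) <= enorm (x - y) + enorm (y - z).
Proof. by apply: le_trans (enormD _ _); rewrite addrA subrK. Qed.

Lemma coord_le_enorm x i : `|x 0 i| <= enorm x.
Proof.
rewrite -(@ler_pXn2r _ 2%N)// ?nnegrE ?enorm_ge0// enorm2 real_normK ?num_real//.
rewrite /dotv (bigD1 i)//= -expr2 lerDl sumr_ge0// => j _.
by rewrite -expr2 sqr_ge0.
Qed.

Lemma enorm_le_sum x : enorm x <= \sum_i `|x 0 i|.
Proof.
have s0 : 0 <= \sum_i `|x 0 i| by apply: sumr_ge0.
rewrite -(@ler_pXn2r _ 2%N)// ?nnegrE ?enorm_ge0// enorm2 expr2 /dotv mulr_suml.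
apply: ler_sum => i _; apply: le_trans (ler_norm _) _; rewrite normrM.
by rewrite ler_wpM2l// (bigD1 i)//= lerDl sumr_ge0.
Qed.

Lemma continuous_coordR (i : 'I_n) : continuous (fun x : 'rV[R]_n => x 0 i : R).
Proof. exact: coord_continuous. Qed.

Lemma continuous_dist2 z : continuous (fun x => dotv (x - z) (x - z) : R).
Proof.
rewrite /dotv; have -> : (fun x => \sum_i (x - z) 0 i * (x - z) 0 i) =
    \sum_i (fun x : 'rV[R]_n => (x 0 i - z 0 i) * (x 0 i - z 0 i)).
  by apply/funext => x; rewrite fct_sumE; apply: eq_bigr => i _; rewrite !mxE.
elim/big_ind : _ => [|f g cf cg|i _] x.
- exact: cst_continuous.
- by apply: continuousD; [exact: cf|exact: cg].
- have h : {for x, continuous (fun x : 'rV[R]_n => x 0 i - z 0 i)}.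
    by apply: continuousB; [exact: continuous_coordR|exact: cst_continuous].
  exact: (continuousM h h).
Qed.

Lemma continuous_dist z : continuous (fun x => enorm (x - z) : R).
Proof.
move=> x; apply: (@continuous_comp _ _ _ (fun x => dotv (x - z) (x - z)) Num.sqrt).
  exact: continuous_dist2.
exact: sqrt_continuous.
Qed.

Lemma continuous_enorm : continuous (@enorm R n).
Proof.
have -> : @enorm R n = (fun x => enorm (x - 0)) by apply/funext => x; rewrite subr0.
exact: continuous_dist.
Qed.

Lemma open_dist_lt z (r : R) : open [set x | enorm (x - z) < r].
Proof.
have -> : [set x | enorm (x - z) < r] = (fun x => enorm (x - z)) @^-1` [set s | s < r] by [].
apply: open_comp; first by move=> x _; exact: continuous_dist.
exact: open_lt.
Qed.

Lemma open_dist_gt z (r : R) : open [set x | r < enorm (x - z)].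
Proof.
have -> : [set x | r < enorm (x - z)] = (fun x => enorm (x - z)) @^-1` [set s | r < s] by [].
apply: open_comp; first by move=> x _; exact: continuous_dist.
exact: open_gt.
Qed.

Lemma closed_dist_le z (r : R) : closed [set x | enorm (x - z) <= r].
Proof.
rewrite -openC (_ : ~` _ = [set x | r < enorm (x - z)]); first exact: open_dist_gt.
by apply/seteqP; split => x /=; [move/negP; rewrite -ltNge|rewrite ltNge => /negP].
Qed.

Lemma open_eball (r : R) : open (eball r : set 'rV[R]_n).
Proof.
have -> : (eball r : set 'rV[R]_n) = [set x | enorm (x - 0) < r].
  by apply/seteqP; split => x; rewrite /eball /= subr0.
exact: open_dist_lt.
Qed.

Lemma bounded_sup_norm (A : set 'rV[R]_n) (K : R) :
  (forall x, A x -> enorm x <= K) -> bounded_set A.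
Proof.
move=> AK; exists K; split; first exact: num_real.
move=> M KM x Ax /=; rewrite [X in X <= _]/Num.norm /= mx_normrE; apply/bigmax_leP; split.
  by apply: le_trans (ltW KM); apply: le_trans (AK _ Ax); exact: enorm_ge0.
by move=> [i j] _ /=; rewrite ord1; apply: le_trans (coord_le_enorm _ _) (le_trans (AK _ Ax) (ltW KM)).
Qed.

Lemma compact_dist_le z (r : R) : compact [set x | enorm (x - z) <= r].
Proof.
apply: bounded_closed_compact; last exact: closed_dist_le.
apply: (bounded_sup_norm _ (r + enorm z)) => x /= h.
by rewrite -[x](subrK z) (le_trans (enormD _ _))// lerD2r.
Qed.

End euclidean_theory.

(** * Smooth functions and test functions of several variables *)

Section smooth_rV.
Context {R : realType} {n : nat}.
Local Notation E := 'rV[R]_n.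
Implicit Types (f g : E -> R) (x z : E).
Local Notation dir := (fun i : 'I_n => delta_mx 0 i : E).

Lemma smoothP f : smooth f <-> forall k, Ck dir k f.
Proof.
split=> [+ k|].
  elim: k f => [|k IH] f sf; first by split => //; have [] := sf [::].
  split; first by have [] := sf [::].
  move=> i; split; first by have [_ /(_ i)] := sf [::].
  apply: IH => s; have := sf (rcons s i).
  by rewrite /iter_partial foldr_rcons.
move=> h s; have {h} : forall k, Ck dir k (iter_partial s f).
  by elim: s => [|i s IH] k //=; have [_ /(_ i)[]] := IH k.+1.
by move=> h; split=> [|i x]; [exact: Ck_cont (h 0%N)|have [_ /(_ i)[]] := h 1%N].
Qed.

Lemma smooth_continuous f : smooth f -> continuous f.
Proof. by move=> sf; have [] := sf [::]. Qed.

Lemma smooth_derivable f i x : smooth f -> derivable f x (delta_mx 0 i : E).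
Proof. by move=> sf; have [_ /(_ i x)] := sf [::]. Qed.

Lemma smooth_is_derive f i x : smooth f ->
  is_derive x (delta_mx 0 i : E) f (partial i f x).
Proof. by move=> sf; apply: derivableP; exact: smooth_derivable. Qed.

Lemma smooth_partial f i : smooth f -> smooth (partial i f).
Proof. by move=> sf s; have := sf (rcons s i); rewrite /iter_partial foldr_rcons. Qed.

Lemma smooth_cst (a : R) : smooth (fun _ : E => a).
Proof. by apply/smoothP => k; exact: Ck_cst. Qed.

Lemma smoothD f g : smooth f -> smooth g -> smooth (fun x => f x + g x).
Proof. by move=> /smoothP sf /smoothP sg; apply/smoothP => k; exact: CkD. Qed.

Lemma smoothM f g : smooth f -> smooth g -> smooth (fun x => f x * g x).
Proof. by move=> /smoothP sf /smoothP sg; apply/smoothP => k; exact: CkM. Qed.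

Lemma smoothN f : smooth f -> smooth (fun x => - f x).
Proof. by move=> /smoothP sf; apply/smoothP => k; exact: CkN. Qed.

Lemma smoothB f g : smooth f -> smooth g -> smooth (fun x => f x - g x).
Proof. by move=> sf sg; apply: smoothD => //; exact: smoothN. Qed.

Lemma smooth_sum (J : Type) (s : seq J) (F : J -> E -> R) :
  (forall j, smooth (F j)) -> smooth (fun x => \sum_(j <- s) F j x).
Proof. by move=> sF; apply/smoothP => k; apply: Ck_sum => j; exact: (smoothP _).1 (sF j) k. Qed.

Lemma smooth_comp (U : set R) (D : nat -> R -> R) m f :
  (forall m (y : R), U y -> is_derive y (1 : R) (D m) (D m.+1 y)) ->
  (forall x, U (f x)) -> smooth f -> smooth (fun x => D m (f x)).
Proof. by move=> dD Uf /smoothP sf; apply/smoothP => k; exact: Ck_comp dD Uf (sf k). Qed.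

Lemma smooth_chi f : smooth f -> smooth (fun x => chi (f x)).
Proof.
by apply: (smooth_comp setT chiD 0) => // m y _; exact: is_derive_chiD.
Qed.

Lemma smooth_Phi f : smooth f -> smooth (fun x => Phi (f x)).
Proof.
by apply: (smooth_comp setT PhiD 0) => // m y _; exact: is_derive_PhiD.
Qed.

Lemma smooth_powR (p : R) f : (forall x, 0 < f x) -> smooth f ->
  smooth (fun x => f x `^ p).
Proof.
move=> f0 sf; have [D [D0 hD]] := powR_D p.
rewrite (_ : (fun x => _) = (fun x => D 0%N (f x))); last by rewrite D0.
exact: smooth_comp hD f0 sf.
Qed.

Lemma is_derive_coord x i j :
  is_derive x (delta_mx 0 i : E) (fun x : E => x 0 j : R) (j == i)%:R.
Proof.
apply/is_derive_line.
rewrite (_ : (fun h => _) = (fun h : R => (j == i)%:R *: h + x 0 j)); last first.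
  by apply/funext => h; rewrite !mxE eqxx /= eq_sym /GRing.scale /= mulrC.
have := @is_deriveD _ _ _ (fun h : R => (j == i)%:R *: h) (cst (x 0 j)) (0 : R) (1 : R) _ _
   (is_deriveZ (j == i)%:R (is_derive_id (0 : R) (1 : R))) (is_derive_cst _ _ _).
by rewrite addr0 /GRing.scale /= mulr1.
Qed.

Lemma smooth_coord j : smooth (fun x : E => x 0 j : R).
Proof.
apply/smoothP; case => [|k]; split => //; try exact: continuous_coordR.
move=> i; split; first by move=> x; case: (is_derive_coord x i j).
have -> : (fun x : E => 'D_(delta_mx 0 i : E) (fun x : E => x 0 j : R) x) =
    (fun=> (j == i)%:R).
  by apply/funext => x; have [_] := is_derive_coord x i j.
exact: Ck_cst.
Qed.

Lemma partialB f g i x : smooth f -> smooth g ->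
  partial i (fun x => f x - g x) x = partial i f x - partial i g x.
Proof. by move=> sf sg; apply: deriveB; exact: smooth_derivable. Qed.

Lemma partialM f g i x : smooth f -> smooth g ->
  partial i (fun x => f x * g x) x = f x * partial i g x + g x * partial i f x.
Proof. by move=> sf sg; apply: deriveM; exact: smooth_derivable. Qed.

Lemma partial_Phi f i x : smooth f ->
  partial i (fun x => Phi (f x)) x = chi (f x) * partial i f x.
Proof.
move=> sf; have [_] := is_derive_comp_dir _ _ _ _ _ _ (smooth_is_derive f i x sf)
  (is_derive_Phi (f x)).
exact: id.
Qed.

Lemma near_partial f g i x : (\near x, f x = g x) -> partial i f x = partial i g x.
Proof. exact: near_eq_derive. Qed.

Lemma partial_eq0 f i x (c : R) : (\near x, f x = c) -> partial i f x = 0.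
Proof.
by move=> h; rewrite (near_partial f (fun=> c) i x h) /partial derive_cst.
Qed.

(** Compositions such as [chi (f - v)] inherit the compact support of [f] as soon as they vanish
    where [f] does. *)
Lemma test_function_sub (A : set E) f g : test_function A f -> smooth g ->
  (forall x, f x = 0 -> g x = 0) -> test_function A g.
Proof.
move=> [sf cf fA] sg h.
have gf : closure [set x | g x != 0] `<=` closure [set x | f x != 0].
  by apply: closureS => x /=; apply: contra_neq; exact: h.
split => //; last exact: subset_trans gf fA.
exact: subclosed_compact (@closed_closure _ _) cf gf.
Qed.

Lemma test_functionM (A : set E) f g : test_function A f -> smooth g ->
  test_function A (fun x => g x * f x).
Proof.
move=> tf sg; apply: (test_function_sub A f) => //.
  by apply: smoothM => //; case: tf.
by move=> x ->; rewrite mulr0.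
Qed.

Lemma test_function_subset (A B : set E) f : A `<=` B ->
  test_function A f -> test_function B f.
Proof. by move=> AB [sf cf fA]; split => //; exact: subset_trans AB. Qed.

Lemma test_function_partial (A : set E) f i : test_function A f ->
  test_function A (partial i f).
Proof.
move=> [sf cf fA].
have h : closure [set x | partial i f x != 0] `<=` closure [set x | f x != 0].
  rewrite closureE => x; apply; split; first exact: closed_closure.
  move=> y /= fy; apply: contrapT => yn; move/eqP: fy; apply.
  apply: (partial_eq0 _ _ _ 0).
  have : nbhs y (~` closure [set x | f x != 0]).
    by apply: open_nbhs_nbhs; split => //; rewrite openC; exact: closed_closure.
  apply: filterS => w /= hw; apply/eqP; apply: contrapT => /negP fw.
  by apply: hw; exact: subset_closure.
split; [exact: smooth_partial| |exact: subset_trans h fA].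
exact: subclosed_compact (@closed_closure _ _) cf h.
Qed.

Lemma test_function_bounded (A : set E) f : test_function A f ->
  exists2 C, 0 <= C & forall x, `|f x| <= C.
Proof.
move=> [sf cf fA].
have cnf : {within closure [set x | f x != 0], continuous (fun x => `|f x|)}.
  apply: continuous_subspaceT => x; apply: continuous_comp; first exact: smooth_continuous.
  exact: norm_continuous.
have := continuous_compact cnf cf => /compact_bounded[M [_ hM]].
exists (`|M| + 1); first by rewrite addr_ge0.
move=> x; have [->|fx] := eqVneq (f x) 0; first by rewrite normr0 addr_ge0.
have /= := hM (`|M| + 1) _ `|f x|; rewrite normr_id; apply; first by rewrite ltr_pwDr// ler_norm.
by exists x => //; exact: subset_closure.
Qed.

Lemma test_function_support (A : set E) f : test_function A f ->
  exists2 K, 0 < K & forall x, f x != 0 -> enorm x < K.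
Proof.
move=> [sf cf fA].
have cnf : {within closure [set x | f x != 0], continuous (@enorm R n)}.
  by apply: continuous_subspaceT; exact: continuous_enorm.
have := continuous_compact cnf cf => /compact_bounded[M [_ hM]].
exists (`|M| + 2); first by rewrite ltr_wpDl.
move=> x fx; have /= := hM (`|M| + 1) _ (enorm x); rewrite (ger0_norm (enorm_ge0 x)) => h.
apply: le_lt_trans (h _ _) _; last by rewrite ltrD2l ltr1n.
  by rewrite ltr_pwDr// ler_norm.
by exists x => //; exact: subset_closure.
Qed.

Lemma integral_partial_test (A : set E) f i : test_function A f ->
  (\int[@lebesgue_rV R n]_x (partial i f x)%:E = 0)%E.
Proof.
move=> tf; have [sf _ _] := tf.
have tp := test_function_partial _ _ i tf.
have [C C0 hC] := test_function_bounded _ _ tp.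
have [K K0 hK] := test_function_support _ _ tf.
have [K' K'0 hK'] := test_function_support _ _ tp.
apply: (integral_partial_compact i f (Num.max K K') C) => //.
- by move=> x; exact: smooth_derivable.
- by apply: smooth_continuous; exact: smooth_partial.
- move=> x j; rewrite gt_max => /andP[Kx K'x]; split; apply/eqP; apply: contraPT Kx => fx.
    by apply/negP; rewrite -leNgt (le_trans (coord_le_enorm _ _))// ltW// hK.
  move: K'x => /(lt_le_trans)/(_ (coord_le_enorm _ _)).
  by move=> /(lt_trans (hK' _ fx)); rewrite ltxx.
Qed.

End smooth_rV.

(** * Cutoffs and radial barriers *)

Section cutoff.
Context {R : realType} {n : nat}.
Local Notation E := 'rV[R]_n.
Implicit Types (x z : E).

Definition dist2 z x : R := dotv (x - z) (x - z).

Lemma dist2E z x : dist2 z x = enorm (x - z) ^+ 2.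
Proof. by rewrite enorm2. Qed.

Lemma dist2_ge0 z x : 0 <= dist2 z x.
Proof. exact: dotv_ge0. Qed.

Lemma smooth_coordB z i : smooth (fun x => x 0 i - z 0 i : R).
Proof. by apply: smoothB; [exact: smooth_coord|exact: smooth_cst]. Qed.

Lemma smooth_dist2 z : smooth (dist2 z).
Proof.
rewrite (_ : dist2 z = fun x => \sum_i (x 0 i - z 0 i) * (x 0 i - z 0 i)).
  by apply: smooth_sum => i; apply: smoothM; exact: smooth_coordB.
by apply/funext => x; apply: eq_bigr => i _; rewrite !mxE.
Qed.

Lemma partial_cst i (c : R) x : partial i (fun=> c) x = 0.
Proof. exact: derive_cst. Qed.

Lemma partial_coordB z i j x : partial i (fun x => x 0 j - z 0 j : R) x = (j == i)%:R.
Proof.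
rewrite partialB; [|exact: smooth_coord|exact: smooth_cst].
by rewrite partial_cst subr0; have [_] := is_derive_coord x i j.
Qed.

Lemma is_derive_dist2 z i x :
  is_derive x (delta_mx 0 i : E) (dist2 z) (2 * (x 0 i - z 0 i)).
Proof.
have -> : dist2 z = \sum_j (fun x : E => (x 0 j - z 0 j) * (x 0 j - z 0 j)).
  by apply/funext => y; rewrite fct_sumE; apply: eq_bigr => j _; rewrite !mxE.
have h j : is_derive x (delta_mx 0 i : E)
    (fun x : E => (x 0 j - z 0 j) * (x 0 j - z 0 j)) ((j == i)%:R * (2 * (x 0 i - z 0 i))).
  have sj := smooth_coordB z j.
  apply: is_derive_eq; first exact: (smooth_is_derive _ i x (smoothM _ _ sj sj)).
  rewrite partialM// !partial_coordB; case: eqP => [->|_] /=; first by rewrite mulr1 mul1r mulr2n mulrDl mul1r.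
  by rewrite !mulr0 mul0r addr0.
have hs := is_derive_sum h; apply: (is_derive_eq hs).
rewrite (bigD1 i)//= eqxx mul1r big1 ?addr0// => j /negbTE ->.
by rewrite mul0r.
Qed.

(** Built on the squared distance, which is smooth at [z]; the value is 1 within distance [a] of [z]
    and 0 from distance [b] on. *)
Definition cutoff z (a b : R) x : R := chi ((b ^+ 2 - dist2 z x) / (b ^+ 2 - a ^+ 2)).

Variables (z : E) (a b : R).
Hypotheses (a0 : 0 <= a) (ab : a < b).

Let b0 : 0 < b. Proof. exact: le_lt_trans ab. Qed.

Let den0 : 0 < b ^+ 2 - a ^+ 2.
Proof. by rewrite subr_gt0 ltr_pXn2r// nnegrE// ltW. Qed.

Lemma smooth_cutoff : smooth (cutoff z a b).
Proof.
apply: smooth_chi; apply: smoothM; last exact: smooth_cst.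
by apply: smoothB; [exact: smooth_cst|exact: smooth_dist2].
Qed.

Lemma cutoff_ge0 x : 0 <= cutoff z a b x. Proof. exact: chi_ge0. Qed.
Lemma cutoff_le1 x : cutoff z a b x <= 1. Proof. exact: chi_le1. Qed.

Lemma cutoff1 x : enorm (x - z) <= a -> cutoff z a b x = 1.
Proof.
move=> xa; apply: chi_ge1; rewrite ler_pdivlMr// mul1r lerD2l lerN2 dist2E.
by rewrite ler_pXn2r// nnegrE// enorm_ge0.
Qed.

Lemma cutoff0 x : b <= enorm (x - z) -> cutoff z a b x = 0.
Proof.
move=> xb; apply: chi_le0; rewrite ler_pdivrMr// mul0r subr_le0 dist2E.
by rewrite ler_pXn2r// nnegrE ?enorm_ge0// ltW.
Qed.

Lemma cutoff_neq0 x : cutoff z a b x != 0 -> enorm (x - z) < b.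
Proof. by move=> h; rewrite ltNge; apply: contra_neqN h; exact: cutoff0. Qed.

Lemma test_function_cutoff (A : set E) :
  (forall x, enorm (x - z) <= b -> A x) -> test_function A (cutoff z a b).
Proof.
move=> hA.
have h : closure [set x | cutoff z a b x != 0] `<=` [set x | enorm (x - z) <= b].
  rewrite closureE => x; apply; split; first exact: closed_dist_le.
  by move=> y /= /cutoff_neq0/ltW.
split; [exact: smooth_cutoff| |by move=> x /h/hA].
exact: subclosed_compact (@closed_closure _ _) (compact_dist_le z b) h.
Qed.

Lemma partial_cutoff x i : enorm (x - z) < a -> partial i (cutoff z a b) x = 0.
Proof.
move=> xa; apply: (partial_eq0 _ _ _ 1).
have : nbhs x [set y | enorm (y - z) < a].
  by apply: open_nbhs_nbhs; split => //; exact: open_dist_lt.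
by apply: filterS => y /= ya; apply: cutoff1; exact: ltW.
Qed.

End cutoff.

Section barrier.
Context {R : realType} {n : nat}.
Local Notation E := 'rV[R]_n.
Variables (z : E) (w v0 : R) (J : nat) (c : 'I_J -> R).
Hypotheses (w0 : 0 < w) (v00 : 0 < v0) (c0 : forall j, 0 <= c j).
Implicit Types x : E.

(** The distance is altered only where [dist2 z x < a]. With this value of [a] the altered distance
    is at most [w] there, while every node [s j] is at least [w], so [barrier] does not feel the
    alteration. *)
Let a : R := w ^+ 2 / 2.
Let a0 : 0 < a. Proof. by rewrite divr_gt0// exprn_gt0. Qed.

Let reg2 x : R := dist2 z x + a * (1 - chi (dist2 z x / a)).

Let reg2_gt0 x : 0 < reg2 x.
Proof.
rewrite /reg2; have [d0|d0] := eqVneq (dist2 z x) 0.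
  by rewrite d0 mul0r chi_le0// add0r subr0 mulr1.
rewrite ltr_pwDl ?lt_def ?d0 ?dist2_ge0// mulr_ge0 ?(ltW a0)//.
by rewrite subr_ge0 chi_le1.
Qed.

(** A smooth substitute for the distance to [z], equal to it off the ball of radius [w / sqrt 2]. *)
Let rho x : R := reg2 x `^ 2^-1.

Let smooth_rho : smooth rho.
Proof.
apply: smooth_powR => //; apply: smoothD; first exact: smooth_dist2.
apply: smoothM; first exact: smooth_cst.
apply: smoothB; first exact: smooth_cst.
apply: smooth_chi; apply: smoothM; [exact: smooth_dist2|exact: smooth_cst].
Qed.

Let rho_far x : a <= dist2 z x -> rho x = enorm (x - z).
Proof.
move=> ax; rewrite /rho powR12_sqrt ?(ltW (reg2_gt0 x))// /reg2 chi_ge1 ?subrr ?mulr0 ?addr0//.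
by rewrite ler_pdivlMr// mul1r.
Qed.

Let rho_near x : dist2 z x <= a -> rho x <= w.
Proof.
move=> ax; rewrite /rho powR12_sqrt ?(ltW (reg2_gt0 x))//.
rewrite -(ger0_norm (ltW w0)) -sqrtr_sqr ler_wsqrtr//.
have -> : w ^+ 2 = a + a by rewrite /a; field.
by rewrite /reg2 lerD// ger_pMr// gerBl chi_ge0.
Qed.

Let dist_near x : dist2 z x <= a -> enorm (x - z) <= w.
Proof.
move=> ax; rewrite -(@ler_pXn2r _ 2%N)// ?nnegrE ?enorm_ge0 ?(ltW w0)//.
rewrite -dist2E (le_trans ax)// /a ler_pdivrMr// ler_peMr ?sqr_ge0//.
by rewrite ler1n.
Qed.

Let s (j : nat) : R := j.+1%:R * w.

Let ws j : w <= s j.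
Proof. by rewrite /s ler_peMl ?(ltW w0)// ler1n. Qed.

(** Its radial derivative is [slope], a smooth staircase that rises by [c j] while the distance to
    [z] runs from [s j] to [s j + w]. *)
Definition barrier x : R := v0 + \sum_(j < J) c j * w * Phi ((rho x - s j) / w).

Definition slope (t : R) : R := \sum_(j < J) c j * chi ((t - s j) / w).

Lemma smooth_barrier : smooth barrier.
Proof.
apply: smoothD; first exact: smooth_cst.
apply: smooth_sum => j; apply: smoothM; first exact: smooth_cst.
apply: smooth_Phi; apply: smoothM; last exact: smooth_cst.
by apply: smoothB => //; exact: smooth_cst.
Qed.

Lemma barrierE x : barrier x = v0 + \sum_(j < J) c j * w * Phi ((enorm (x - z) - s j) / w).
Proof.
rewrite /barrier; congr (_ + _); apply: eq_bigr => j _.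
have [ax|ax] := leP a (dist2 z x); first by rewrite rho_far.
rewrite !Phi_le0//; rewrite ler_pdivrMr// mul0r subr_le0 (le_trans _ (ws j))//.
  exact/dist_near/ltW.
exact/rho_near/ltW.
Qed.

Lemma barrier_ge x : v0 <= barrier x.
Proof.
rewrite /barrier lerDl; apply: sumr_ge0 => j _.
by rewrite mulr_ge0 ?Phi_ge0// mulr_ge0// ltW.
Qed.

Let partial_barrier0 i x : partial i barrier x = slope (rho x) * partial i rho x.
Proof.
have srho j : smooth (fun x => (rho x - s j) / w).
  apply: smoothM; last exact: smooth_cst.
  by apply: smoothB => //; exact: smooth_cst.
have h (j : 'I_J) : is_derive x (delta_mx 0 i : E)
    (fun x : E => c j * w * Phi ((rho x - s j) / w))
    (c j * chi ((rho x - s j) / w) * partial i rho x).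
  apply: is_derive_eq.
    apply: smooth_is_derive; apply: smoothM; first exact: smooth_cst.
    exact: smooth_Phi.
  rewrite partialM ?partial_Phi//; [|exact: smooth_cst|exact: smooth_Phi].
  rewrite partialM; [|by apply: smoothB => //; exact: smooth_cst|exact: smooth_cst].
  rewrite partialB//; last exact: smooth_cst.
  rewrite !partial_cst; field.
  by rewrite gt_eqF.
have hs := is_derive_sum h.
have -> : barrier = cst v0 + \sum_(j < J) (fun x : E => c j * w * Phi ((rho x - s j) / w)).
  by apply/funext => y; rewrite /barrier [RHS]/(_ + _) /= fct_sumE.
have [_ h2] := is_deriveD (is_derive_cst v0 x (delta_mx 0 i : E)) hs.
by apply: eq_trans h2 _; rewrite add0r /slope mulr_suml.
Qed.

Lemma partial_barrier i x :
  partial i barrier x = slope (enorm (x - z)) / enorm (x - z) * (x 0 i - z 0 i).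
Proof.
have slope0 t : t <= w -> slope t = 0.
  move=> tw; rewrite /slope big1// => j _; rewrite chi_le0 ?mulr0//.
  by rewrite ler_pdivrMr// mul0r subr_le0 (le_trans tw).
rewrite partial_barrier0; have [ax|ax] := ltP a (dist2 z x); last first.
  by rewrite !slope0 ?mul0r//; [exact: dist_near|exact: rho_near].
rewrite rho_far ?(ltW ax)// -mulrA; congr (_ * _).
have d0 : 0 < dist2 z x by exact: lt_trans ax.
have -> : partial i rho x = partial i (fun x => dist2 z x `^ 2^-1) x.
  apply: near_partial.
  have : nbhs x [set y | a < dist2 z y].
    apply: open_nbhs_nbhs; split => //.
    apply: (@open_comp _ _ (dist2 z) [set t | a < t]); last exact: open_gt.
    by move=> y _; exact: smooth_continuous (smooth_dist2 z) y.
  apply: filterS => y /= ay; rewrite rho_far ?(ltW ay)// powR12_sqrt ?dist2_ge0//.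
have [_ h] := is_derive_comp_dir _ _ _ _ _ _ (is_derive_dist2 z i x)
   (is_derive1_powR 2^-1 d0).
apply: eq_trans h _; rewrite (_ : 2^-1 - 1 = - 2^-1); last by field.
rewrite powRN powR12_sqrt ?dist2_ge0// dist2E sqrtr_sqr ger0_norm ?enorm_ge0//.
have e0 : enorm (x - z) != 0 by rewrite -sqrf_eq0 -dist2E gt_eqF.
by field.
Qed.

End barrier.

Section monotone_profile.
Context {R : realType} {n : nat}.
Local Notation E := 'rV[R]_n.
Variables (p : R -> R) (w : R) (J : nat).
Hypotheses (w0 : 0 < w) (p00 : p 0 = 0).
Hypothesis p_mono : forall s t, 0 <= s -> s <= t -> p s <= p t.

(** The steps are the increments of [p] over the mesh, so their partial sums telescope to [p]: the
    slope of the barrier follows [p] from below with a delay of at most two mesh widths. *)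
Definition incr (j : nat) : R := p (j.+1%:R * w) - p (j%:R * w).

Lemma incr_ge0 j : 0 <= incr j.
Proof.
by rewrite subr_ge0 p_mono ?mulr_ge0 ?(ltW w0)// ler_wpM2r ?(ltW w0)// ler_nat.
Qed.

Lemma sum_incr m : \sum_(j < m) incr j = p (m%:R * w).
Proof.
elim: m => [|m IH]; first by rewrite big_ord0 mul0r p00.
by rewrite big_ord_recr /= IH /incr addrC subrK.
Qed.

Lemma sum_incr_le (J1 m : nat) : (m <= J1)%N ->
  \sum_(j < J1 | (j < m)%N) incr j = p (m%:R * w).
Proof. by move=> mJ; rewrite -(big_ord_widen _ incr mJ) sum_incr. Qed.

Lemma slope_incr_ge0 (t : R) : 0 <= slope w J (incr \o val) t.
Proof. by apply: sumr_ge0 => j _; rewrite mulr_ge0 ?chi_ge0// incr_ge0. Qed.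

Lemma slope_incr_le (t : R) (m : nat) : (m <= J)%N -> t <= m.+1%:R * w ->
  slope w J (incr \o val) t <= p (m%:R * w).
Proof.
move=> mJ tm; rewrite -(sum_incr_le _ _ mJ) /slope (bigID (fun j : 'I_J => (j < m)%N)) /=.
rewrite [X in _ + X]big1 ?addr0.
  by apply: ler_sum => j _; rewrite ler_piMr ?incr_ge0// chi_le1.
move=> j; rewrite -leqNgt => mj; rewrite chi_le0 ?mulr0//.
rewrite ler_pdivrMr// mul0r subr_le0 (le_trans tm)// ler_wpM2r ?(ltW w0)//.
by rewrite ler_nat.
Qed.

Lemma slope_incr_ge (t : R) (m : nat) : (m <= J)%N -> m.+1%:R * w <= t ->
  p (m%:R * w) <= slope w J (incr \o val) t.
Proof.
move=> mJ tm; rewrite -(sum_incr_le _ _ mJ) /slope [leRHS](bigID (fun j : 'I_J => (j < m)%N)) /=.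
rewrite ler_wpDr//; first by apply: sumr_ge0 => j _; rewrite mulr_ge0 ?chi_ge0// incr_ge0.
rewrite le_eqVlt; apply/orP; left; apply/eqP; apply: eq_bigr => j jm.
rewrite chi_ge1 ?mulr1// ler_pdivlMr// mul1r lerBrDr (le_trans _ tm)//.
by rewrite -[X in X + _]mul1r -mulrDl ler_wpM2r ?(ltW w0)// addrC natr1 ler_nat.
Qed.

Lemma slope_incr_max (t : R) : slope w J (incr \o val) t <= p (J%:R * w).
Proof.
rewrite -sum_incr; apply: ler_sum => j _.
by rewrite ler_piMr ?incr_ge0// chi_le1.
Qed.

Variables (z : E) (v0 : R).

Lemma barrier_incr_ge x (m : nat) (t : R) : (m <= J)%N -> m.+1%:R * w <= t ->
  v0 + (enorm (x - z) - t) * p (m%:R * w) <= barrier z w v0 J (incr \o val) x.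
Proof.
move=> mJ mt; rewrite barrierE// lerD2l [leRHS](bigID (fun j : 'I_J => (j < m)%N)) /=.
rewrite ler_wpDr//.
  by apply: sumr_ge0 => j _; rewrite mulr_ge0 ?Phi_ge0// mulr_ge0 ?incr_ge0// ltW.
rewrite -(sum_incr_le _ _ mJ) mulr_sumr; apply: ler_sum => j jm.
rewrite mulrC -mulrA ler_wpM2l ?incr_ge0//.
(* [Phi s >= s - 1] loses one more mesh width and moves the node of step [j] to [j.+2%:R * w], which
   is still at most [t] for [j < m]. *)
have h := Phi_ge ((enorm (x - z) - j.+1%:R * w) / w).
apply: (@le_trans _ _ (w * ((enorm (x - z) - j.+1%:R * w) / w - 1))); last first.
  by rewrite ler_wpM2l// ltW.
rewrite mulrBr mulrCA divff ?gt_eqF// !mulr1 -addrA lerD2l -opprD lerN2.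
by apply: le_trans mt; rewrite -[X in _ + X]mul1r -mulrDl ler_wpM2r ?(ltW w0)// natr1 ler_nat.
Qed.

Lemma barrier_incr_le x :
  barrier z w v0 J (incr \o val) x <= v0 + enorm (x - z) * p (J%:R * w).
Proof.
rewrite barrierE// lerD2l -sum_incr mulr_sumr; apply: ler_sum => j _ /=.
rewrite -mulrA [leRHS]mulrC ler_wpM2l ?incr_ge0//.
have [d0|d0] := leP 0 ((enorm (x - z) - j.+1%:R * w) / w); last first.
  by rewrite Phi_le0 ?(ltW d0)// mulr0 enorm_ge0.
apply: (@le_trans _ _ (w * ((enorm (x - z) - j.+1%:R * w) / w))).
  by rewrite ler_wpM2l ?(ltW w0)// Phi_le.
by rewrite mulrCA divff ?gt_eqF// mulr1 gerBl mulr_ge0// ltW.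
Qed.

End monotone_profile.

(** * Integrable functions *)

Section real_integrable.
Context {d : measure_display} {T : measurableType d} {R : realType}.
Variables (mu : {measure set T -> \bar R}) (A : set T) (mA : measurable A).
Implicit Types f g h : T -> R.

Definition intble f := mu.-integrable A (EFin \o f).
Local Notation Int f := (\int[mu]_(x in A) f x).

Lemma intble_meas f : intble f -> measurable_fun A f.
Proof. by move=> /integrableP[/measurable_EFinP]. Qed.

Lemma ae_weaken (P Q : T -> Prop) : (forall x, P x -> Q x) ->
  {ae mu, forall x, P x} -> {ae mu, forall x, Q x}.
Proof. by move=> PQ; apply: filterS. Qed.

Lemma ae_conj (P Q : T -> Prop) : {ae mu, forall x, P x} -> {ae mu, forall x, Q x} ->
  {ae mu, forall x, P x /\ Q x}.
Proof. by move=> hP hQ; apply: filterS2 hP hQ. Qed.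

Lemma ae_all (P : T -> Prop) : (forall x, P x) -> {ae mu, forall x, P x}.
Proof. exact: aeW. Qed.

Lemma ae_countable (P : nat -> T -> Prop) : (forall k, {ae mu, forall x, P k x}) ->
  {ae mu, forall x, forall k, P k x}.
Proof. by move=> h; apply/ae_foralln. Qed.

Lemma measurable_normR f : measurable_fun A f -> measurable_fun A (fun x => `|f x|).
Proof. by move=> mf; exact: measurableT_comp. Qed.

Lemma measurable_min_normR f (c : R) : measurable_fun A f ->
  measurable_fun A (fun x => Num.min `|f x| c).
Proof. by move=> mf; apply: measurable_minr => //; exact: measurable_normR. Qed.

Lemma measurable_comp_continuous (h : R -> R) f : continuous h -> measurable_fun A f ->
  measurable_fun A (fun x => h (f x)).
Proof.
by move=> ch mf; apply: measurableT_comp => //; exact: continuous_measurable_fun.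
Qed.

Lemma intbleD f g : intble f -> intble g -> intble (fun x => f x + g x).
Proof. exact: integrableD. Qed.

Lemma intbleB f g : intble f -> intble g -> intble (fun x => f x - g x).
Proof. exact: integrableB. Qed.

Lemma intbleZ (k : R) f : intble f -> intble (fun x => k * f x).
Proof. exact: integrableZl. Qed.

Lemma intble_norm f : intble f -> intble (fun x => `|f x|).
Proof. exact: integrable_norm. Qed.

Lemma intble_dom f g : measurable_fun A f -> intble g ->
  (forall x, A x -> `|f x| <= g x) -> intble f.
Proof.
move=> mf ig h; apply: (le_integrable mA _ _ ig); first exact/measurable_EFinP.
by move=> x Ax /=; rewrite lee_fin; apply: le_trans (h x Ax) (ler_norm _).
Qed.

Lemma intbleM f g (C : R) : measurable_fun A f -> (forall x, A x -> `|f x| <= C) ->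
  intble g -> intble (fun x => f x * g x).
Proof.
move=> mf fC ig; apply: (intble_dom _ (fun x => C * `|g x|)).
- by apply: measurable_funM => //; exact: intble_meas.
- by apply: intbleZ; exact: intble_norm.
- by move=> x Ax; rewrite normrM ler_wpM2r// fC.
Qed.

Lemma intble_sum (I : Type) (s : seq I) (F : I -> T -> R) :
  (forall i, intble (F i)) -> intble (fun x => \sum_(i <- s) F i x).
Proof.
move=> iF; have -> : (fun x => \sum_(i <- s) F i x) = fun x => fine (\sum_(i <- s) (F i x)%:E).
  by apply/funext => x; rewrite sumEFin.
elim: s => [|i s IH]; rewrite /intble.
  under eq_fun do rewrite big_nil; exact: integrable0.
have -> : (fun x => fine (\sum_(j <- i :: s) (F j x)%:E)) =
    (fun x => F i x + fine (\sum_(j <- s) (F j x)%:E)).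
  by apply/funext => x; rewrite big_cons sumEFin.
exact: intbleD.
Qed.

Lemma intble_ae f g : measurable_fun A g -> intble f ->
  {ae mu, forall x, A x -> f x = g x} -> intble g.
Proof.
move=> mg /integrableP[mf fi] fg; apply/integrableP; split; first exact/measurable_EFinP.
rewrite -(@ge0_ae_eq_integral _ _ _ mu A (fun x => `|(f x)%:E|%E))//.
- exact: measurableT_comp.
- by apply: measurableT_comp => //; exact/measurable_EFinP.
- by apply: filterS fg => x /= h /h ->.
Qed.

Lemma EFin_Int f : intble f -> (Int f)%:E = (\int[mu]_(x in A) (f x)%:E)%E.
Proof. by move=> fi; rewrite fineK//; exact: integrable_fin_num. Qed.

Lemma IntD f g : intble f -> intble g -> Int (fun x => f x + g x) = Int f + Int g.
Proof. exact: RintegralD. Qed.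

Lemma IntB f g : intble f -> intble g -> Int (fun x => f x - g x) = Int f - Int g.
Proof. exact: RintegralB. Qed.

Lemma IntZ (k : R) f : intble f -> Int (fun x => k * f x) = k * Int f.
Proof. by move=> h; exact: RintegralZl. Qed.

Lemma Int_eq f g : (forall x, A x -> f x = g x) -> Int f = Int g.
Proof. by move=> h; apply: eq_Rintegral => x /[!inE]; exact: h. Qed.

Lemma Int_le f g : intble f -> intble g -> (forall x, A x -> f x <= g x) -> Int f <= Int g.
Proof. exact: le_Rintegral. Qed.

Lemma Int_ge0 f : (forall x, A x -> 0 <= f x) -> 0 <= Int f.
Proof. exact: Rintegral_ge0. Qed.

Lemma Int_norm f : intble f -> `|Int f| <= Int (fun x => `|f x|).
Proof. exact: le_normr_Rintegral. Qed.

Lemma Int_ae f g : measurable_fun A f -> measurable_fun A g ->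
  {ae mu, forall x, A x -> f x = g x} -> Int f = Int g.
Proof.
move=> mf mg fg; congr fine; apply: ae_eq_integral => //; try exact/measurable_EFinP.
by apply: filterS fg => x /= h /h ->.
Qed.

Lemma Int_le_ae f g : intble f -> intble g ->
  {ae mu, forall x, A x -> f x <= g x} -> Int f <= Int g.
Proof.
move=> fi gi fg; rewrite -subr_ge0 -IntB//.
have mgf : measurable_fun A (fun x => g x - f x) by apply: intble_meas; exact: intbleB.
rewrite (Int_ae _ (fun x => `|g x - f x|))//; first exact: Int_ge0.
- exact: measurableT_comp.
- by apply: filterS fg => x /= h /h gf; rewrite ger0_norm// subr_ge0.
Qed.

Lemma Int_eq0_ae f : intble f -> (forall x, A x -> 0 <= f x) -> Int f = 0 ->
  {ae mu, forall x, A x -> f x = 0}.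
Proof.
move=> fi f0 If; have h0 : (\int[mu]_(x in A) `|(f x)%:E| = 0)%E.
  transitivity (Int f)%:E; last by rewrite If.
  rewrite EFin_Int//.
  by apply: eq_integral => x /[!inE] Ax; rewrite /= ger0_norm// f0.
have mf : measurable_fun A (EFin \o f) by apply/measurable_EFinP; exact: intble_meas.
have /(ae_eq_integral_abs mu mA mf).1 := h0.
by apply: filterS => x /= h /h [].
Qed.

Lemma ge0_le_integral_EFin f g : measurable_fun A f -> measurable_fun A g ->
  (forall x, A x -> 0 <= f x) -> (forall x, A x -> f x <= g x) ->
  (\int[mu]_(x in A) (f x)%:E <= \int[mu]_(x in A) (g x)%:E)%E.
Proof.
move=> mf mg f0 fg; apply: ge0_le_integral => //.
- by apply/measurable_EFinP.
- by apply/measurable_EFinP.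
Qed.

(** Dominated convergence with dominating function [|f|]. It splits an integrable weight into a
    bounded part and a part of small integral, as [chi_approx] requires. *)
Lemma Int_trunc_cvg f : intble f -> forall e : R, 0 < e ->
  exists k : nat, Int (fun x => `|f x| - Num.min `|f x| k%:R) < e.
Proof.
move=> fi e e0; have mf := intble_meas _ fi.
have mmin (k : nat) : measurable_fun A (fun x => Num.min `|f x| k%:R).
  exact: measurable_min_normR.
have [|||||_ + _] := @dominated_convergence _ _ _ mu A mA
   (fun k x => (Num.min `|f x| k%:R)%:E) (fun x => `|f x|%:E) (fun x => `|f x|%:E).
- by move=> k; exact/measurable_EFinP.
- by apply/measurable_EFinP; exact: measurableT_comp.
- apply: aeW => x Ax; apply: cvg_near_cst; near=> k; congr EFin; apply: min_l.
  near: k; exists (Num.bound `|f x|) => //= k /= h.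
  by rewrite (le_trans (ltW (archi_boundP _)))// ler_nat.
- exact: intble_norm.
- by apply: aeW => x k Ax /=; rewrite lee_fin ger0_norm ?ge_min ?lexx// le_min normr_ge0 ler0n.
move=> /fine_cvgP[_ /cvgrPdist_lt /(_ e e0)[k _ /(_ k (leqnn k))]].
rewrite /= sub0r normrN => h; exists k; apply: le_lt_trans (ler_norm _) _.
apply: le_lt_trans h; rewrite le_eqVlt; apply/orP; left; apply/eqP; congr `|fine _|.
apply: eq_integral => x _ /=; congr EFin; rewrite distrC [RHS]ger0_norm// subr_ge0.
by rewrite ge_min lexx.
Unshelve. all: by end_near. Qed.

End real_integrable.

Set Implicit Arguments.
Unset Strict Implicit.

Section rV_integrable.
Context {R : realType} {n : nat}.
Local Notation E := 'rV[R]_n.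
Local Notation mu := (@lebesgue_rV R n).
Local Notation LE := (caratheodory_type (mu_ext (@borel_lebesgue_rV R n))).

Lemma eball_lty (r : R) : (mu (eball r) < +oo)%E.
Proof.
apply: le_lt_trans (cube_lty r); apply: le_measure; rewrite ?inE.
- by apply: open_lebesgue; exact: open_eball.
- apply: borel_lebesgue.
  have -> : [set x : E | forall i, `|x 0 i| <= r] = \bigcap_(i in [set: 'I_n])
    ((fun x : E => x 0 i : R) @^-1` `[- r, r]%classic).
    apply/seteqP; split=> x h i; first by move=> _; rewrite /= in_itv/= -ler_norml; exact: h.
    by have := h i Logic.I; rewrite /= in_itv/= -ler_norml.
  apply: fin_bigcap_measurable => // i _.
  by rewrite -[X in measurable X]setTI; exact: measurable_coord.
- by move=> x /= xr i; apply: le_trans (coord_le_enorm x i) (ltW xr).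
Qed.

Lemma measurable_smooth (A : set LE) (f : E -> R) : smooth f -> measurable_fun A (f : LE -> R).
Proof. by move=> sf; apply: measurable_funTS; apply: continuous_lebesgue; exact: smooth_continuous. Qed.

Lemma intble_bounded_support (A : set LE) (f : LE -> R) (C K : R) : measurable A ->
  measurable_fun A f -> (forall x, A x -> `|f x| <= C) ->
  (forall x, A x -> K <= enorm (x : E) -> f x = 0) -> intble mu A f.
Proof.
move=> mA mf fC fK.
have mB : measurable (eball K : set LE) by apply: open_lebesgue; exact: open_eball.
have mAB : measurable (A `&` eball K) by exact: measurableI.
have h : mu.-integrable (A `&` eball K) (EFin \o f).
  apply: measurable_bounded_integrable => //.
  - apply: le_lt_trans (eball_lty K); apply: le_measure; rewrite ?inE//.
  - by apply: measurable_funS mf.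
  - by exists C; split; [exact: num_real|move=> y Cy t [At _]; exact: le_trans (fC _ At) (ltW Cy)].
move/(integrable_restrict mu mB mA) : h; apply: eq_integrable => // x /[!inE] Ax.
rewrite patchE; case: ifPn => //; rewrite notin_setE /= => /negP; rewrite -leNgt => Kx.
by rewrite fK.
Qed.

Lemma measurable_dotv (A : set LE) (G H : LE -> E) :
  (forall i, measurable_fun A (fun x => G x 0 i : R)) ->
  (forall i, measurable_fun A (fun x => H x 0 i : R)) ->
  measurable_fun A (fun x => dotv (G x) (H x) : R).
Proof.
move=> mG mH; apply: measurable_sum => i; exact: measurable_funM.
Qed.

Lemma measurable_enorm (A : set LE) (G : LE -> E) :
  (forall i, measurable_fun A (fun x => G x 0 i : R)) ->
  measurable_fun A (fun x => enorm (G x) : R).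
Proof.
move=> mG; apply: (@measurableT_comp _ _ _ _ _ _ (@Num.sqrt R)).
  by apply: continuous_measurable_fun; exact: sqrt_continuous.
exact: measurable_dotv.
Qed.

End rV_integrable.

Section rV_interface.
Context {R : realType} {n : nat}.
Local Notation E := 'rV[R]_n.
Local Notation mu := (@lebesgue_rV R n).
Local Notation LE := (caratheodory_type (mu_ext (@borel_lebesgue_rV R n))).
Implicit Types (A B : set E) (f g : E -> R) (G H : E -> E).

(** The carrier of the measurable structure of [lebesgue_rV] is only convertible
    to ['rV_n]; the following constants keep that conversion out of the proofs. *)
Definition meas_set : set E -> Prop := locked (fun A => measurable (A : set LE)).
Definition measf : set E -> (E -> R) -> Prop :=
  locked (fun A f => measurable_fun (A : set LE) (f : LE -> R)).
Definition intOn : set E -> (E -> R) -> R :=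
  locked (fun A f => (\int[mu]_(x in (A : set LE)) f x)%R).

Lemma meas_setE : meas_set = (fun A => measurable (A : set LE)).
Proof. by rewrite /meas_set -lock. Qed.

Lemma measfE : measf = (fun A f => measurable_fun (A : set LE) (f : LE -> R)).
Proof. by rewrite /measf -lock. Qed.

Lemma intOnE : intOn = (fun A f => (\int[mu]_(x in (A : set LE)) f x)%R).
Proof. by rewrite /intOn -lock. Qed.


Lemma ae_mono (P Q : E -> Prop) : {ae mu, forall x, P x} ->
  (forall x, P x -> Q x) -> {ae mu, forall x, Q x}.
Proof. by move=> h PQ; exact: (ae_weaken mu P Q PQ h). Qed.

Lemma ae_and (P Q : E -> Prop) : {ae mu, forall x, P x} -> {ae mu, forall x, Q x} ->
  {ae mu, forall x, P x /\ Q x}.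
Proof. by move=> hP hQ; exact: (ae_conj mu P Q hP hQ). Qed.

Lemma ae_forall (P : E -> Prop) : (forall x, P x) -> {ae mu, forall x, P x}.
Proof. exact: (ae_all mu). Qed.

Lemma ae_nat (P : nat -> E -> Prop) : (forall k, {ae mu, forall x, P k x}) ->
  {ae mu, forall x, forall k, P k x}.
Proof. by move=> h; exact: (ae_countable mu P h). Qed.

Lemma open_meas A : open A -> meas_set A.
Proof. by rewrite ?meas_setE ?measfE ?intOnE => *; exact: open_lebesgue. Qed.

Lemma meas_setI A B : meas_set A -> meas_set B -> meas_set (A `&` B).
Proof. by rewrite ?meas_setE ?measfE ?intOnE => *; exact: measurableI. Qed.

Lemma measf_smooth A f : smooth f -> measf A f.
Proof. by rewrite ?meas_setE ?measfE ?intOnE => *; exact: measurable_smooth. Qed.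

Lemma measf_continuous A f : continuous f -> measf A f.
Proof. by rewrite measfE => cf; apply: measurable_funTS; exact: continuous_lebesgue. Qed.

Lemma measf_sub A B f : meas_set B -> A `<=` B -> measf B f -> measf A f.
Proof. by rewrite meas_setE measfE => mB AB; exact: measurable_funS. Qed.

Lemma measf_cst A (c : R) : measf A (fun=> c).
Proof. by rewrite ?meas_setE ?measfE ?intOnE => *; exact: measurable_cst. Qed.

Lemma measfD A f g : measf A f -> measf A g -> measf A (fun x => f x + g x).
Proof. by rewrite ?meas_setE ?measfE ?intOnE => *; exact: measurable_funD. Qed.

Lemma measfB A f g : measf A f -> measf A g -> measf A (fun x => f x - g x).
Proof. by rewrite ?meas_setE ?measfE ?intOnE => *; exact: measurable_funB. Qed.

Lemma measfM A f g : measf A f -> measf A g -> measf A (fun x => f x * g x).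
Proof. by rewrite ?meas_setE ?measfE ?intOnE => *; exact: measurable_funM. Qed.

Lemma measf_norm A f : measf A f -> measf A (fun x => `|f x|).
Proof. by rewrite ?meas_setE ?measfE ?intOnE => *; exact: measurable_normR. Qed.

Lemma measf_min A f (c : R) : measf A f -> measf A (fun x => Num.min `|f x| c).
Proof. by rewrite ?meas_setE ?measfE ?intOnE => *; exact: measurable_min_normR. Qed.

Lemma measf_comp A (h : R -> R) f : continuous h -> measf A f -> measf A (fun x => h (f x)).
Proof. by rewrite ?meas_setE ?measfE ?intOnE => *; exact: measurable_comp_continuous. Qed.

Lemma measf_comp_mono A (h : R -> R) f : nondecreasing_fun h -> measf A f ->
  measf A (fun x => h (f x)).
Proof.
by rewrite measfE => ch mf; apply: measurableT_comp mf; exact: nondecreasing_measurable.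
Qed.

Lemma measf_dotv A G H : (forall i, measf A (fun x => G x 0 i)) ->
  (forall i, measf A (fun x => H x 0 i)) -> measf A (fun x => dotv (G x) (H x)).
Proof. by rewrite ?meas_setE ?measfE ?intOnE => *; exact: measurable_dotv. Qed.

Lemma measf_enorm A G : (forall i, measf A (fun x => G x 0 i)) ->
  measf A (fun x => enorm (G x)).
Proof. by rewrite ?meas_setE ?measfE ?intOnE => *; exact: measurable_enorm. Qed.

Lemma L1_measf A f : L1 A f -> measf A f.
Proof. by rewrite measfE => h; exact: (intble_meas mu A f h). Qed.

Lemma le_int_EFin A f g : meas_set A -> measf A f -> measf A g ->
  (forall x, A x -> 0 <= f x) -> (forall x, A x -> f x <= g x) ->
  (\int[mu]_(x in A) (f x)%:E <= \int[mu]_(x in A) (g x)%:E)%E.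
Proof. by rewrite meas_setE measfE => mA mf mg; exact: (ge0_le_integral_EFin mu A mA f g mf mg). Qed.

Section on_set.
Variables (A : set E) (mA : meas_set A).

Let mA' : measurable (A : set LE). Proof. by move: mA; rewrite meas_setE. Qed.

Lemma L1_sub B f : meas_set B -> B `<=` A -> L1 A f -> L1 B f.
Proof. by rewrite meas_setE => mB BA; exact: integrableS. Qed.

Lemma L1D f g : L1 A f -> L1 A g -> L1 A (fun x => f x + g x).
Proof. by rewrite ?meas_setE ?measfE ?intOnE => *; exact: (intbleD mu A). Qed.

Lemma L1B f g : L1 A f -> L1 A g -> L1 A (fun x => f x - g x).
Proof. by rewrite ?meas_setE ?measfE ?intOnE => *; exact: (intbleB mu A). Qed.

Lemma L1Z (k : R) f : L1 A f -> L1 A (fun x => k * f x).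
Proof. by rewrite ?meas_setE ?measfE ?intOnE => *; exact: (intbleZ mu A). Qed.

Lemma L1_norm f : L1 A f -> L1 A (fun x => `|f x|).
Proof. by rewrite ?meas_setE ?measfE ?intOnE => *; exact: (intble_norm mu A). Qed.

Lemma L1_dom f g : measf A f -> L1 A g -> (forall x, A x -> `|f x| <= g x) -> L1 A f.
Proof. by rewrite ?measfE ?intOnE => mf ig h; exact: (intble_dom mu A mA' f g mf ig h). Qed.

Lemma L1M f g (C : R) : measf A f -> (forall x, A x -> `|f x| <= C) ->
  L1 A g -> L1 A (fun x => f x * g x).
Proof. by rewrite ?measfE ?intOnE => mf fC ig; exact: (intbleM mu A mA' f g C mf fC ig). Qed.

Lemma L1_sum (I : Type) (s : seq I) (F : I -> E -> R) :
  (forall i, L1 A (F i)) -> L1 A (fun x => \sum_(i <- s) F i x).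
Proof. by rewrite ?meas_setE ?measfE ?intOnE => *; exact: (intble_sum mu A). Qed.

Lemma L1_ae f g : measf A g -> L1 A f ->
  {ae mu, forall x, A x -> f x = g x} -> L1 A g.
Proof. by rewrite ?measfE ?intOnE => mg fi fg; exact: (intble_ae mu A mA' f g mg fi fg). Qed.

Lemma L1_bounded_support f (C K : R) : measf A f -> (forall x, A x -> `|f x| <= C) ->
  (forall x, A x -> K <= enorm x -> f x = 0) -> L1 A f.
Proof. by rewrite ?measfE ?intOnE => mf fC fK; exact (@intble_bounded_support R n A f C K mA' mf fC fK). Qed.

Lemma EFin_intOn f : L1 A f -> (intOn A f)%:E = (\int[mu]_(x in A) (f x)%:E)%E.
Proof. by rewrite ?meas_setE ?measfE ?intOnE => *; exact: (EFin_Int mu A). Qed.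

Lemma intOn_EFin f (a : R) : (\int[mu]_(x in A) (f x)%:E)%E = a%:E -> intOn A f = a.
Proof. by rewrite intOnE /Rintegral => ->. Qed.

Lemma intOnD f g : L1 A f -> L1 A g -> intOn A (fun x => f x + g x) = intOn A f + intOn A g.
Proof. by rewrite ?meas_setE ?measfE ?intOnE => *; exact: (IntD mu A). Qed.

Lemma intOnB f g : L1 A f -> L1 A g -> intOn A (fun x => f x - g x) = intOn A f - intOn A g.
Proof. by rewrite ?meas_setE ?measfE ?intOnE => *; exact: (IntB mu A). Qed.

Lemma intOnZ (k : R) f : L1 A f -> intOn A (fun x => k * f x) = k * intOn A f.
Proof. by rewrite ?meas_setE ?measfE ?intOnE => *; exact: (IntZ mu A). Qed.

Lemma intOn_eq f g : (forall x, A x -> f x = g x) -> intOn A f = intOn A g.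
Proof. by rewrite ?meas_setE ?measfE ?intOnE => *; exact: (Int_eq mu A). Qed.

Lemma intOn_le f g : L1 A f -> L1 A g -> (forall x, A x -> f x <= g x) -> intOn A f <= intOn A g.
Proof. by rewrite ?meas_setE ?measfE ?intOnE => *; exact: (Int_le mu A). Qed.

Lemma intOn_ge0 f : (forall x, A x -> 0 <= f x) -> 0 <= intOn A f.
Proof. by rewrite ?meas_setE ?measfE ?intOnE => *; exact: (Int_ge0 mu A). Qed.

Lemma intOn_norm f : L1 A f -> `|intOn A f| <= intOn A (fun x => `|f x|).
Proof. by rewrite ?meas_setE ?measfE ?intOnE => *; exact: (Int_norm mu A). Qed.

Lemma intOn_ae f g : measf A f -> measf A g ->
  {ae mu, forall x, A x -> f x = g x} -> intOn A f = intOn A g.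
Proof. by rewrite ?measfE ?intOnE => mf mg fg; exact: (Int_ae mu A mA' f g mf mg fg). Qed.

Lemma intOn_le_ae f g : L1 A f -> L1 A g ->
  {ae mu, forall x, A x -> f x <= g x} -> intOn A f <= intOn A g.
Proof. by rewrite ?meas_setE ?measfE ?intOnE => *; exact: (Int_le_ae mu A). Qed.

Lemma intOn_eq0_ae f : L1 A f -> (forall x, A x -> 0 <= f x) -> intOn A f = 0 ->
  {ae mu, forall x, A x -> f x = 0}.
Proof. by rewrite ?meas_setE ?measfE ?intOnE => *; exact: (Int_eq0_ae mu A). Qed.

Lemma intOn_sum (I : Type) (s : seq I) (F : I -> E -> R) : (forall i, L1 A (F i)) ->
  intOn A (fun x => \sum_(i <- s) F i x) = \sum_(i <- s) intOn A (F i).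
Proof.
move=> iF; elim: s => [|i s IH].
  rewrite big_nil; apply/eqP; rewrite eq_le; apply/andP; split; last first.
    by apply: intOn_ge0 => x _; rewrite big_nil.
  have i0 : L1 A (fun x => \sum_(i <- [::]) F i x) by exact: L1_sum.
  rewrite -[leRHS](mul0r (intOn A (fun x => \sum_(i <- [::]) F i x))) -intOnZ//.
  by apply: intOn_le => //; [exact: L1Z|move=> x _; rewrite big_nil mul0r].
rewrite big_cons -IH -intOnD//; last exact: L1_sum.
by apply: intOn_eq => x _; rewrite big_cons.
Qed.

Lemma intOn_trunc_cvg f : L1 A f -> forall e : R, 0 < e ->
  exists k : nat, intOn A (fun x => `|f x| - Num.min `|f x| k%:R) < e.
Proof. by rewrite ?meas_setE ?measfE ?intOnE => *; exact: (Int_trunc_cvg mu A). Qed.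

Lemma L1_test B f : test_function B f -> L1 A f.
Proof.
move=> tf; have [C _ fC] := test_function_bounded _ _ tf.
have [K _ fK] := test_function_support _ _ tf.
apply: (@L1_bounded_support f C K).
- by apply: measf_smooth; case: tf.
- by move=> x _; exact: fC.
- by move=> x _ Kx; apply/eqP; apply: contraTT Kx => /fK; rewrite -ltNge.
Qed.

End on_set.
End rV_interface.

(** * Truncation of functions vanishing on the boundary *)

Section real_lemmas.
Context {R : realType}.

Lemma chi_diff (s t : R) : `|chi s - chi t| <= 1.
Proof.
have := chi_ge0 s; have := chi_le1 s; have := chi_ge0 t; have := chi_le1 t.
by move: (chi s) (chi t) => a b *; rewrite ler_norml; apply/andP; split; lra.
Qed.

Lemma chi_norm (s : R) : `|chi s| <= 1.
Proof. by rewrite ger0_norm ?chi_ge0// chi_le1. Qed.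

Lemma small_eq0 (a C : R) : (forall e, 0 < e -> `|a| <= C * e) -> a = 0.
Proof.
move=> h; apply/eqP; apply: contraT => a0.
have na : 0 < `|a| by rewrite normr_gt0.
have C0 : 0 <= C.
  by have := h 1 ltr01; rewrite mulr1; apply: le_trans.
have C1 : 0 < C + 1 by rewrite ltr_wpDl.
have := h (`|a| / 2 / (C + 1)) _; rewrite !divr_gt0// => /(_ isT).
have : C * (`|a| / 2 / (C + 1)) <= `|a| / 2.
  rewrite mulrA ler_pdivrMr// mulrC ler_wpM2l ?divr_ge0 ?(ltW na)// lerDl//.
by lra.
Qed.

Lemma third_le (e : R) : 0 <= e -> e / 3 <= e.
Proof. lra. Qed.

Lemma sum3_lt (a b s t d e : R) : a < d -> b <= s + e / 3 -> s + t + d <= e / 3 ->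
  0 < e -> a + b + t < e.
Proof. lra. Qed.

End real_lemmas.

Section truncation.
Context {R : realType} {n : nat}.
Local Notation E := 'rV[R]_n.
Local Notation mu := (@lebesgue_rV R n).

Variables (Om : set E) (oOm : open Om) (w : E -> R) (K Gt : E -> E).
Hypothesis wK : W11_grad Om w K.
Hypothesis wapp : forall e : R, 0 < e -> exists2 f, test_function Om f &
    (W11_norm Om (w \- f)%R (fun x => K x - grad f x)%R < e%:E)%E.
Hypothesis wG : W11_grad Om w Gt.
Variables (v : E -> R) (v0 Cv : R).
Hypotheses (sv : smooth v) (v00 : 0 < v0) (v_ge : forall x, v0 <= v x).
Hypothesis v_bd : forall i x, `|partial i v x| <= Cv.

Local Notation itb := (L1 Om).
Local Notation Int := (intOn Om).

Let mOm : meas_set Om. Proof. exact: open_meas. Qed.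
Let iw : itb w. Proof. by have [h _ _] := wK; exact: h. Qed.
Let iK i : itb (fun x => K x 0 i). Proof. by have [_ h _] := wK; exact: h. Qed.
Let iG i : itb (fun x => Gt x 0 i). Proof. by have [_ h _] := wG; exact: h. Qed.
Let mw : measf Om w. Proof. exact: L1_measf iw. Qed.
Let mv : measf Om v. Proof. exact: measf_smooth. Qed.
Let mpv i : measf Om (partial i v).
Proof. by apply: measf_smooth; exact: smooth_partial. Qed.
Let itest f : test_function Om f -> itb f. Proof. exact: L1_test. Qed.
Let itestp f i : test_function Om f -> itb (partial i f).
Proof. by move=> tf; apply: itest; exact: test_function_partial. Qed.

(** [W11_norm] dominates the L^1 distance of the values and of each gradient component. Here [K] is
    the gradient that comes with the approximation by test functions, while [Gt] stands for a
    gradient given by a formula. *)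
Let approx e : 0 < e -> exists f, [/\ test_function Om f, Int (fun x => `|w x - f x|) < e &
  forall i, Int (fun x => `|K x 0 i - partial i f x|) < e].
Proof.
move=> e0; have [f tf] := wapp e0; rewrite /W11_norm => h; exists f.
have iwf : itb (fun x => `|w x - f x|) by apply: L1_norm => //; apply: L1B => //; exact: itest.
have iKf i : itb (fun x => `|K x 0 i - partial i f x|).
  by apply: L1_norm => //; apply: L1B => //; exact: itestp.
split => // [|i].
  rewrite -lte_fin EFin_intOn//; apply: le_lt_trans h.
  rewrite -[leLHS]adde0 leeD//; apply: integral_ge0 => x _; rewrite lee_fin; exact: enorm_ge0.
rewrite -lte_fin EFin_intOn//; apply: le_lt_trans h.
rewrite -[leLHS]add0e leeD//; first by apply: integral_ge0 => x _; rewrite lee_fin.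
apply: (@le_int_EFin R n Om (fun x => `|K x 0 i - partial i f x|)
  (fun x => enorm (K x - grad f x)) mOm).
- exact: L1_measf (iKf i).
- apply: measf_enorm => j.
  under eq_fun do rewrite !mxE.
  by apply: L1_measf; apply: L1B => //; exact: itestp.
- by [].
- by move=> x _; apply: le_trans (coord_le_enorm _ i); rewrite !mxE.
Qed.

Let mchi (f : E -> R) : measf Om f ->
  measf Om (fun x => chi (f x - v x)).
Proof.
move=> mf; exact: (measf_comp (@continuous_chi R) (measfB mf mv)).
Qed.

Let mPhi (f : E -> R) : measf Om f ->
  measf Om (fun x => Phi (f x - v x)).
Proof.
have cP : continuous (@Phi R).
  by move=> x; exact: is_derive1_continuous (is_derive_Phi x).
by move=> mf; exact: (measf_comp cP (measfB mf mv)).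
Qed.

(** The difference of the two steps is at most 1 and at most [L |w - f|]. Cut [|D|] at height [k]:
    the Lipschitz bound serves on [min |D| k], the bound 1 on the remainder, whose integral is below
    [e]. *)
Let chi_approx (D : E -> R) (e : R) : itb D -> 0 < e -> exists2 T, 0 <= T &
  forall f, itb f -> Int (fun x => `|chi (f x - v x) - chi (w x - v x)| * `|D x|) <=
    T * Int (fun x => `|w x - f x|) + e.
Proof.
move=> iD e0; have [L L0 hL] := @chi_lipschitz R.
have [k hk] := intOn_trunc_cvg mOm iD e0.
have iDn : itb (fun x => `|D x|) by exact: L1_norm.
exists (L * k%:R); first by rewrite mulr_ge0.
move=> f jf; have mf := L1_measf jf.
have mc : measf Om (fun x => `|chi (f x - v x) - chi (w x - v x)|).
  by apply: measf_norm; apply: measfB; exact: mchi.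
have imin : itb (fun x => `|D x| - Num.min `|D x| k%:R).
  apply: (L1_dom mOm _ iDn).
    apply: measfB; first exact: L1_measf iDn.
    by apply: measf_min; exact: L1_measf iD.
  move=> x _; rewrite ger0_norm ?subr_ge0 ?ge_min ?lexx// gerBl le_min normr_ge0.
  exact: ler0n.
have iwf : itb (fun x => `|w x - f x|) by apply: L1_norm => //; exact: L1B.
rewrite -intOnZ//; apply: le_trans (lerD (lexx _) (ltW hk)); rewrite -intOnD//; last exact: L1Z.
apply: intOn_le => //.
- by apply: (@L1M R n Om mOm _ _ 1) => // x _; rewrite normr_id chi_diff.
- exact: (L1D mOm (L1Z mOm (L * k%:R) iwf) imin).
move=> x _; rewrite (_ : `|chi (f x - v x) - chi (w x - v x)| * `|D x| =
  `|chi (f x - v x) - chi (w x - v x)| * Num.min `|D x| k%:R +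
  `|chi (f x - v x) - chi (w x - v x)| * (`|D x| - Num.min `|D x| k%:R)); last by ring.
apply: lerD.
  rewrite mulrAC; apply: ler_pM; [by []|by rewrite le_min normr_ge0 ler0n| |].
    apply: le_trans (hL _ _) _; rewrite ler_wpM2l// distrC.
    by rewrite (_ : w x - v x - (f x - v x) = w x - f x)//; ring.
  by rewrite ge_min lexx orbT.
by rewrite ler_piMl ?chi_diff// subr_ge0 ge_min lexx.
Qed.

(** Where [f = 0] the argument of [chi] is [- v x < 0], so the product vanishes there: positivity of
    [v] keeps the support inside that of [f]. *)
Let test_chi f X : test_function Om f -> smooth X ->
  test_function Om (fun x => chi (f x - v x) * X x).
Proof.
move=> tf sX; have [sf _ _] := tf; apply: (test_function_sub Om f _ tf).
  by apply: smoothM sX; apply: smooth_chi; exact: smoothB.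
move=> x ->; rewrite sub0r chi_le0 ?mul0r// oppr_le0; exact: le_trans (ltW v00) (v_ge x).
Qed.

Let test_Phi f : test_function Om f -> test_function Om (fun x => Phi (f x - v x)).
Proof.
move=> tf; have [sf _ _] := tf; apply: (test_function_sub Om f _ tf).
  by apply: smooth_Phi; exact: smoothB.
move=> x ->; rewrite sub0r Phi_le0// oppr_le0; exact: le_trans (ltW v00) (v_ge x).
Qed.

(** The gradients [K] and [Gt] need not be compared pointwise: [chi (f - v) * X]
    is a test function on [Om] for every test function [f]. *)
Let chi_orthogonal (D X : E -> R) (C : R) : itb D ->
  (forall f, test_function Om f -> Int (fun x => f x * D x) = 0) ->
  smooth X -> (forall x, `|X x| <= C) ->
  Int (fun x => chi (w x - v x) * X x * D x) = 0.
Proof.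
move=> iD Dtest sX XC.
have iDn : itb (fun x => `|D x|) by exact: L1_norm.
have mX : measf Om X by exact: measf_smooth.
have C0 : 0 <= C by apply: le_trans (XC 0).
apply: (small_eq0 (C := 2 * C)) => e e0.
have [T T0 hT] := chi_approx iD e0.
have [f [tf wf _]] := approx (divr_gt0 e0 (ltr_wpDl T0 ltr01)).
have sf : smooth f by case: tf.
have if_ := itest tf; have mf := L1_measf if_.
have ia : itb (fun x => chi (w x - v x) * X x * D x).
  apply: (@L1M R n Om mOm _ _ C); [exact: measfM (mchi mw) mX| |exact: iD].
  by move=> x _; rewrite normrM -[leRHS]mul1r ler_pM ?chi_norm.
have ib : itb (fun x => chi (f x - v x) * X x * D x).
  apply: (@L1M R n Om mOm _ _ C); [exact: measfM (mchi mf) mX| |exact: iD].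
  by move=> x _; rewrite normrM -[leRHS]mul1r ler_pM ?chi_norm.
have mdc : measf Om (fun x => `|chi (f x - v x) - chi (w x - v x)|).
  by apply: measf_norm; apply: measfB; exact: mchi.
have ic : itb (fun x => `|chi (f x - v x) - chi (w x - v x)| * `|D x|).
  by apply: (@L1M R n Om mOm _ _ 1) => // x _; rewrite normr_id chi_diff.
have -> : Int (fun x => chi (w x - v x) * X x * D x) =
    Int (fun x => chi (w x - v x) * X x * D x - chi (f x - v x) * X x * D x).
  have z : Int (fun x => chi (f x - v x) * X x * D x) = 0 := Dtest _ (test_chi tf sX).
  by rewrite (intOnB mOm ia ib) z subr0.
apply: le_trans (intOn_norm mOm (L1B mOm ia ib)) _.
apply: (@le_trans _ _ (C * Int (fun x => `|chi (f x - v x) - chi (w x - v x)| * `|D x|))).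
  rewrite -intOnZ//; apply: intOn_le => //; [|exact: L1Z|].
    by apply: L1_norm => //; exact: L1B.
  move=> x _; rewrite -mulrBl -mulrBl !normrM distrC mulrAC (mulrC C).
  by rewrite ler_wpM2l// mulr_ge0.
rewrite (mulrC 2) -mulrA ler_wpM2l//; apply: le_trans (hT f if_) _.
have : T * Int (fun x => `|w x - f x|) <= e.
  apply: le_trans (ler_wpM2l T0 (ltW wf)) _.
  by rewrite mulrA ler_pdivrMr ?ltr_wpDl// mulrC ler_wpM2l ?(ltW e0)// lerDl.
by move=> h; rewrite mulr_natl mulr2n lerD2r.
Qed.

(** Both gradients satisfy the same integration by parts, so the difference of their components is
    orthogonal to every test function on [Om]. *)
Let chi_grad_eq X i (C : R) : smooth X -> (forall x, `|X x| <= C) ->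
  Int (fun x => chi (w x - v x) * X x * (K x 0 i - Gt x 0 i)) = 0.
Proof.
move=> sX XC; apply: (chi_orthogonal (D := fun x => K x 0 i - Gt x 0 i) (C := C)) => //.
  exact: L1B.
move=> f tf; have [_ _ /(_ f tf i) eK] := wK; have [_ _ /(_ f tf i) eG] := wG.
have [Cf _ fC] := test_function_bounded _ _ tf.
have mf : measf Om f by apply: measf_smooth; case: tf.
have jK : itb (fun x => f x * K x 0 i) by apply: (@L1M R n Om mOm _ _ Cf).
have jG : itb (fun x => f x * Gt x 0 i) by apply: (@L1M R n Om mOm _ _ Cf).
have eKG : (\int[mu]_(x in Om) (Gt x 0 i * f x)%:E = \int[mu]_(x in Om) (K x 0 i * f x)%:E)%E.
  by apply: oppe_inj; rewrite -eG.
transitivity (Int (fun x => f x * K x 0 i - f x * Gt x 0 i)).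
  by apply: intOn_eq => x _; rewrite mulrBr.
rewrite (intOnB mOm jK jG).
have -> : Int (fun x => f x * K x 0 i) = Int (fun x => K x 0 i * f x).
  by apply: intOn_eq => x _; rewrite mulrC.
have -> : Int (fun x => f x * Gt x 0 i) = Int (fun x => Gt x 0 i * f x).
  by apply: intOn_eq => x _; rewrite mulrC.
by rewrite intOnE /Rintegral eKG subrr.
Qed.

Definition trunc x : R := Phi (w x - v x).
Definition trunc_grad (G : E -> E) x : E := \row_i (chi (w x - v x) * (G x 0 i - partial i v x)).

(** [Phi (f - v)] approximates the truncation. Its gradient error has three parts: [chi (f - v)]
    times [K - grad f], and the change of [chi] times [K] or times [grad v]. The second part is the
    work of [chi_approx], the third that of the Lipschitz constant of [chi]. *)
Let trunc_approx e : 0 < e -> exists f, [/\ test_function Om f,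
   Int (fun x => `|trunc x - f x|) < e &
   forall i, itb (fun x => trunc_grad K x 0 i - partial i f x) /\
     Int (fun x => `|trunc_grad K x 0 i - partial i f x|) < e].
Proof.
move=> e0; have [L L0 hL] := @chi_lipschitz R.
have e30 : 0 < e / 3 by rewrite divr_gt0.
have hTi i := chi_approx (iK i) e30.
pose T i := projT1 (cid2 (hTi i)).
have T0 i : 0 <= T i by rewrite /T; case: (cid2 _).
have hT i : forall f, itb f ->
   Int (fun x => `|chi (f x - v x) - chi (w x - v x)| * `|K x 0 i|) <=
    T i * Int (fun x => `|w x - f x|) + e / 3 by rewrite /T; case: (cid2 _).
(* Chosen so that [(T i + L |Cv| + 1) / S <= 1] for all [i] at once; the accuracy [e / 3 / S] for
   [f] then controls all three parts of the error. *)
pose S := 1 + \sum_i T i + L * `|Cv|.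
have S1 : 1 <= S.
  by rewrite /S -addrA lerDl addr_ge0 ?mulr_ge0// sumr_ge0.
have S0 : 0 < S by exact: lt_le_trans S1.
have d0 : 0 < e / 3 / S by rewrite divr_gt0.
have [f [tf wf Kf]] := approx d0.
have sf : smooth f by case: tf.
have if_ := itest tf; have mf := L1_measf if_.
have iwf : itb (fun x => `|w x - f x|) by apply: L1_norm => //; exact: L1B.
have de : e / 3 / S <= e / 3 by rewrite ler_pdivrMr// ler_peMr// ltW.
exists (fun x => Phi (f x - v x)); split; first exact: test_Phi.
  apply: le_lt_trans (lt_le_trans wf _); last exact: le_trans de (third_le (ltW e0)).
  have PL x : `|trunc x - Phi (f x - v x)| <= `|w x - f x|.
    apply: le_trans (Phi_lipschitz _ _) _.
    by rewrite (_ : w x - v x - (f x - v x) = w x - f x)//; ring.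
  apply: intOn_le => //; apply: (L1_dom mOm _ iwf).
    by apply: measf_norm; apply: measfB; exact: mPhi.
  by move=> x _; rewrite normr_id.
move=> i.
have pE x : trunc_grad K x 0 i - partial i (fun x => Phi (f x - v x)) x =
    chi (f x - v x) * (K x 0 i - partial i f x) -
    (chi (f x - v x) - chi (w x - v x)) * K x 0 i +
    (chi (f x - v x) - chi (w x - v x)) * partial i v x.
  by rewrite mxE partial_Phi ?partialB//; [ring|exact: smoothB].
have mc := mchi mf.
have md : measf Om (fun x => chi (f x - v x) - chi (w x - v x)).
  by apply: measfB; exact: mchi.
have i1 : itb (fun x => K x 0 i - partial i f x) by apply: L1B => //; exact: itestp.
have i1n : itb (fun x => `|K x 0 i - partial i f x|) by exact: L1_norm.
have i2 : itb (fun x => `|chi (f x - v x) - chi (w x - v x)| * `|K x 0 i|).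
  apply: (@L1M R n Om mOm _ _ 1); first exact: measf_norm.
    by move=> x _; rewrite normr_id chi_diff.
  exact: L1_norm.
have bound x : `|trunc_grad K x 0 i - partial i (fun x => Phi (f x - v x)) x| <=
   `|K x 0 i - partial i f x| + `|chi (f x - v x) - chi (w x - v x)| * `|K x 0 i| +
   L * `|Cv| * `|w x - f x|.
  rewrite pE; apply: le_trans (ler_normD _ _) _; apply: lerD.
    apply: le_trans (ler_normB _ _) _; apply: lerD; rewrite normrM//.
    by rewrite ler_piMl ?chi_norm.
  rewrite normrM -mulrA (mulrC `|Cv|) mulrA; apply: ler_pM => //.
    apply: le_trans (hL _ _) _; rewrite distrC.
    by rewrite (_ : w x - v x - (f x - v x) = w x - f x)//; ring.
  exact: le_trans (v_bd i x) (ler_norm _).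
have ib : itb (fun x => `|K x 0 i - partial i f x| +
     `|chi (f x - v x) - chi (w x - v x)| * `|K x 0 i| + L * `|Cv| * `|w x - f x|).
  by apply: L1D => //; [exact: L1D|exact: L1Z].
have ig : itb (fun x => trunc_grad K x 0 i - partial i (fun x => Phi (f x - v x)) x).
  apply: (L1_dom mOm _ ib) => //.
  under eq_fun do rewrite pE.
  apply: measfD; last exact: measfM md (mpv i).
  apply: measfB; [apply: (measfM mc)|apply: (measfM md)].
    exact: L1_measf i1.
  exact: L1_measf (iK i).
split => //.
apply: (@le_lt_trans _ _ (Int (fun x => `|K x 0 i - partial i f x| +
     `|chi (f x - v x) - chi (w x - v x)| * `|K x 0 i| + L * `|Cv| * `|w x - f x|))).
  by apply: intOn_le => //; exact: L1_norm.
rewrite intOnD//; [|exact: L1D|exact: L1Z].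
rewrite intOnD// intOnZ//.
have h1 := Kf i; have h2 := hT i f if_.
have h3 : (T i + L * `|Cv|) * Int (fun x => `|w x - f x|) + e / 3 / S <= e / 3.
  apply: (@le_trans _ _ ((T i + L * `|Cv|) * (e / 3 / S) + e / 3 / S)).
    by rewrite lerD2r ler_wpM2l ?(ltW wf)// addr_ge0// mulr_ge0.
  rewrite -{2}[e / 3 / S]mul1r -mulrDl mulrC.
  have -> : e / 3 / S * (T i + L * `|Cv| + 1) = (e / 3) * ((T i + L * `|Cv| + 1) / S) by ring.
  rewrite -[leRHS]mulr1 ler_wpM2l ?(ltW e30)// ler_pdivrMr// mul1r /S.
  have : T i <= \sum_i T i by rewrite (bigD1 i)//= lerDl sumr_ge0.
  by move=> h; rewrite addrC addrA lerD2r lerD2l.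
by rewrite mulrDl in h3; exact: sum3_lt h1 h2 h3 e0.
Qed.

Lemma trunc_intble : itb trunc.
Proof.
apply: (L1_dom mOm _ (L1_norm iw)); first exact: mPhi.
move=> x _; rewrite ger0_norm ?Phi_ge0// /trunc.
have [h|h] := leP 0 (w x - v x); last by rewrite Phi_le0// ltW.
apply: le_trans (Phi_le _ h) _; apply: le_trans (ler_norm _).
by rewrite gerBl (le_trans (ltW v00)).
Qed.

(** [partial i v] is only bounded, while [Om] may have infinite measure. Where the factor [chi] is
    positive, [|w| >= v >= v0], hence [Cv <= (Cv / v0) |w|], which is integrable. *)
Lemma trunc_grad_intble (G : E -> E) i : itb (fun x => G x 0 i) ->
  itb (fun x => trunc_grad G x 0 i).
Proof.
move=> jG; have v0n : v0 != 0 by rewrite gt_eqF.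
have Cv0 : 0 <= Cv by apply: le_trans (v_bd i 0).
apply: (L1_dom mOm (g := fun x => `|G x 0 i| + Cv / v0 * `|w x|)).
- under eq_fun do rewrite mxE; apply: measfM; first exact: mchi.
  by apply: measfB (mpv i); exact: L1_measf jG.
- by apply: L1D => //; [exact: L1_norm|apply: L1Z => //; exact: L1_norm].
move=> x _; rewrite mxE normrM; have [h|h] := leP (w x - v x) 0.
  by rewrite chi_le0// normr0 mul0r addr_ge0// mulr_ge0// divr_ge0// ltW.
apply: (@le_trans _ _ `|G x 0 i - partial i v x|); first by rewrite ler_piMl ?chi_norm.
apply: le_trans (ler_normB _ _) _; rewrite lerD2l; apply: le_trans (v_bd i x) _.
rewrite -mulrA ler_peMr// mulrC ler_pdivlMr// mul1r.
by apply: le_trans (v_ge x) _; apply: le_trans (ler_norm _); rewrite subr_gt0 in h; exact: ltW.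
Qed.

(** [X] is a test function on the whole space: the truncation is a limit of test functions on [Om],
    so no boundary term arises. [test_divergence] relies on this. *)
Lemma trunc_ibp X i : test_function setT X ->
  Int (fun x => trunc x * partial i X x) = - Int (fun x => trunc_grad Gt x 0 i * X x).
Proof.
move=> tX; have [sX _ _] := tX.
have [C C0 XC] := test_function_bounded _ _ tX.
have [C' C'0 XC'] := test_function_bounded _ _ (test_function_partial _ _ i tX).
have mX : measf Om X by exact: measf_smooth.
have mpX : measf Om (partial i X).
  by apply: measf_smooth; exact: smooth_partial.
have jK := trunc_grad_intble (iK i).
have jG := trunc_grad_intble (iG i).
have bX (h : E -> R) : itb h -> itb (fun x => X x * h x).
  by move=> ih; apply: (@L1M R n Om mOm _ _ C).
have bpX (h : E -> R) : itb h -> itb (fun x => partial i X x * h x).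
  by move=> ih; apply: (@L1M R n Om mOm _ _ C').
have KG : Int (fun x => X x * trunc_grad K x 0 i) = Int (fun x => X x * trunc_grad Gt x 0 i).
  apply/eqP; rewrite -subr_eq0 -intOnB//; [|exact: bX|exact: bX].
  rewrite -[X in _ == X](chi_grad_eq i sX XC); apply/eqP.
  by apply: intOn_eq => x _; rewrite !mxE; ring.
have -> : Int (fun x => trunc x * partial i X x) = Int (fun x => partial i X x * trunc x).
  by apply: intOn_eq => x _; rewrite mulrC.
have -> : Int (fun x => trunc_grad Gt x 0 i * X x) = Int (fun x => X x * trunc_grad Gt x 0 i).
  by apply: intOn_eq => x _; rewrite mulrC.
rewrite -KG; apply/eqP; rewrite -addr_eq0; apply/eqP.
apply: (small_eq0 (C := C + C')) => e e0.
have [f [tf psif Kf]] := trunc_approx e0.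
have sf : smooth f by case: tf.
have [igi Kfi] := Kf i.
have if_ := itest tf; have ipf := itestp i tf.
(* [X * f] is supported in [Om], so the integral of its derivative over [Om] equals the integral
   over the whole space, which is 0. *)
have f0 : Int (fun x => partial i X x * f x) + Int (fun x => X x * partial i f x) = 0.
  rewrite -intOnD//; [|exact: bpX|exact: bX].
  have tXf : test_function Om (fun x => X x * f x) by exact: test_functionM.
  have := integral_partial_test _ _ i tXf => h.
  transitivity (fine (\int[mu]_x (partial i (fun x => X x * f x) x)%:E)); last by rewrite h.
  rewrite intOnE /Rintegral integral_mkcond; congr fine; apply: eq_integral => x _.
  rewrite patchE partialM//; case: ifPn => [_|]; first by congr EFin; ring.
  rewrite notin_setE => nOm.
  have z0 g : test_function Om g -> g x = 0.
    move=> [_ _ gOm]; apply/eqP; apply: contraT => gx; case: nOm; apply: gOm.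
    exact: subset_closure.
  by rewrite (z0 _ (test_function_partial _ _ i tf)) (z0 _ tf) mulr0 mul0r addr0.
have -> : Int (fun x => partial i X x * trunc x) + Int (fun x => X x * trunc_grad K x 0 i) =
    Int (fun x => partial i X x * trunc x - partial i X x * f x) +
    Int (fun x => X x * trunc_grad K x 0 i - X x * partial i f x).
  rewrite (intOnB mOm (bpX _ trunc_intble) (bpX _ if_)).
  by rewrite (intOnB mOm (bX _ jK) (bX _ ipf)) addrACA -opprD f0 subr0.
apply: le_trans (ler_normD _ _) _; rewrite addrC mulrDl; apply: lerD.
- apply: le_trans (intOn_norm mOm _) _; first by apply: L1B => //; exact: bX.
  apply: le_trans (ler_wpM2l C0 (ltW Kfi)); rewrite -intOnZ//; last exact: L1_norm.
  apply: intOn_le => //.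
  + by apply: L1_norm => //; apply: L1B => //; exact: bX.
  + by apply: L1Z => //; exact: L1_norm.
  + by move=> x _; rewrite -mulrBr normrM ler_wpM2r.
- have ipsif : itb (fun x => trunc x - f x) by apply: L1B => //; exact: trunc_intble.
  apply: le_trans (intOn_norm mOm _) _.
    by apply: L1B => //; apply: bpX => //; exact: trunc_intble.
  apply: le_trans (ler_wpM2l C'0 (ltW psif)); rewrite -intOnZ//; last exact: L1_norm.
  apply: intOn_le => //.
  + by apply: L1_norm => //; apply: L1B => //; apply: bpX => //; exact: trunc_intble.
  + by apply: L1Z => //; exact: L1_norm.
  + by move=> x _; rewrite -mulrBr normrM ler_wpM2r.
Qed.

Lemma trunc_norm_approx e : 0 < e -> exists2 f, test_function Om f &
  (W11_norm Om (trunc \- f)%R (fun x => trunc_grad K x - grad f x)%R < e%:E)%E.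
Proof.
(* One share for the values and one for each of the [n] components use [n.+1] shares out of [n.+2],
   which leaves the inequality strict. *)
move=> e0; have d0 : 0 < e / n.+2%:R by rewrite divr_gt0.
have [f [tf psif Kf]] := trunc_approx d0; exists f => //.
have if_ := itest tf.
have ipf : itb (fun x => `|trunc x - f x|).
  by apply: L1_norm; apply: L1B => //; exact: trunc_intble.
have iK' i : itb (fun x => `|trunc_grad K x 0 i - partial i f x|).
  by apply: L1_norm; case: (Kf i).
have iS : itb (fun x => \sum_i `|trunc_grad K x 0 i - partial i f x|) by exact: L1_sum.
apply: (@le_lt_trans _ _ (Int (fun x => `|trunc x - f x|) +
    \sum_i Int (fun x => `|trunc_grad K x 0 i - partial i f x|))%:E); last first.
  rewrite lte_fin; apply: (@le_lt_trans _ _ (n.+1%:R * (e / n.+2%:R))); last first.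
    by rewrite mulrCA gtr_pMr// ltr_pdivrMr// mul1r ltr_nat.
  rewrite -natr1 mulrDl mul1r addrC lerD ?(ltW psif)//.
  apply: (@le_trans _ _ (\sum_(i < n) e / n.+2%:R)).
    by apply: ler_sum => i _; case: (Kf i) => _ /ltW.
  by rewrite sumr_const card_ord mulr_natl.
rewrite /W11_norm EFinD EFin_intOn//; apply: leeD => //.
rewrite -intOn_sum// EFin_intOn//.
apply: (@le_int_EFin R n Om (fun x => enorm (trunc_grad K x - grad f x))
  (fun x => \sum_i `|trunc_grad K x 0 i - partial i f x|)) => //.
- apply: measf_enorm => i.
  rewrite (_ : (fun x => _) = (fun x => trunc_grad K x 0 i - partial i f x)).
    by apply: L1_measf; case: (Kf i).
  by apply/funext => x; rewrite !mxE.
- exact: L1_measf iS.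
- by move=> x _; exact: enorm_ge0.
- move=> x _; apply: le_trans (enorm_le_sum _) _; apply: ler_sum => i _.
  by rewrite !mxE.
Qed.

Lemma trunc_W11_grad : W11_grad Om trunc (trunc_grad Gt).
Proof.
split; [exact: trunc_intble|by move=> i; apply: trunc_grad_intble; exact: iG|].
move=> f tf i.
have [C C0 XC] := test_function_bounded _ _ tf.
have [C' C'0 XC'] := test_function_bounded _ _ (test_function_partial _ _ i tf).
have mf : measf Om f by apply: measf_smooth; case: tf.
have mpf : measf Om (partial i f) by apply: measf_smooth; apply: smooth_partial; case: tf.
have j1 : itb (fun x => trunc x * partial i f x).
  rewrite (_ : (fun x => _) = (fun x => partial i f x * trunc x)); last first.
    by apply/funext => x; rewrite mulrC.
  by apply: (@L1M R n Om mOm _ _ C') => //; exact: trunc_intble.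
have j2 : itb (fun x => trunc_grad Gt x 0 i * f x).
  rewrite (_ : (fun x => _) = (fun x => f x * trunc_grad Gt x 0 i)); last first.
    by apply/funext => x; rewrite mulrC.
  by apply: (@L1M R n Om mOm _ _ C) => //; apply: trunc_grad_intble; exact: iG.
rewrite -!EFin_intOn// -EFinN trunc_ibp//.
exact: test_function_subset tf.
Qed.

End truncation.

(** The definition of the closure asks for some weak gradient, so the choice [Gt := K] suffices. *)
Lemma trunc_W11_0 (R : realType) (n : nat) (Om : set 'rV[R]_n) (w v : 'rV[R]_n -> R)
    (K : 'rV[R]_n -> 'rV[R]_n) (v0 Cv : R) :
  open Om -> W11_grad Om w K ->
  (forall e : R, 0 < e -> exists2 f, test_function Om f &
    (W11_norm Om (w \- f)%R (fun x => K x - grad f x)%R < e%:E)%E) ->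
  smooth v -> 0 < v0 -> (forall x, v0 <= v x) ->
  (forall i x, `|partial i v x| <= Cv) ->
  W11_0 Om (trunc w v).
Proof.
move=> oOm wK wapp sv v00 vge vbd; exists (trunc_grad w v K).
  exact: (trunc_W11_grad oOm wK wapp wK sv v00 vge vbd).
move=> e e0; exact: (trunc_norm_approx oOm wK wapp sv v00 vge vbd e0).
Qed.

(** * Passing from balls to the whole domain *)

Section extension.
Context {R : realType} {n : nat}.
Local Notation E := 'rV[R]_n.
Local Notation mu := (@lebesgue_rV R n).
Implicit Types (A B : set E) (f g : E -> R).

Lemma meas_eball (r : R) : meas_set (eball r : set E).
Proof. by apply: open_meas; exact: open_eball. Qed.

Lemma L1_extend A B f : meas_set A -> meas_set B -> L1 (A `&` B) f ->
  (forall x, A x -> ~ B x -> f x = 0) ->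
  L1 A f /\ intOn A f = intOn (A `&` B) f.
Proof.
rewrite meas_setE intOnE => mA mB fi f0; split.
  move/(integrable_restrict mu mB mA) : fi; apply: eq_integrable => // x /[!inE] Ax.
  by rewrite patchE; case: ifPn => //; rewrite notin_setE => nB; rewrite /= f0.
rewrite [RHS]Rintegral_mkcondr; apply: eq_Rintegral => x /[!inE] Ax.
by rewrite patchE; case: ifPn => //; rewrite notin_setE => nB; rewrite f0.
Qed.

Lemma L1_extend_ae A B f : meas_set A -> meas_set B -> measf A f -> L1 (A `&` B) f ->
  {ae mu, forall x, A x -> ~ B x -> f x = 0} ->
  L1 A f /\ intOn A f = intOn (A `&` B) f.
Proof.
move=> mA mB mf fi f0.
pose g := f \_ B.
have gB x : B x -> g x = f x by move=> Bx; rewrite /g patchE mem_set.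
have gN x : ~ B x -> g x = 0 by move=> Bx; rewrite /g patchE memNset.
have gi : L1 (A `&` B) g.
  by move: fi; apply: eq_integrable; [move: (meas_setI mA mB); rewrite meas_setE
    |move=> x /[!inE] -[_ Bx]; rewrite /= gB].
have [gA gE] := L1_extend mA mB gi (fun x _ => gN x).
have gf : {ae mu, forall x, A x -> g x = f x}.
  apply: (ae_mono f0) => x h Ax; have [Bx|Bx] := pselect (B x); first by rewrite gB.
  by rewrite gN// h.
split; first exact: (L1_ae mA mf gA gf).
rewrite -(intOn_ae mA (L1_measf gA) mf gf) gE.
by apply: intOn_eq => x [_ Bx]; rewrite gB.
Qed.

Lemma measf_local A f : meas_set A ->
  (forall r, 0 < r -> measf (A `&` eball r) f) -> measf A f.
Proof.
move=> mA mf; have mB (k : nat) : meas_set (A `&` eball k.+1%:R).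
  by apply: meas_setI => //; exact: meas_eball.
have -> : A = \bigcup_(k : nat) (A `&` eball k.+1%:R).
  apply/seteqP; split=> [x Ax|x [k _ []]//].
  exists (Num.bound (enorm x)) => //; split => //=.
  rewrite /eball /= (lt_le_trans (archi_boundP (enorm_ge0 x)))// ler_nat//.
move: mB mf; rewrite meas_setE measfE => mB mf.
by apply/measurable_fun_bigcup => // k; exact: mf.
Qed.

Lemma measf_inv A f : (forall x, 0 <= f x) -> measf A f -> measf A (fun x => (f x)^-1).
Proof.
rewrite measfE => f0 mf.
have -> : (fun x => (f x)^-1) = (fun x => f x `^ (-1)).
  by apply/funext => x; rewrite powR_inv1.
exact: (measurableT_comp (measurable_powR _) mf).
Qed.

Lemma L1_cst A (c : R) (r : R) : meas_set A -> L1 (A `&` eball r) (fun=> c).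
Proof.
move=> mA; have mAr : meas_set (A `&` eball r) by apply: meas_setI => //; exact: meas_eball.
apply: (L1_bounded_support mAr (C := `|c|) (K := r)); first exact: measf_cst.
- by [].
- by move=> x [_]; rewrite /eball /= ltNge => /negP.
Qed.

End extension.

Section product_rule.
Context {R : realType} {n : nat}.
Local Notation E := 'rV[R]_n.
Variables (Om : set E) (u : E -> R) (G : E -> E) (gam : E -> R) (r : R).
Hypotheses (oOm : open Om) (uG : W11_grad (Om `&` eball r) u G).
Hypothesis tgam : test_function (eball r) gam.

Definition prod_grad x : E := \row_i (gam x * G x 0 i + u x * partial i gam x).

(** The gradient of [u] is given on [Om] inside the ball. For a test function [f] on [Om] the
    product [gam * f] is a test function on that smaller set, and its derivative splits by the
    product rule; outside the ball every term vanishes with [gam]. *)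
Lemma W11_grad_prod : W11_grad Om (fun x => gam x * u x) prod_grad.
Proof.
have mOm : meas_set Om by exact: open_meas.
have mB : meas_set (Om `&` eball r) by apply: meas_setI => //; exact: meas_eball.
have [u1 G1 ibp] := uG; have [sgam _ gsub] := tgam.
have gam0 g x : test_function (eball r) g -> ~ eball r x -> g x = 0.
  move=> [_ _ gs] nx; apply/eqP; apply: contraT => gx; case: nx; apply: gs.
  exact: subset_closure.
have bM g h : test_function (eball r) g -> L1 (Om `&` eball r) h ->
    L1 (Om `&` eball r) (fun x => g x * h x).
  move=> tg ih; have [C _ gC] := test_function_bounded _ _ tg.
  apply: (L1M mB (C := C)) => //; apply: measf_smooth; by case: tg.
have tpg i : test_function (eball r) (partial i gam) by exact: test_function_partial.
have i1 : L1 (Om `&` eball r) (fun x => gam x * u x) by exact: bM.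
have i2 i : L1 (Om `&` eball r) (fun x => gam x * G x 0 i + u x * partial i gam x).
  apply: L1D => //; first by apply: bM => //; exact: G1.
  by under eq_fun do rewrite mulrC; exact: bM.
have e1 := L1_extend mOm (meas_eball r) i1.
have {e1}[|I1 _] := e1; first by move=> x _ nx; rewrite (gam0 _ _ _ tgam nx) mul0r.
have I2 i : L1 Om (fun x => prod_grad x 0 i).
  under eq_fun do rewrite mxE.
  have [|h _] := L1_extend mOm (meas_eball r) (i2 i); last exact: h.
  by move=> x _ nx; rewrite (gam0 _ _ _ tgam nx) (gam0 _ _ _ (tpg i) nx) mul0r mulr0 addr0.
split => // f tf i.
have [sf _ fOm] := tf.
have tpf := test_function_partial _ _ i tf.
have [Cf _ fC] := test_function_bounded _ _ tf.
have [Cpf _ pfC] := test_function_bounded _ _ tpf.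
have tY : test_function (Om `&` eball r) (fun x => gam x * f x).
  have [_ _ h1] := test_functionM _ _ _ tf sgam.
  have [sY cY h2] := test_functionM _ _ _ tgam sf.
  have -> : (fun x => gam x * f x) = (fun x => f x * gam x) by apply/funext => x; rewrite mulrC.
  split => // x hx; split; last exact: h2.
  by apply: h1; move: hx; under [X in closure X]eq_set do rewrite mulrC.
have mf : measf Om f by exact: measf_smooth.
have mpf : measf Om (partial i f) by apply: measf_smooth; exact: smooth_partial.
have mfB : measf (Om `&` eball r) f by exact: measf_smooth.
have J1 : L1 Om (fun x => gam x * u x * partial i f x).
  by under eq_fun do rewrite mulrC; apply: (L1M mOm (C := Cpf)).
have J2 : L1 Om (fun x => prod_grad x 0 i * f x).
  by under eq_fun do rewrite mulrC; apply: (L1M mOm (C := Cf)).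
rewrite -!EFin_intOn// -EFinN; congr EFin.
have sOB : Om `&` eball r `<=` Om by move=> x [].
have [_ ->] : L1 Om (fun x => gam x * u x * partial i f x) /\
    intOn Om (fun x => gam x * u x * partial i f x) =
    intOn (Om `&` eball r) (fun x => gam x * u x * partial i f x).
  apply: L1_extend => //; [exact: meas_eball|exact: L1_sub J1|].
  by move=> x _ nx; rewrite (gam0 _ _ _ tgam nx) !mul0r.
have [_ ->] : L1 Om (fun x => prod_grad x 0 i * f x) /\
    intOn Om (fun x => prod_grad x 0 i * f x) =
    intOn (Om `&` eball r) (fun x => prod_grad x 0 i * f x).
  apply: L1_extend => //; [exact: meas_eball|exact: L1_sub J2|].
  by move=> x _ nx; rewrite mxE (gam0 _ _ _ tgam nx) (gam0 _ _ _ (tpg i) nx) mul0r mulr0 addr0 mul0r.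
have := ibp _ tY i.
have tpY := test_function_partial _ _ i tY.
have [CY _ YC] := test_function_bounded _ _ tY.
have [CpY _ pYC] := test_function_bounded _ _ tpY.
have L1' : L1 (Om `&` eball r) (fun x => u x * partial i (fun x => gam x * f x) x).
  under eq_fun do rewrite mulrC; apply: (L1M mB (C := CpY)) => //.
  by apply: measf_smooth; case: tpY.
have L2' : L1 (Om `&` eball r) (fun x => G x 0 i * (gam x * f x)).
  under eq_fun do rewrite mulrC; apply: (L1M mB (C := CY)) => //.
  by apply: measf_smooth; case: tY.
rewrite -!EFin_intOn// -EFinN => -[eI].
have L3' : L1 (Om `&` eball r) (fun x => u x * partial i gam x * f x).
  under eq_fun do rewrite mulrC; apply: (L1M mB (C := Cf)) => //.
  by under eq_fun do rewrite mulrC; exact: bM.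
have J1' := L1_sub mOm mB sOB J1.
have -> : intOn (Om `&` eball r) (fun x => gam x * u x * partial i f x) =
  intOn (Om `&` eball r) (fun x => u x * partial i (fun x => gam x * f x) x -
     u x * partial i gam x * f x).
  by apply: intOn_eq => x _; rewrite partialM//; ring.
rewrite intOnB// eI -opprD -intOnD//; congr (- _).
by apply: intOn_eq => x _; rewrite mxE; ring.
Qed.

End product_rule.

(** * The scalar functions *)

Section profile.
Context {R : realType}.
Variables (phi : R -> R).
Hypothesis phi_bij : set_bij `[0, +oo[%classic `[0, +oo[%classic phi.
Hypothesis phi_incr : forall s t, 0 <= s -> s < t -> phi s < phi t.
Local Notation p := (phi_inv phi).
Local Notation eta := (eta_of phi).
Local Notation etai := (eta_inv phi).

Let inA (x : R) : (x \in `[0, +oo[%classic) = (0 <= x).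
Proof. by rewrite mem_setE in_itv/= andbT. Qed.

Lemma phi_ge0 x : 0 <= x -> 0 <= phi x.
Proof.
move=> x0; have [+ _ _] := phi_bij => /(_ x).
by rewrite /= !in_itv/= !andbT; apply.
Qed.

Lemma phi_le s t : 0 <= s -> s <= t -> phi s <= phi t.
Proof. by move=> s0; rewrite le_eqVlt => /predU1P[->//|/(phi_incr s0)/ltW]. Qed.

Lemma phi_invK y : 0 <= y -> phi (p y) = y.
Proof.
move=> y0; have [_ _ h] := phi_bij; apply: (surjpK _ h).
by rewrite inA.
Qed.

Lemma phi_inv_ge0 y : 0 <= y -> 0 <= p y.
Proof.
move=> y0; have [_ _ h] := phi_bij.
have := surjpinv_image_sub (dflt := fun=> 0 : R) (t := p y) h.
rewrite /= in_itv/= andbT; apply; exists y => //.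
by rewrite /= in_itv/= y0.
Qed.

Lemma phiK x : 0 <= x -> p (phi x) = x.
Proof.
move=> x0; have [_ h _] := phi_bij.
by apply: (pinvKV (fun=> 0 : R) h); rewrite inA.
Qed.

Lemma phi0 : phi 0 = 0.
Proof.
apply/eqP; rewrite eq_le phi_ge0// andbT -[leRHS](phi_invK (lexx 0)).
by apply: phi_le => //; exact: phi_inv_ge0.
Qed.

Lemma phi_inv0 : p 0 = 0.
Proof. by rewrite -{1}phi0 phiK. Qed.

Lemma phi_inv_lt s t : 0 <= s -> s < t -> p s < p t.
Proof.
move=> s0 st; have t0 : 0 <= t by exact: ltW (le_lt_trans s0 st).
rewrite ltNge; apply/negP => /(phi_le (phi_inv_ge0 t0)).
by rewrite !phi_invK// leNgt st.
Qed.

Lemma phi_inv_le s t : 0 <= s -> s <= t -> p s <= p t.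
Proof. by move=> s0; rewrite le_eqVlt => /predU1P[->//|/(phi_inv_lt s0)/ltW]. Qed.

Lemma phi_inv_gt0 s : 0 < s -> 0 < p s.
Proof. by move=> s0; rewrite -{1}phi_inv0 phi_inv_lt. Qed.

Lemma phi_inv_continuous (a : R) : 0 < a -> {within `[0, a], continuous p}.
Proof.
move=> a0; apply: segment_inc_surj_continuous.
  move=> x y; rewrite !in_itv/= => /andP[x0 _] /andP[y0 _].
  apply/idP/idP; last exact: phi_inv_le.
  by apply: contraTT; rewrite -!ltNge; exact: phi_inv_lt.
move=> y; rewrite /= in_itv/= phi_inv0 => /andP[y0 ya].
exists (phi y); last exact: phiK.
by rewrite /= in_itv/= phi_ge0//= -(phi_invK (ltW a0)) phi_le.
Qed.

Let etaE t : eta t = t / p (1 / t). Proof. by []. Qed.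

Lemma eta_gt0 t : 0 < t -> 0 < eta t.
Proof. by move=> t0; rewrite etaE divr_gt0// phi_inv_gt0// divr_gt0. Qed.

(** [eta t / t = 1 / p (1 / t)] is nondecreasing because [p] is. *)
Lemma eta_ratio_le s t : 0 < s -> s <= t -> eta s <= s * (eta t / t).
Proof.
move=> s0 st; have t0 : 0 < t by exact: lt_le_trans st.
have ps : 0 < p (1 / s) by rewrite phi_inv_gt0 ?divr_gt0.
have pt : 0 < p (1 / t) by rewrite phi_inv_gt0 ?divr_gt0.
have -> : eta t / t = (p (1 / t))^-1 by rewrite etaE; field; rewrite !gt_eqF.
rewrite etaE ler_wpM2l ?(ltW s0)// lef_pV2//.
by rewrite phi_inv_le ?divr_ge0 ?(ltW t0)// ler_pM2l// lef_pV2.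
Qed.

Lemma eta_lt s t : 0 < s -> s < t -> eta s < eta t.
Proof.
move=> s0 st; have t0 : 0 < t by exact: lt_trans st.
apply: le_lt_trans (eta_ratio_le s0 (ltW st)) _.
by rewrite mulrA mulrAC gtr_pMl ?eta_gt0// ltr_pdivrMr// mul1r.
Qed.

Lemma eta_le s t : 0 < s -> s <= t -> eta s <= eta t.
Proof. by move=> s0; rewrite le_eqVlt => /predU1P[->//|/(eta_lt s0)/ltW]. Qed.

Let inP (x : R) : (x \in `]0, +oo[%classic) = (0 < x).
Proof. by rewrite mem_setE in_itv/= andbT. Qed.

Let eta_inj : {in `]0, +oo[%classic &, injective eta}.
Proof.
move=> s t; rewrite !inP => s0 t0 est.
have [st|ts|//] := ltgtP s t.
  by have := eta_lt s0 st; rewrite est ltxx.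
by have := eta_lt t0 ts; rewrite est ltxx.
Qed.

Let eta_surj : set_surj `]0, +oo[%classic `]0, +oo[%classic eta.
Proof.
move=> y /=; rewrite in_itv/= andbT => y0.
(* The equation [eta (1 / s) = y] reads [s * p s = 1 / y]. At [b] the left side is at least [1 / y],
   since [p b >= p 1] and [b >= y^-1 / p 1]; the intermediate value theorem applies on [[0, b]]. *)
pose b := Num.max 1 (y^-1 / p 1).
have b1 : 1 <= b by rewrite le_max lexx.
have b0 : 0 < b by exact: lt_le_trans b1.
have p1 : 0 < p 1 by exact: phi_inv_gt0.
have yV : 0 < y^-1 by rewrite invr_gt0.
have cont : {within `[0, b], continuous (fun s => s * p s)}.
  have cid : {within `[0, b], continuous (@idfun R)}.
    by apply: continuous_subspaceT => x; exact: cvg_id.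
  by move=> x; apply: continuousM; [exact: cid|exact: phi_inv_continuous].
have hb : y^-1 <= b * p b.
  have : y^-1 / p 1 <= b by rewrite le_max lexx orbT.
  rewrite ler_pdivrMr// => /le_trans; apply.
  by rewrite ler_wpM2l ?(ltW b0)// phi_inv_le.
have [] := IVT (ltW b0) cont (v := y^-1).
  by rewrite mul0r ge_min le_max (ltW yV) hb orbT.
move=> s; rewrite in_itv/= => /andP[s0 sb] es.
have sp : 0 < s.
  by rewrite lt_def s0 andbT; apply: contraTneq yV => s0'; rewrite -es s0' mul0r ltxx.
exists s^-1; first by rewrite /= in_itv/= invr_gt0 sp.
by rewrite etaE div1r invrK -invfM es invrK.
Qed.

Lemma eta_invK y : 0 < y -> eta (etai y) = y.
Proof. by move=> y0; apply: (surjpK _ eta_surj); rewrite inP. Qed.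

Lemma eta_inv_gt0 y : 0 < y -> 0 < etai y.
Proof.
move=> y0; have := surjpinv_image_sub (dflt := fun=> 0 : R) (t := etai y) eta_surj.
rewrite /= in_itv/= andbT; apply; exists y => //.
by rewrite /= in_itv/= y0.
Qed.

Lemma etaK t : 0 < t -> etai (eta t) = t.
Proof. by move=> t0; apply: (pinvKV (fun=> 0 : R) eta_inj); rewrite inP. Qed.

Lemma eta_inv_le s t : 0 < s -> s <= t -> etai s <= etai t.
Proof.
move=> s0 st; have t0 : 0 < t by exact: lt_le_trans st.
rewrite leNgt; apply/negP => /(eta_lt (eta_inv_gt0 t0)).
by rewrite !eta_invK// ltNge st.
Qed.

Lemma le_eta_inv s t : 0 < s -> 0 < t -> eta s <= t -> s <= etai t.
Proof. by move=> s0 t0 st; rewrite -(etaK s0) eta_inv_le// eta_gt0. Qed.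

Hypothesis p_semi : almost_semi_multiplicative p.

Lemma phi_inv_mul : exists2 c, 0 < c &
  forall s t, 0 < s -> 0 < t -> c * p (s * t) <= p s * p t.
Proof. by case: p_semi. Qed.

Lemma phi_inv_scale k : 0 < k -> exists2 C, 0 < C & forall s, 0 < s -> p (k * s) <= C * p s.
Proof.
move=> k0; have [c c0 h] := phi_inv_mul.
exists (p k / c); first by rewrite divr_gt0// phi_inv_gt0.
move=> s s0; rewrite mulrAC ler_pdivlMr// mulrC; exact: h.
Qed.

(** [p] stands in the denominator of [eta], so the inequality for [p] comes out reversed. *)
Lemma eta_mul : exists2 c, 0 < c &
  forall s t, 0 < s -> 0 < t -> c * (eta s * eta t) <= eta (s * t).
Proof.
have [c c0 h] := phi_inv_mul; exists c => // s t s0 t0.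
have ps : 0 < p (1 / s) by rewrite phi_inv_gt0// divr_gt0.
have pt : 0 < p (1 / t) by rewrite phi_inv_gt0// divr_gt0.
have pst : 0 < p (1 / (s * t)) by rewrite phi_inv_gt0// divr_gt0// mulr_gt0.
have -> : c * (eta s * eta t) = s * t * (c / (p (1 / s) * p (1 / t))).
  by rewrite !etaE; field; rewrite !gt_eqF.
rewrite etaE ler_wpM2l ?mulr_ge0 ?(ltW s0) ?(ltW t0)//.
rewrite ler_pdivrMr ?mulr_gt0// mulrC ler_pdivlMr//.
have := h (1 / s) (1 / t); rewrite !divr_gt0// => /(_ isT isT).
by rewrite (_ : 1 / s * (1 / t) = 1 / (s * t))//; field; rewrite !gt_eqF.
Qed.

Lemma eta_inv_mul : exists2 C, 0 < C &
  forall y z, 0 < y -> 0 < z -> etai (y * z) <= C * (etai y * etai z).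
Proof.
have [c c0 h] := eta_mul.
have c20 : 0 < (c * c)^-1 by rewrite invr_gt0 mulr_gt0.
(* With this constant [C], two uses of [eta_mul] give [eta (C * (etai y * etai z)) >= c * (c * c)^-1
   * (c * (y * z)) = y * z]. *)
exists (etai (c * c)^-1); first exact: eta_inv_gt0.
move=> y z y0 z0; have yz0 : 0 < y * z by rewrite mulr_gt0.
have ey := eta_inv_gt0 y0; have ez := eta_inv_gt0 z0; have eD := eta_inv_gt0 c20.
have eyz : 0 < etai y * etai z by rewrite mulr_gt0.
have h1 := h _ _ ey ez; have h2 := h _ _ eD eyz.
rewrite !eta_invK// in h1; rewrite eta_invK// in h2.
rewrite -[leRHS]etaK ?mulr_gt0//; apply: eta_inv_le => //.
apply: le_trans h2.
rewrite (_ : c * (_ * ?[e]) = ?e / c); last by field; rewrite gt_eqF.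
by rewrite ler_pdivlMr// mulrC.
Qed.

End profile.

(** * Growth of the essential supremum *)

(** [t] and [2 t] are the left ends of two consecutive dyadic cells, and [q0], [q1] the lengths of
    an interval inside them. The factor 2 comes from [1 / a <= 2 / (2 t)] in the second cell. *)
Lemma potential_slope_le (R : realFieldType) (C Sa S0 S1 a t q0 q1 : R) :
  0 <= C -> 0 <= Sa -> Sa <= C * S0 -> Sa <= C * S1 -> 0 < t -> t <= a -> 0 <= q0 -> 0 <= q1 ->
  Sa * ((q0 + q1) / a) <= 2 * C * (S0 * (q0 / t) + S1 * (q1 / (2 * t))).
Proof.
move=> C0 Sa0 h0 h1 t0 ta q00 q10; have a0 : 0 < a by exact: lt_le_trans ta.
have hV : a^-1 <= t^-1 by rewrite lef_pV2.
have S00 : 0 <= C * S0 by exact: le_trans h0.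
have e1 : Sa * (q1 / a) <= C * S1 * (q1 / t).
  by rewrite ler_pM ?divr_ge0 ?(ltW a0)// ler_wpM2l.
have e0 : Sa * (q0 / a) <= C * S0 * (q0 / t).
  by rewrite ler_pM ?divr_ge0 ?(ltW a0)// ler_wpM2l.
have e2 : 0 <= C * S0 * (q0 / t) by rewrite mulr_ge0// divr_ge0 ?(ltW t0).
have -> : S1 * (q1 / (2 * t)) = S1 * (q1 / t) / 2 by field; rewrite gt_eqF.
have -> : 2 * C * (S0 * (q0 / t) + S1 * (q1 / t) / 2) =
  2 * (C * S0 * (q0 / t)) + C * S1 * (q1 / t) by field; rewrite gt_eqF.
by rewrite mulrDl mulrDr lerD// (le_trans e0)// mulr_natl mulr2n lerDl.
Qed.

Lemma min_max_step (R : realDomainType) (a b t0 t1 t2 : R) :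
  t0 <= a -> a <= t1 -> a <= b -> b <= t2 -> t1 <= t2 -> t0 <= t1 ->
  b - a = (Num.min (Num.max b t0) t1 - Num.min (Num.max a t0) t1) +
    (Num.min (Num.max b t1) t2 - Num.min (Num.max a t1) t2).
Proof.
move=> t0a at1 ab bt2 t12 t01.
rewrite (max_l t0a) (max_l (le_trans t0a ab)) (max_r at1) (min_l at1) (min_l t12).
have [bt1|/ltW t1b] := leP b t1.
  by rewrite (min_l t12) subrr addr0.
by rewrite (min_l bt2); ring.
Qed.

(** * A potential for the first integral condition *)

Section growth.
Context {R : realType}.
Variables (phi g : R -> R).
Hypothesis phi_bij : set_bij `[0, +oo[%classic `[0, +oo[%classic phi.
Hypothesis phi_incr : forall s t, 0 <= s -> s < t -> phi s < phi t.
Hypothesis p_semi : almost_semi_multiplicative (phi_inv phi).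
Hypothesis g_semi : almost_semi_multiplicative g.
Hypothesis g_bounded : forall K : set R, compact K -> K `<=` `]0, +oo[%classic ->
  has_ubound [set g t | t in K].
Local Notation p := (phi_inv phi).
Local Notation eta := (eta_of phi).
Local Notation etai := (eta_inv phi).

(** [scale t / t] is the integrand of the first integral condition, and [area t] the argument of
    [eta^-1] in it. *)
Definition area (t : R) := t / p (g t).
Definition scale (t : R) := etai (area t).

Lemma areaE t : area t = t / p (g t).
Proof. by []. Qed.

Lemma g_gt0 t : 0 < t -> 0 < g t.
Proof. by case: g_semi => + _; apply. Qed.

Let p_gt0 := phi_inv_gt0 phi_bij phi_incr.
Let p_le := phi_inv_le phi_bij phi_incr.

Lemma area_gt0 t : 0 < t -> 0 < area t.
Proof. by move=> t0; rewrite divr_gt0// p_gt0// g_gt0. Qed.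

Lemma scale_gt0 t : 0 < t -> 0 < scale t.
Proof. by move=> t0; apply: (eta_inv_gt0 phi_bij phi_incr); exact: area_gt0. Qed.

Lemma eta_scale k : 0 < k -> exists2 C, 0 < C & forall s, 0 < s -> eta s <= C * eta (k * s).
Proof.
move=> k0; have [c c0 h] := eta_mul phi_bij phi_incr p_semi.
have ek := eta_gt0 phi_bij phi_incr k0.
exists (c * eta k)^-1 => [|s s0]; first by rewrite invr_gt0; exact: mulr_gt0.
rewrite ler_pdivlMl; last exact: mulr_gt0.
by rewrite -mulrA; exact: h.
Qed.

Lemma eta_inv_scale k : 0 < k ->
  exists2 C, 0 < C & forall y, 0 < y -> etai (k * y) <= C * etai y.
Proof.
move=> k0; have [C C0 h] := eta_inv_mul phi_bij phi_incr p_semi.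
have ek := eta_inv_gt0 phi_bij phi_incr k0.
exists (C * etai k) => [|y y0]; first by rewrite mulr_gt0.
by rewrite -mulrA; exact: h.
Qed.

(** Semi-multiplicativity gives [c g (k t) <= g k * g t], and [g k] is bounded for [k] in the
    compact interval [[k1, k2]]. *)
Lemma g_scale k1 k2 : 0 < k1 -> exists2 C, 0 < C &
  forall k t, k1 <= k -> k <= k2 -> 0 < t -> g (k * t) <= C * g t.
Proof.
move=> k10; have [_ [c c0 h]] := g_semi.
have [|D hD] := g_bounded (@segment_compact R k1 k2).
  move=> x; rewrite /= !in_itv/= andbT => /andP[+ _]; exact: lt_le_trans.
exists (Num.max D 1 / c) => [|k t kk1 kk2 t0].
  by rewrite divr_gt0// lt_max ltr01 orbT.
have k0 : 0 < k by exact: lt_le_trans kk1.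
rewrite mulrAC ler_pdivlMr// mulrC; apply: le_trans (h _ _ k0 t0) _.
apply: (ler_wpM2r (ltW (g_gt0 t0))); rewrite le_max; apply/orP; left; apply: hD.
by exists k => //=; rewrite in_itv/= kk1.
Qed.

(** An upper bound for [area (k t)] needs a lower bound for [g (k t)]; it comes from [g_scale]
    applied to [t = k^-1 * (k t)], with [k^-1] between [k2^-1] and [k1^-1]. *)
Lemma area_scale k1 k2 : 0 < k1 -> exists2 C, 0 < C &
  forall k t, k1 <= k -> k <= k2 -> 0 < t -> area (k * t) <= C * area t.
Proof.
move=> k10; have [k21|k12] := ltP k2 k1.
  by exists 1 => // k t ak kb; have := lt_le_trans (le_lt_trans kb k21) ak; rewrite ltxx.
have k20 : 0 < k2 by exact: lt_le_trans k12.
have [|C C0 h] := @g_scale k2^-1 k1^-1; first by rewrite invr_gt0.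
have [D D0 hD] := phi_inv_scale phi_bij phi_incr p_semi C0.
exists (k2 * D) => [|k t kk1 kk2 t0]; first by rewrite mulr_gt0.
have k0 : 0 < k by exact: lt_le_trans kk1.
have kt : 0 < k * t by rewrite mulr_gt0.
have pkt : 0 < p (g (k * t)) by rewrite p_gt0// g_gt0.
have pt : 0 < p (g t) by rewrite p_gt0// g_gt0.
have gg : g t <= C * g (k * t).
  by have := h k^-1 (k * t); rewrite !lef_pV2 ?posrE// mulKf ?gt_eqF//; apply.
have pp : p (g t) <= D * p (g (k * t)).
  by apply: le_trans (hD _ (g_gt0 kt)); rewrite p_le// ltW// g_gt0.
rewrite /area ler_pdivrMr//.
have -> : k2 * D * (t / p (g t)) * p (g (k * t)) =
  k2 * t * (D * p (g (k * t)) / p (g t)) by field; rewrite gt_eqF.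
rewrite -[leLHS]mulr1 ler_pM ?(ltW kt)// ?ler_wpM2r ?(ltW t0)//.
by rewrite ler_pdivlMr// mul1r.
Qed.

Lemma scale_scale k1 k2 : 0 < k1 -> exists2 C, 0 < C &
  forall k t, k1 <= k -> k <= k2 -> 0 < t -> scale (k * t) <= C * scale t.
Proof.
move=> k10; have [D D0 hD] := area_scale k2 k10.
have [C C0 hC] := eta_inv_scale D0.
exists C => // k t kk1 kk2 t0; apply: le_trans (hC _ (area_gt0 t0)).
apply: (eta_inv_le phi_bij phi_incr); last exact: hD.
by apply: area_gt0; rewrite mulr_gt0// (lt_le_trans k10).
Qed.

Lemma scale_near : exists2 C, 0 < C &
  forall s t, 0 < t -> t <= 2 * s -> s <= 2 * t -> scale s <= C * scale t.
Proof.
have k0 : 0 < 2^-1 :> R by rewrite invr_gt0.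
have [C C0 h] := scale_scale 2 k0.
exists C => // s t t0 ts st; have := h (s / t) t.
rewrite divfK ?gt_eqF//; apply => //.
  by rewrite ler_pdivlMr// ler_pdivrMl// mulrC.
by rewrite ler_pdivrMr.
Qed.

Lemma area_near : exists2 C, 0 < C &
  forall s t, 0 < t -> t <= 2 * s -> s <= 2 * t -> area s <= C * area t.
Proof.
have k0 : 0 < 2^-1 :> R by rewrite invr_gt0.
have [C C0 h] := area_scale 2 k0.
exists C => // s t t0 ts st; have := h (s / t) t.
rewrite divfK ?gt_eqF//; apply => //.
  by rewrite ler_pdivlMr// ler_pdivrMl// mulrC.
by rewrite ler_pdivrMr.
Qed.

Section potential.
Variable (m0 Stot : R).
Hypothesis m0_gt0 : 0 < m0.
Local Notation tk k := (m0 * 2 ^+ k).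
Hypothesis scale_sum : forall N, \sum_(0 <= k < N) scale (tk k) <= Stot.

Let tk_gt0 k : 0 < tk k. Proof. by rewrite mulr_gt0// exprn_gt0. Qed.
Let tkS k : tk k.+1 = 2 * tk k. Proof. by rewrite exprS; ring. Qed.

(** The position of [t] relative to the cell [[tk k, tk k.+1]]: [clamp k t / tk k - 1] runs from 0
    to 1 across it, so the cell adds at most [scale (tk k)] to the potential. *)
Let clamp k (t : R) := Num.min (Num.max t (tk k)) (tk k.+1).

Let tk_leS k : tk k <= tk k.+1.
Proof. by rewrite tkS ler_peMl ?(ltW (tk_gt0 k))// ler1n. Qed.

Let clamp_ge k t : tk k <= clamp k t.
Proof. by rewrite le_min le_max lexx orbT/= tk_leS. Qed.

Let clamp_le k t : clamp k t <= 2 * tk k.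
Proof. by rewrite -tkS ge_min lexx orbT. Qed.

Let clamp_mono k s t : s <= t -> clamp k s <= clamp k t.
Proof. by move=> st; rewrite le_min2// le_max2. Qed.

Let clamp_low k t : t <= tk k -> clamp k t = tk k.
Proof. by move=> h; rewrite /clamp max_r// min_l. Qed.

Let Ppart N t := \sum_(0 <= k < N) scale (tk k) * (clamp k t / tk k - 1).

Let term_ge0 k t : 0 <= scale (tk k) * (clamp k t / tk k - 1).
Proof.
by rewrite mulr_ge0 ?(ltW (scale_gt0 _))// subr_ge0 ler_pdivlMr// mul1r.
Qed.

Let Ppart_ge0 N t : 0 <= Ppart N t.
Proof. by apply: sumr_ge0 => k _; exact: term_ge0. Qed.

Let Ppart_le N t : Ppart N t <= Stot.
Proof.
apply: le_trans (scale_sum N); apply: ler_sum => k _.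
rewrite ler_piMr ?(ltW (scale_gt0 _))// lerBlDr ler_pdivrMr//.
Qed.

Let Ppart_mono N s t : s <= t -> Ppart N s <= Ppart N t.
Proof.
move=> st; apply: ler_sum => k _; rewrite ler_wpM2l ?(ltW (scale_gt0 _))//.
by rewrite lerD2r ler_pM2r ?invr_gt0//; exact: clamp_mono.
Qed.

(** From this index on the cells lie above [t] and contribute 0, so the sum over all cells can stop
    here. *)
Let idx t := Num.bound (t / m0).

Let idxP t k : (idx t <= k)%N -> t <= tk k.
Proof.
by move=> /upper_nthrootP/ltW; rewrite ler_pdivrMr// mulrC.
Qed.

Let Ppart_stable N t : (idx t <= N)%N -> Ppart N t = Ppart (idx t) t.
Proof.
move=> iN; rewrite /Ppart (big_cat_nat _ iN)//= [X in _ + X]big1_seq ?addr0// => k.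
rewrite mem_index_iota => /andP[_ /andP[ik _]].
by rewrite clamp_low ?idxP// divff ?gt_eqF// subrr mulr0.
Qed.

Lemma dyadic_index a : m0 <= a -> exists k, tk k <= a < tk k.+1.
Proof.
move=> m0a; have h : exists k, a < tk k.
  exists (idx a); have /upper_nthrootP := leqnn (idx a).
  by rewrite ltr_pdivrMr// mulrC.
case: (ex_minnP h) => -[|k] ak kmin.
  by move: ak; rewrite expr0 mulr1 ltNge m0a.
by exists k; rewrite ak andbT leNgt; apply/negP => /kmin; rewrite ltnn.
Qed.

(** [P] is piecewise linear, with slope [scale t / t] on [[t, 2 t]] for
    [t = m0 2^k]; it replaces the primitive of [scale t / t], which need not be
    measurable. *)
Lemma potential_exists : exists P : R -> R, exists2 C, 0 < C &
  [/\ forall t, 0 <= P t <= Stot, forall s t, s <= t -> P s <= P t &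
      forall a b, m0 <= a -> a <= b -> b <= 2 * a ->
        scale a * ((b - a) / a) <= C * (P b - P a)].
Proof.
have [C C0 hC] := scale_near.
exists (fun t => Ppart (idx t) t); exists (2 * C); first by rewrite mulr_gt0.
split=> [t|s t st|a b m0a ab b2a].
- by rewrite Ppart_ge0 Ppart_le.
- rewrite -(Ppart_stable (leq_maxl (idx s) (idx t))).
  by rewrite -(Ppart_stable (leq_maxr (idx s) (idx t))) Ppart_mono.
have [k /andP[ka ak]] := dyadic_index m0a.
(* Since [b <= 2 a < tk k.+2], the interval [[a, b]] meets only the cells [k] and [k.+1]; [N] covers
   both and is past the indices of [a] and [b]. *)
pose N := maxn k.+2 (maxn (idx a) (idx b)).
rewrite -(@Ppart_stable N a) ?leq_max ?leqnn ?orbT//.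
rewrite -(@Ppart_stable N b) ?leq_max ?leqnn ?orbT//.
have kN : (k.+2 <= N)%N by rewrite leq_max leqnn.
have a0 : 0 < a by exact: lt_le_trans m0a.
pose D j := scale (tk j) * (clamp j b / tk j - 1) - scale (tk j) * (clamp j a / tk j - 1).
have DE j : D j = scale (tk j) * ((clamp j b - clamp j a) / tk j).
  by rewrite /D; ring.
have D0 j : 0 <= D j.
  rewrite DE mulr_ge0 ?(ltW (scale_gt0 _))// divr_ge0 ?(ltW (tk_gt0 _))//.
  by rewrite subr_ge0 clamp_mono.
have -> : Ppart N b - Ppart N a = \sum_(0 <= j < N) D j by rewrite sumrB.
have : D k + D k.+1 <= \sum_(0 <= j < N) D j.
  rewrite (@big_cat_nat _ _ _ _ _ _ _ _ (leq0n k))/=; last by apply: leq_trans kN; rewrite -addn2 leq_addr.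
  have kN' : (k < N)%N by apply: leq_trans kN.
  rewrite (big_ltn kN') (big_ltn kN) addrCA lerD2l addrCA lerDl.
  by rewrite addr_ge0// sumr_ge0.
move=> /(ler_wpM2l (ltW C0)) hD.
have h2 : 2 * C * (D k + D k.+1) <= 2 * C * \sum_(0 <= j < N) D j.
  by rewrite -!mulrA ler_wpM2l.
have DE1 : D k.+1 = scale (tk k.+1) * ((clamp k.+1 b - clamp k.+1 a) / (2 * tk k)).
  by rewrite DE -tkS.
apply: le_trans h2; rewrite DE DE1.
rewrite (@min_max_step _ a b (tk k) (tk k.+1) (tk k.+2)) ?(ltW ak)//; last first.
  by apply: le_trans b2a _; rewrite (tkS k.+1) ler_wpM2l// ltW.
apply: potential_slope_le => //.
- exact: ltW.
- by rewrite ltW// scale_gt0.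
- by apply: hC => //; [apply: le_trans ka _; rewrite ler_peMl ?ler1n// ltW|rewrite -tkS ltW].
- apply: hC => //; first by rewrite tkS; apply: ler_wpM2l.
  apply: (le_trans (ltW ak)); apply: ler_peMl; [exact: ltW|exact: ler1n].
- by rewrite subr_ge0 clamp_mono.
- by rewrite subr_ge0 clamp_mono.
Qed.

End potential.

(** Semi-multiplicativity is applied three times to [G = (kap h F G) (1 / h) (1 / F) (1 / kap)], and
    [h / p (1 / h)] is [eta h]. *)
Lemma step_eta kap : 0 < kap -> exists2 c, 0 < c & forall h F G, 0 < h -> 0 < F -> 0 < G ->
  c * (eta h * p G / p (1 / F)) <= h / 4 * p (kap * h * F * G).
Proof.
move=> k0; have [c c0 hc] := phi_inv_mul p_semi.
have pk : 0 < p (1 / kap) by apply: p_gt0; rewrite divr_gt0.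
exists (c * c * c / (4 * p (1 / kap))) => [|h F G h0 F0 G0].
  by rewrite divr_gt0// !mulr_gt0.
have x0 : 0 < kap * h * F * G by rewrite !mulr_gt0.
have hV : 0 < 1 / h by rewrite divr_gt0.
have FV : 0 < 1 / F by rewrite divr_gt0.
have kV : 0 < 1 / kap by rewrite divr_gt0.
have px := p_gt0 x0; have ph := p_gt0 hV; have pF := p_gt0 FV; have pG := p_gt0 G0.
have q1 : c * c * c * p G <= p (kap * h * F * G) * p (1 / h) * p (1 / F) * p (1 / kap).
  have -> : p G = p (kap * h * F * G * (1 / h) * (1 / F) * (1 / kap)).
    by congr p; field; rewrite !gt_eqF.
  set x := kap * h * F * G in x0 px *.
  have xh : 0 < x * (1 / h) by exact: mulr_gt0.
  have xF : 0 < x * (1 / h) * (1 / F) by exact: mulr_gt0.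
  have e1 := hc _ _ x0 hV; have e2 := hc _ _ xh FV; have e3 := hc _ _ xF kV.
  have e1' : c * p (x * (1 / h)) * p (1 / F) <= p x * p (1 / h) * p (1 / F).
    by apply: ler_wpM2r => //; exact: ltW.
  have e2' : c * (c * p (x * (1 / h) * (1 / F))) <= c * (p (x * (1 / h)) * p (1 / F)).
    by apply: ler_wpM2l => //; exact: ltW.
  have e3' : c * c * (c * p (x * (1 / h) * (1 / F) * (1 / kap))) <=
      c * c * (p (x * (1 / h) * (1 / F)) * p (1 / kap)).
    by apply: ler_wpM2l => //; rewrite ltW// mulr_gt0.
  have e4 : c * c * p (x * (1 / h) * (1 / F)) <= p x * p (1 / h) * p (1 / F).
    by apply: le_trans e1'; rewrite -(mulrA c c) -(mulrA c (p _)).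
  rewrite -[leLHS]mulrA; apply: le_trans e3' _; rewrite mulrA.
  by apply: ler_wpM2r => //; exact: ltW.
have -> : c * c * c / (4 * p (1 / kap)) * (eta h * p G / p (1 / F)) =
   h / 4 * (c * c * c * p G / (p (1 / h) * p (1 / F) * p (1 / kap))).
  by rewrite /eta_of; field; rewrite !gt_eqF.
rewrite ler_wpM2l ?divr_ge0 ?(ltW h0)//.
by rewrite ler_pdivrMr ?mulr_gt0// !mulrA.
Qed.

Lemma scale_bounded m0 Stot : 0 < m0 ->
  (forall N, \sum_(0 <= k < N) scale (m0 * 2 ^+ k) <= Stot) ->
  exists2 C, 0 < C & forall t, m0 <= t -> scale t <= C.
Proof.
move=> m00 hS; have [C C0 hC] := scale_near.
have tk0 k : 0 < m0 * 2 ^+ k by rewrite mulr_gt0// exprn_gt0.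
have ler k : scale (m0 * 2 ^+ k) <= Stot.
  apply: le_trans (hS k.+1); rewrite big_nat_recr//= lerDr sumr_ge0// => j _.
  exact/ltW/scale_gt0.
exists (C * Stot) => [|t mt].
  by apply: mulr_gt0 => //; apply: lt_le_trans (ler 0); exact: scale_gt0.
have [k /andP[kt tk]] := dyadic_index m00 mt.
apply: le_trans (_ : C * scale (m0 * 2 ^+ k) <= _); last by rewrite ler_wpM2l// ltW.
apply: hC => //.
  by apply: le_trans kt _; rewrite ler_peMl ?ler1n// (le_trans _ mt)// ltW.
by apply: le_trans (ltW tk) _; rewrite exprS mulrCA.
Qed.

End growth.

Lemma exists_between (R : realFieldType) (r s T U : R) :
  T + U < s - r -> exists2 x, r + T < x & x < s - U.
Proof. by move=> h; exists ((r + T + (s - U)) / 2); lra. Qed.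

(** * Growth across one annulus *)

Section growth_bound.
Context {R : realType}.
Variables (phi g : R -> R).
Hypothesis phi_bij : set_bij `[0, +oo[%classic `[0, +oo[%classic phi.
Hypothesis phi_incr : forall s t, 0 <= s -> s < t -> phi s < phi t.
Hypothesis p_semi : almost_semi_multiplicative (phi_inv phi).
Hypothesis g_semi : almost_semi_multiplicative g.
Hypothesis g_bounded : forall K : set R, compact K -> K `<=` `]0, +oo[%classic ->
  has_ubound [set g t | t in K].
Local Notation p := (phi_inv phi).
Local Notation eta := (eta_of phi).
Local Notation etai := (eta_inv phi).
Local Notation area := (area phi g).
Local Notation scale := (scale phi g).
Local Notation area_gt0 := (area_gt0 phi_bij phi_incr g_semi).
Local Notation scale_gt0 := (scale_gt0 phi_bij phi_incr g_semi).
Local Notation eta_gt0 := (eta_gt0 phi_bij phi_incr).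
Local Notation etai_gt0 := (eta_inv_gt0 phi_bij phi_incr).
Local Notation p_gt0 := (phi_inv_gt0 phi_bij phi_incr).

Variables (kap lam m0 Stot : R) (P : R -> R) (Cp : R).
Hypothesis kap0 : 0 < kap.
Hypothesis lam1 : 1 < lam.
Hypothesis m00 : 0 < m0.
Hypothesis scale_sum : forall N, \sum_(0 <= k < N) scale (m0 * 2 ^+ k) <= Stot.
Hypothesis Cp0 : 0 < Cp.
Hypothesis P_mono : forall s t, s <= t -> P s <= P t.
Hypothesis P_bnd : forall t, 0 <= P t <= Stot.
Hypothesis P_scale : forall a b, m0 <= a -> a <= b -> b <= 2 * a ->
  scale a * ((b - a) / a) <= Cp * (P b - P a).

Section annulus.
Variables (M : R -> R) (r F : R).
Hypothesis r0 : 0 < r.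
Hypothesis F0 : 0 < F.
Hypothesis M_mono : forall a b, r <= a -> a <= b -> b <= lam * r -> M a <= M b.
Hypothesis Mr : m0 <= M r.
Hypothesis M_step : forall a b, r <= a -> a < b -> b <= lam * r -> M b <= 2 * M a ->
  (b - a) / 4 * p (kap * (b - a) * F * g (M a)) <= M b - M a.
Local Notation B := (p (1 / F)).
Local Notation X := (eta (r / etai B)).

Let B0 : 0 < B. Proof. by rewrite p_gt0 ?divr_gt0. Qed.
Let E0 : 0 < etai B. Proof. exact: etai_gt0. Qed.
Let r_lamr : r < lam * r. Proof. by rewrite ltr_pMl. Qed.
Let h0 : 0 < (lam - 1) * r. Proof. by rewrite mulr_gt0 ?subr_gt0. Qed.

Let M_gt0 a : r <= a -> a <= lam * r -> 0 < M a.
Proof.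
by move=> ra al; rewrite (lt_le_trans m00)// (le_trans Mr)// M_mono.
Qed.

(** [M] at most doubles, so a single step from [r] to [lam r] is admissible. It bounds [X] by a
    multiple of [area (M r) * (M (lam r) - M r) / M r], and [area <= C4 scale] passes to the
    potential. *)
Lemma growth_slow c1 c2 C3 C4 : 0 < c1 -> 0 < c2 -> 0 < C3 -> 0 < C4 ->
  (forall h F G, 0 < h -> 0 < F -> 0 < G ->
    c1 * (eta h * p G / p (1 / F)) <= h / 4 * p (kap * h * F * G)) ->
  (forall s t, 0 < s -> 0 < t -> c2 * (eta s * eta t) <= eta (s * t)) ->
  (forall s, 0 < s -> eta s <= C3 * eta ((lam - 1) * s)) ->
  (forall t, m0 <= t -> area t <= C4 * scale t) ->
  M (lam * r) <= 2 * M r -> X <= C3 / (c1 * c2) * C4 * Cp * (P (M (lam * r)) - P (M r)).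
Proof.
move=> c10 c20 C30 C40 hc1 hc2 hC3 hC4 M2.
have Mr0 : 0 < M r by apply: M_gt0 => //; exact: ltW.
have G0 : 0 < g (M r) by exact: (g_gt0 g_semi).
have pG := p_gt0 G0.
have rM : M r <= M (lam * r) by apply: M_mono => //; exact: ltW.
have st := M_step (lexx r) r_lamr (lexx _) M2.
have hE : lam * r - r = (lam - 1) * r by ring.
rewrite hE in st.
have st1 := le_trans (hc1 _ _ _ h0 F0 G0) st.
have e1 : c2 * (X * B) <= eta r.
  have := hc2 (r / etai B) (etai B); rewrite divfK ?gt_eqF//.
  by rewrite eta_invK//; apply => //; rewrite divr_gt0.
have e2 := le_trans e1 (hC3 _ r0).
have hX : X <= C3 / (c1 * c2) * (area (M r) * ((M (lam * r) - M r) / M r)).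
  have -> : C3 / (c1 * c2) * (area (M r) * ((M (lam * r) - M r) / M r)) =
     C3 / c2 / B * ((M (lam * r) - M r) / (c1 * (p (g (M r)) / B))).
    by rewrite areaE; field; rewrite !gt_eqF.
  have e3 : eta ((lam - 1) * r) <= (M (lam * r) - M r) / (c1 * (p (g (M r)) / B)).
    rewrite ler_pdivlMr; last by rewrite mulr_gt0// divr_gt0.
    by rewrite mulrCA [eta _ * _]mulrA.
  have e4 : X <= C3 / c2 / B * eta ((lam - 1) * r).
    rewrite -(ler_pM2r (mulr_gt0 c20 B0)).
    have -> : C3 / c2 / B * eta ((lam - 1) * r) * (c2 * B) = C3 * eta ((lam - 1) * r).
      by field; rewrite !gt_eqF.
    by rewrite mulrCA.
  apply: le_trans e4 _; apply: ler_wpM2l e3.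
  by rewrite !divr_ge0 ?ltW.
apply: le_trans hX _; rewrite -!(mulrA (C3 / (c1 * c2))).
apply: ler_wpM2l; first by rewrite divr_ge0 ?mulr_ge0 ?ltW.
rewrite -(mulrA C4); apply: le_trans (ler_wpM2l (ltW C40) (P_scale Mr rM M2)); rewrite [leRHS]mulrA.
by apply: ler_wpM2r; [rewrite divr_ge0 ?subr_ge0 ?(ltW Mr0)|exact: hC4].
Qed.

(** Between the levels [m] and [2 m] the increment of [M] is at most [m], so the step bounds
    [eta (b - a)] by a multiple of [area m * B]; applying [eta^-1], submultiplicative up to a
    constant, bounds the length. *)
Lemma growth_level c1 C4 C5 C6 : 0 < c1 -> 0 < C4 -> 0 < C5 -> 0 < C6 ->
  (forall h F G, 0 < h -> 0 < F -> 0 < G ->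
    c1 * (eta h * p G / p (1 / F)) <= h / 4 * p (kap * h * F * G)) ->
  (forall s t, 0 < t -> t <= 2 * s -> s <= 2 * t -> area s <= C4 * area t) ->
  (forall y, 0 < y -> etai (C4 / c1 * y) <= C5 * etai y) ->
  (forall y z, 0 < y -> 0 < z -> etai (y * z) <= C6 * (etai y * etai z)) ->
  forall m a b, 0 < m -> r <= a -> a < b -> b <= lam * r -> m <= M a -> M b <= 2 * m ->
  b - a <= C5 * C6 * (scale m * etai B).
Proof.
move=> c10 C40 C50 C60 hc1 hC4 hC5 hC6 m a b m_gt0 ra ab bl ma bm.
have al : a <= lam * r by exact: le_trans (ltW ab) bl.
have Ma0 := M_gt0 ra al.
have G0 : 0 < g (M a) by exact: (g_gt0 g_semi).
have pG := p_gt0 G0.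
have h1 : 0 < b - a by rewrite subr_gt0.
have Mb2 : M b <= 2 * M a by apply: le_trans bm _; rewrite ler_pM2l.
have st := le_trans (hc1 _ _ _ h1 F0 G0) (M_step ra ab bl Mb2).
have dM : M b - M a <= m.
  by rewrite lerBlDr (le_trans bm)// mulrDl !mul1r lerD2l.
have Mab : M a <= M b by apply: M_mono => //; exact: ltW.
have e1 : eta (b - a) <= C4 / c1 * (area m * B).
  have e2 : eta (b - a) <= m / (c1 * (p (g (M a)) / B)).
    rewrite ler_pdivlMr; last by rewrite mulr_gt0// divr_gt0.
    by rewrite mulrCA [eta _ * _]mulrA; exact: le_trans dM.
  apply: le_trans e2 _.
  have -> : C4 / c1 * (area m * B) = C4 * area m * (B / c1) by ring.
  have e3 : m / (c1 * (p (g (M a)) / B)) <= area (M a) * (B / c1).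
    have -> : m / (c1 * (p (g (M a)) / B)) = m / M a * (area (M a) * (B / c1)).
      by rewrite areaE; field; rewrite !gt_eqF.
    apply: ler_piMl; last by rewrite ler_pdivrMr// mul1r.
    by apply: mulr_ge0; [exact/ltW/area_gt0|rewrite divr_ge0 ?ltW].
  apply: le_trans e3 _; apply: ler_wpM2r; first by rewrite divr_ge0 ?ltW.
  apply: hC4 => //; last exact: le_trans Mab bm.
  by apply: le_trans ma _; rewrite ler_peMl ?ler1n// ltW.
have mB : 0 < area m * B by apply: mulr_gt0 => //; exact: area_gt0.
have := le_eta_inv phi_bij phi_incr h1 _ e1.
rewrite (mulr_gt0 (divr_gt0 C40 c10) mB) => /(_ isT) /le_trans; apply.
apply: le_trans (hC5 _ mB) _; rewrite -mulrA ler_wpM2l ?(ltW C50)//.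
by apply: hC6 => //; exact: area_gt0.
Qed.

(** [M] needs at most the length [D * scale m * etai B] to grow from [m] to
    [2 m]; these lengths add up over the doublings. *)
Lemma growth_fast D : 0 < D ->
  (forall m a b, 0 < m -> r <= a -> a < b -> b <= lam * r -> m <= M a -> M b <= 2 * m ->
    b - a <= D * (scale m * etai B)) ->
  forall l s, r <= s -> s <= lam * r -> M s <= M r * 2 ^+ l ->
    s - r <= D * etai B * \sum_(0 <= j < l) scale (M r * 2 ^+ j).
Proof.
move=> D0 hD.
have Mr0 : 0 < M r by apply: M_gt0 => //; exact: ltW.
have m_gt0 j : 0 < M r * 2 ^+ j by rewrite mulr_gt0// exprn_gt0.
elim=> [|l IH] s rs sl Ms.
  (* With no doubling allowed [s = r], since a growth step over [[r, s]] would increase [M]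
     strictly. *)
  rewrite big_geq// mulr0 subr_le0 leNgt; apply/negP => rs'.
  rewrite expr0 mulr1 in Ms.
  have M2 : M s <= 2 * M r by apply: le_trans Ms _; rewrite ler_peMl ?ler1n// ltW.
  have := M_step (lexx r) rs' sl M2; rewrite leNgt => /negP; apply.
  apply: (@le_lt_trans _ _ 0); first by rewrite subr_le0.
  have sr : 0 < s - r by rewrite subr_gt0.
  rewrite mulr_gt0 ?divr_gt0// p_gt0// !mulr_gt0//; exact: (g_gt0 g_semi).
rewrite big_nat_recr//= mulrDr leNgt; apply/negP => hs.
set T := D * etai B * _ in IH hs; set U := D * etai B * scale (M r * 2 ^+ l) in hs.
have T0 : 0 <= T.
  apply: mulr_ge0; first by apply: mulr_ge0; exact: ltW.
  by apply: sumr_ge0 => j _; exact/ltW/scale_gt0.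
have U0 : 0 < U by apply: mulr_gt0; [exact: mulr_gt0|exact: scale_gt0].
(* If the bound failed, some [x] would have [x - r > T] and [s - x > U]. Then [M x <= M r * 2 ^+ l]
   contradicts the induction hypothesis, and the opposite inequality contradicts the bound for one
   doubling. *)
have [x x1 x2] := exists_between hs.
have rx : r <= x by rewrite ltW// (le_lt_trans _ x1)// lerDl.
have xs : x < s by rewrite (lt_trans x2)// gtrBl.
have [Mx|Mx] := leP (M x) (M r * 2 ^+ l).
  have := IH x rx (le_trans (ltW xs) sl) Mx.
  by rewrite lerBlDr addrC -/T leNgt x1.
have := hD _ _ _ (m_gt0 l) rx xs sl (ltW Mx).
rewrite exprS mulrCA in Ms => /(_ Ms).
rewrite (mulrC (scale _)) mulrA -/U => hU.
have Us : U < s - x by rewrite ltrBrDr -ltrBrDl.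
by have := le_lt_trans hU Us; rewrite ltxx.
Qed.

End annulus.

Lemma growth_bound : exists2 C, 0 < C & forall (M : R -> R) (r F : R), 0 < r -> 0 < F ->
  (forall a b, r <= a -> a <= b -> b <= lam * r -> M a <= M b) -> m0 <= M r ->
  (forall a b, r <= a -> a < b -> b <= lam * r -> M b <= 2 * M a ->
    (b - a) / 4 * p (kap * (b - a) * F * g (M a)) <= M b - M a) ->
  eta (r / etai (p (1 / F))) <= C * (P (M (lam * r)) - P (M r)).
Proof.
have l0 : 0 < lam - 1 by rewrite subr_gt0.
have [c1 c10 hc1] := step_eta phi_bij phi_incr p_semi kap0.
have [c2 c20 hc2] := eta_mul phi_bij phi_incr p_semi.
have [C3 C30 hC3] := eta_scale phi_bij phi_incr p_semi l0.
have [Cs Cs0 hCs] := scale_near phi_bij phi_incr p_semi g_semi g_bounded.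
have [Ca Ca0 hCa] := area_near phi_bij phi_incr p_semi g_semi g_bounded.
have [Sm Sm0 hSm] := scale_bounded phi_bij phi_incr p_semi g_semi g_bounded m00 scale_sum.
have [C5 C50 hC5] := eta_inv_scale phi_bij phi_incr p_semi (divr_gt0 Ca0 c10).
have [C6 C60 hC6] := eta_inv_mul phi_bij phi_incr p_semi.
(* [scale t] is bounded for [t >= m0] and [eta s / s] is nondecreasing, so [area t = eta (scale t)]
   is at most a multiple of [scale t]. *)
have hA t : m0 <= t -> area t <= eta Sm / Sm * scale t.
  move=> mt; have t0 : 0 < t by exact: lt_le_trans mt.
  have := eta_ratio_le phi_bij phi_incr (scale_gt0 t0) (hSm _ mt).
  by rewrite (eta_invK phi_bij phi_incr (area_gt0 t0)) mulrC.
have St0 : 0 < Stot.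
  by apply: lt_le_trans (scale_sum 1); rewrite big_nat1 expr0 mulr1 scale_gt0.
pose D := C5 * C6.
have D0 : 0 < D by exact: mulr_gt0.
pose K := D * (1 + Cs) * Cp / (lam - 1).
have K0 : 0 < K by rewrite divr_gt0// !mulr_gt0// addr_gt0.
pose Cslow := C3 / (c1 * c2) * (eta Sm / Sm) * Cp.
(* In the fast case [r / etai (p (1 / F)) <= K Q] with [Q <= Stot]; as [eta s / s] is nondecreasing
   up to [K Stot], the resulting bound is linear in [Q]. *)
pose Cfast := K * (eta (K * Stot) / (K * Stot)).
have eSm : 0 < eta Sm / Sm by apply: divr_gt0 => //; exact: eta_gt0.
have Cslow0 : 0 < Cslow.
  apply: mulr_gt0 => //; apply: mulr_gt0 => //; apply: divr_gt0 => //; exact: mulr_gt0.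
have KS0 : 0 < K * Stot by exact: mulr_gt0.
have Cfast0 : 0 < Cfast.
  by apply: mulr_gt0 => //; apply: divr_gt0 => //; exact: eta_gt0.
exists (Cslow + Cfast) => [|M r F r_gt0 F_gt0 M_mono Mr M_step]; first exact: addr_gt0.
have rl : r <= lam * r by rewrite ler_peMl// ltW.
have Q0 : 0 <= P (M (lam * r)) - P (M r) by rewrite subr_ge0 P_mono// M_mono.
have [M2|M2] := leP (M (lam * r)) (2 * M r).
  apply: le_trans (_ : Cslow * (P (M (lam * r)) - P (M r)) <= _).
    by apply: (growth_slow _ _ M_mono Mr M_step).
  by rewrite ler_wpM2r// lerDl ltW.
have lev := growth_level F_gt0 M_mono Mr M_step c10 Ca0 C50 C60 hc1 hCa hC5 hC6.
have fast := growth_fast r_gt0 F_gt0 M_mono Mr M_step D0 lev.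
have Mr0 : 0 < M r by exact: lt_le_trans Mr.
have E0 : 0 < etai (p (1 / F)) by apply: etai_gt0; apply: p_gt0; exact: divr_gt0.
pose m j := M r * 2 ^+ j.
have m_gt0 j : 0 < m j by rewrite mulr_gt0// exprn_gt0.
have mS j : m j.+1 = 2 * m j by rewrite /m exprS mulrCA.
have hex : exists l, M (lam * r) <= m l.
  exists (Num.bound (M (lam * r) / M r)).
  by rewrite /m -ler_pdivrMl// mulrC ltW// upper_nthrootP.
(* The least number of doublings that reaches [M (lam * r)]; it is at least two because [M] more
   than doubles. *)
case: (ex_minnP hex) => -[|[|l]] Ml lmin.
- by move: M2; rewrite ltNge (le_trans Ml)// /m expr0 mulr1 ler_peMl ?ler1n// ltW.
- by move: M2; rewrite ltNge (le_trans Ml)// /m expr1 mulrC.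
have lM : m l.+1 <= M (lam * r).
  by rewrite leNgt; apply/negP => /ltW /lmin; rewrite ltnn.
pose Q := P (M (lam * r)) - P (M r); rewrite -/Q in Q0 *.
have sumQ : \sum_(0 <= j < l.+1) scale (m j) <= Cp * Q.
  have h j : scale (m j) <= Cp * (P (m j.+1) - P (m j)).
    have m0j : m0 <= m j by rewrite (le_trans Mr)// ler_peMr ?(ltW Mr0)// exprn_ege1// ler1n.
    have mj : m j <= m j.+1 by rewrite mS ler_peMl ?ler1n// ltW.
    have := P_scale m0j mj; rewrite mS => /(_ (lexx _)).
    by rewrite (_ : (2 * m j - m j) / m j = 1) ?mulr1//; field; rewrite gt_eqF.
  apply: le_trans (ler_sum _ (fun j _ => h j)) _.
  rewrite -mulr_sumr (@telescope_sumr _ 0 l.+1 (fun j => P (m j)))//.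
  rewrite ler_wpM2l ?(ltW Cp0)// lerB ?P_mono// /m expr0 mulr1//.
(* The last doubling may be incomplete, so its term is compared with the preceding one instead of
   with the potential. *)
have sum2 : \sum_(0 <= j < l.+2) scale (m j) <= (1 + Cs) * (Cp * Q).
  rewrite mulrDl mul1r big_nat_recr//=; apply: lerD => //.
  have : scale (m l.+1) <= Cs * scale (m l).
    apply: hCs => //; last by rewrite mS.
    have ml : m l <= m l.+1 by rewrite mS ler_peMl ?ler1n// ltW.
    by apply: le_trans ml _; rewrite ler_peMl ?ler1n// ltW.
  move=> /le_trans; apply; rewrite ler_wpM2l ?(ltW Cs0)//.
  apply: le_trans sumQ; rewrite big_nat_recr//= lerDr sumr_ge0// => j _.
  by rewrite ltW// scale_gt0.
have hrE : r / etai (p (1 / F)) <= K * Q.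
  have := fast l.+2 _ rl (lexx _) Ml.
  have -> : lam * r - r = (lam - 1) * r by ring.
  move=> h; rewrite ler_pdivrMr//.
  have : (lam - 1) * r <= D * etai (p (1 / F)) * ((1 + Cs) * (Cp * Q)).
    apply: le_trans h _; rewrite ler_wpM2l// ltW// mulr_gt0//.
  rewrite -ler_pdivlMl// => /le_trans; apply; rewrite le_eqVlt; apply/orP; left; apply/eqP.
  by rewrite /K; ring.
have rE0 : 0 < r / etai (p (1 / F)) by exact: divr_gt0.
have KQ0 : 0 < K * Q by exact: lt_le_trans hrE.
apply: (@le_trans _ _ (Cfast * Q)); last by rewrite ler_wpM2r// lerDr ltW.
apply: le_trans (eta_le phi_bij phi_incr rE0 hrE) _.
have KQS : K * Q <= K * Stot.
  rewrite ler_wpM2l ?(ltW K0)// /Q.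
  have /andP[_ a1] := P_bnd (M (lam * r)); have /andP[a2 _] := P_bnd (M r).
  by rewrite (le_trans _ a1)// gerBl.
apply: le_trans (eta_ratio_le phi_bij phi_incr KQ0 KQS) _.
by rewrite /Cfast mulrAC.
Qed.

End growth_bound.

Section nonmeasurable.
Local Open Scope ereal_scope.
Context d (T : measurableType d) (R : realType) (m : {measure set T -> \bar R}).
Implicit Types (D : set T) (h : T -> \bar R).

(** The integral of a non-negative function is the supremum over the simple
    functions below it, so no measurability is needed here. *)
Lemma ge0_le_integral_nomeas D h1 h2 : (forall x, D x -> 0 <= h1 x) ->
  (forall x, D x -> h1 x <= h2 x) -> \int[m]_(x in D) h1 x <= \int[m]_(x in D) h2 x.
Proof.
move=> h10 h12.
have h20 x : D x -> 0 <= h2 x by move=> Dx; exact: le_trans (h10 _ Dx) (h12 _ Dx).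
rewrite !ge0_integralE//; apply: le_ereal_sup => _ [k hk <-]; exists k => // x.
apply: le_trans (hk x) _; rewrite /patch; case: ifPn => //; rewrite inE; exact: h12.
Qed.

Variables (A : nat -> set T) (c : nat -> \bar R).
Hypothesis mA : forall k, measurable (A k).
Hypothesis c0 : forall k, 0 <= c k.

Let integral_term k : \int[m]_x (c k * (\1_(A k) x)%:E) = c k * m (A k).
Proof.
rewrite ge0_integralZl//; last exact/measurable_EFinP/measurable_indic.
by rewrite integral_indic// setIT.
Qed.

Let term_ge0 k x : 0 <= c k * (\1_(A k) x)%:E.
Proof. by rewrite mule_ge0// lee_fin. Qed.

Lemma integral_step_ge D h N : (forall x, D x -> 0 <= h x) ->
  trivIset setT A -> (forall k, A k `<=` D) -> (forall k x, A k x -> c k <= h x) ->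
  \sum_(0 <= k < N) c k * m (A k) <= \int[m]_(x in D) h x.
Proof.
move=> h0 tA AD ch; rewrite (integral_mkcond D).
under eq_bigr do rewrite -integral_term.
rewrite -ge0_integral_sum//; last first.
  by move=> k; apply: measurable_funeM; exact/measurable_EFinP/measurable_indic.
apply: ge0_le_integral_nomeas => x _; first exact: sume_ge0.
have [[k [kN Akx]]|noA] := pselect (exists k, (k < N)%N /\ A k x).
  have hk : k \in index_iota 0 N by rewrite mem_index_iota.
  rewrite (bigD1_seq k)//= ?iota_uniq// big1 ?adde0; last first.
    move=> j jk; rewrite indicE memNset ?mule0// => Ajx.
    by move/eqP: jk; apply; apply: tA => //; exists x.
  rewrite indicE mem_set// mule1 patchE mem_set; last exact: (AD k).
  exact: ch.
rewrite big1_seq; first by rewrite patchE; case: ifPn => // /[!inE] /h0.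
move=> k /andP[_]; rewrite mem_index_iota => /andP[_ kN].
by rewrite indicE memNset ?mule0// => Akx; apply: noA; exists k.
Qed.

(** The sets may overlap and [c k] may be infinite: a null set can enter with the value [+oo] and
    contributes 0 to the sum. *)
Lemma integral_step_le D h : (forall x, D x -> 0 <= h x) ->
  (forall x, D x -> exists2 k, A k x & h x <= c k) ->
  \int[m]_(x in D) h x <= \sum_(k <oo) c k * m (A k).
Proof.
move=> h0 hA; rewrite (integral_mkcond D).
under eq_eseriesr do rewrite -integral_term.
rewrite -integral_nneseries//; last first.
  by move=> k; apply: measurable_funeM; exact/measurable_EFinP/measurable_indic.
apply: ge0_le_integral_nomeas => x _.
  by rewrite patchE; case: ifPn => // /[!inE] /h0.
rewrite patchE; case: ifPn => [/[!inE] Dx|_]; last exact: nneseries_ge0.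
have [k Akx hk] := hA x Dx; apply: le_trans hk _.
apply: le_trans (nneseries_lim_ge k.+1 _) => //.
rewrite big_nat_recr//= indicE mem_set// mule1 leeDr//; exact: sume_ge0.
Qed.

End nonmeasurable.

Lemma geometric_index (R : realType) (lam x : R) : 1 < lam -> 1 <= x ->
  exists j, lam ^+ j <= x < lam ^+ j.+1.
Proof.
move=> l1 x1.
(* Bernoulli's inequality, which makes the powers of [lam] exceed [x]. *)
have bern k : 1 + k%:R * (lam - 1) <= lam ^+ k.
  elim: k => [|k IH]; first by rewrite mul0r addr0 expr0.
  rewrite exprS; apply: le_trans (_ : lam * (1 + k%:R * (lam - 1)) <= _).
    rewrite -subr_ge0 (_ : _ - _ = k%:R * (lam - 1) ^+ 2); last by rewrite -natr1; ring.
    by rewrite mulr_ge0// sqr_ge0.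
  by rewrite ler_wpM2l// (le_trans ler01)// ltW.
have h : exists k, x < lam ^+ k.
  have l0 : 0 < lam - 1 by rewrite subr_gt0.
  exists (Num.bound (x / (lam - 1))); apply: lt_le_trans (bern _).
  apply: le_lt_trans (_ : 1 + x / (lam - 1) * (lam - 1) < _).
    by rewrite divfK ?gt_eqF// lerDr.
  rewrite ltrD2l ltr_pM2r// archi_boundP// divr_ge0 ?(ltW l0)// (le_trans ler01)//.
case: (ex_minnP h) => -[|k] xk kmin.
  by move: xk; rewrite expr0 ltNge x1.
by exists k; rewrite xk andbT leNgt; apply/negP => /kmin; rewrite ltnn.
Qed.

Section completed.
Context {R : realType}.
Local Notation m := (@completed_lebesgue_measure R).
Local Notation LR := (caratheodory_type (mu_ext (wlength (@idfun R)))).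

Lemma completed_itv_measurable (i : interval R) : measurable ([set` i] : set LR).
Proof. by apply: sub_caratheodory; exact: measurable_itv. Qed.

Lemma completed_measure_itv (a b : R) (x y : bool) : a <= b ->
  m [set` Interval (BSide x a) (BSide y b)] = (b - a)%:E.
Proof.
move=> ab; transitivity (@lebesgue_measure R [set` Interval (BSide x a) (BSide y b)]).
  by [].
rewrite lebesgue_measure_itv/= lte_fin; case: ltP => // ba.
by rewrite (le_anti (introT andP (conj ab ba))) subrr.
Qed.

End completed.

(** * From growth in annuli to a finite integral *)

Section blow_up.
Context {R : realType}.
Variables (phi f g : R -> R) (r0 : R).
Hypothesis phi_bij : set_bij `[0, +oo[%classic `[0, +oo[%classic phi.
Hypothesis phi_incr : forall s t, 0 <= s -> s < t -> phi s < phi t.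
Hypothesis p_semi : almost_semi_multiplicative (phi_inv phi).
Hypothesis g_semi : almost_semi_multiplicative g.
Hypothesis g_bounded : forall K : set R, compact K -> K `<=` `]0, +oo[%classic ->
  has_ubound [set g t | t in K].
Hypothesis g_integral :
  (\int[@completed_lebesgue_measure R]_(t in `[1%R, +oo[%classic)
     (eta_inv phi (t / phi_inv phi (g t)) / t)%:E < +oo)%E.
Local Notation p := (phi_inv phi).
Local Notation eta := (eta_of phi).
Local Notation etai := (eta_inv phi).
Local Notation scale := (scale phi g).
Local Notation scale_gt0 := (scale_gt0 phi_bij phi_incr g_semi).
Local Notation eta_gt0 := (eta_gt0 phi_bij phi_incr).
Local Notation etai_gt0 := (eta_inv_gt0 phi_bij phi_incr).
Local Notation p_gt0 := (phi_inv_gt0 phi_bij phi_incr).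
Local Notation mu := (@completed_lebesgue_measure R).

(** On [[2^k, 2^k.+1[], of length [2^k], the integrand [scale t / t] is at least
    [scale (2^k) / (C 2^k.+1)]; [scale_scale] then passes from [2^k] to [m0 2^k]. *)
Lemma scale_sum_bounded m0 : 0 < m0 ->
  exists S, forall N, \sum_(0 <= k < N) scale (m0 * 2 ^+ k) <= S.
Proof.
move=> m00.
have [C C0 hC] := scale_near phi_bij phi_incr p_semi g_semi g_bounded.
have [D D0 hD] := scale_scale phi_bij phi_incr p_semi g_semi g_bounded m0 m00.
have e0 k : 0 < 2 ^+ k :> R by rewrite exprn_gt0.
pose A k : set R := `[2 ^+ k, 2 ^+ k.+1[%classic.
pose c k := scale (2 ^+ k) / (C * 2 ^+ k.+1).
have c0 k : 0 <= c k by rewrite divr_ge0 ?mulr_ge0 ?(ltW C0) ?(ltW (e0 _)) ?ltW ?scale_gt0.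
pose I := (\int[mu]_(t in `[1%R, +oo[%classic) (scale t / t)%:E)%E.
have gI : (I < +oo)%E by exact: g_integral.
have hI N : (\sum_(0 <= k < N) (c k)%:E * mu (A k) <= I)%E.
  apply: (@integral_step_ge _ _ _ mu A (EFin \o c)).
  - by move=> k; exact: completed_itv_measurable.
  - by move=> k; rewrite lee_fin.
  - move=> t; rewrite /= in_itv/= andbT => t1; have t0 := lt_le_trans ltr01 t1.
    by rewrite lee_fin; apply: divr_ge0; [exact/ltW/scale_gt0|exact: ltW].
  - apply/trivIsetP => i j _ _; wlog ij : i j / (i < j)%N.
      move=> h; rewrite neq_ltn => /orP[] ij; first by apply: h => //; rewrite neq_ltn ij.
      by rewrite setIC; apply: h => //; rewrite neq_ltn ij.
    move=> _; apply/seteqP; split => // x; rewrite /A /=; case; rewrite /= !in_itv/= => /andP[_ h1] /andP[h2 _].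
    have : 2 ^+ i.+1 <= 2 ^+ j :> R by rewrite ler_eXn2l// ltr1n.
    by move=> /le_trans/(_ h2); rewrite leNgt h1.
  - move=> k t; rewrite /A /= !in_itv/= andbT => /andP[kt _]; apply: le_trans kt.
    by rewrite exprn_ege1// ler1n.
  - move=> k t; rewrite /A /= in_itv/= => /andP[kt tk]; rewrite lee_fin.
    have t0 : 0 < t by exact: lt_le_trans kt.
    rewrite /c invfM mulrA ler_pM ?divr_ge0 ?invr_ge0 ?(ltW (e0 _)) ?(ltW C0) ?(ltW (scale_gt0 _))//.
      rewrite ler_pdivrMr// mulrC; apply: hC => //.
        by rewrite (le_trans (ltW tk))// exprS.
      by rewrite (le_trans kt)// ler_peMl ?ler1n// ltW.
    by rewrite lef_pV2 ?posrE// ltW.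
have Ifin : I \is a fin_num.
  rewrite ge0_fin_numE// (le_trans _ (hI 0%N))// big_geq//.
exists (D * (2 * C * fine I)) => N.
apply: le_trans (_ : D * \sum_(0 <= k < N) scale (2 ^+ k) <= _).
  by rewrite mulr_sumr; apply: ler_sum => k _; apply: hD.
rewrite ler_wpM2l ?(ltW D0)//.
rewrite -lee_fin EFinM fineK//; apply: le_trans (lee_wpmul2l _ (hI N)); last first.
  by rewrite lee_fin mulr_ge0// ltW.
rewrite -sumEFin ge0_sume_distrr; last first.
  by move=> k _; rewrite mule_ge0// ?lee_fin.
apply: lee_sum => k _; rewrite completed_measure_itv; last first.
  by rewrite ler_eXn2l// ltr1n.
rewrite -!EFinM lee_fin le_eqVlt; apply/orP; left; apply/eqP.
by rewrite /c exprS; field; rewrite !gt_eqF.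
Qed.

(** On the cell [[T j, T j.+1[] monotonicity gives [X r <= C (Q (T j.+2) - Q (T j))], and the cell
    has length [(lam - 1) T j]. Each increment of the bounded function [Q] is thus counted at most
    twice. *)
Lemma finite_growth (lam kap r1 : R) (M : R -> R) :
  1 < lam -> 0 < kap -> 0 < r0 -> r0 <= r1 ->
  Linfty_loc_itv `[r0, +oo[%classic f -> (forall r, r0 <= r -> 0 <= f r) ->
  (forall a b, r1 <= a -> a <= b -> M a <= M b) -> 0 < M r1 ->
  (forall r a b, r1 <= r -> 0 < f r -> r <= a -> a < b -> b <= lam * r -> M b <= 2 * M a ->
    (b - a) / 4 * p (kap * (b - a) * f r * g (M a)) <= M b - M a) ->
  (\int[mu]_(r in `[r0, +oo[%classic)
     ((if f r == 0 then 0 else eta (r / etai (p (1 / f r)))) / r)%:E < +oo)%E.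
Proof.
move=> l1 k0 r00 r01 fL f0 M_mono M1 M_step.
have l0 : 0 < lam by exact: lt_trans l1.
have r10 : 0 < r1 by exact: lt_le_trans r01.
have [S hS] := scale_sum_bounded M1.
have [P [Cp Cp0 [Pb Pm Ps]]] := potential_exists phi_bij phi_incr p_semi g_semi g_bounded M1 hS.
have [C C0 hC] := growth_bound phi_bij phi_incr p_semi g_semi g_bounded k0 l1 M1 hS Cp0 Pm Pb Ps.
pose X r := if f r == 0 then 0 else eta (r / etai (p (1 / f r))).
have X0 r : 0 < r -> r0 <= r -> 0 <= X r.
  move=> rp rr; rewrite /X; case: eqP => // /eqP fr; apply/ltW/eta_gt0/divr_gt0 => //.
  by apply/etai_gt0/p_gt0/divr_gt0 => //; rewrite lt_def fr f0.
pose Q r := P (M r).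
have Qm a b : r1 <= a -> a <= b -> Q a <= Q b by move=> *; apply/Pm/M_mono.
have hX r : r1 <= r -> X r <= C * (Q (lam * r) - Q r).
  move=> rr; have rp : 0 < r by exact: lt_le_trans rr.
  have rl : r <= lam * r by rewrite ler_peMl// ltW.
  rewrite /X; case: eqP => [_|/eqP fr].
    by rewrite mulr_ge0 ?(ltW C0)// subr_ge0 Qm.
  have fr0 : 0 < f r by rewrite lt_def fr f0// (le_trans r01).
  apply: hC => //.
  - by move=> a b ra ab _; apply: M_mono => //; exact: le_trans ra.
  - exact: M_mono.
  - by move=> a b; exact: M_step.
pose T j := r1 * lam ^+ j.
have T0 j : 0 < T j by rewrite mulr_gt0// exprn_gt0.
have TS j : T j.+1 = lam * T j by rewrite /T exprS mulrCA.
have TleS j : T j <= T j.+1 by rewrite TS ler_peMl ?ltW.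
have T1 j : r1 <= T j by rewrite ler_peMr ?(ltW r10)// exprn_ege1// ltW.
pose cj j := C * (Q (T j.+2) - Q (T j)) / T j.
have Qj j : 0 <= Q (T j.+2) - Q (T j) by rewrite subr_ge0 Qm// (le_trans (TleS j)).
have cj0 j : 0 <= cj j.
  by rewrite /cj divr_ge0 ?(ltW (T0 _))// mulr_ge0 ?(ltW C0).
have [|_ [K0 [N [mN N0 hN]]]] := fL _ (@segment_compact R r0 r1).
  by move=> x /=; rewrite !in_itv/= andbT => /andP[].
pose K := Num.max K0 1.
have K_gt0 : 0 < K by rewrite lt_max ltr01 orbT.
have pK0 : 0 < p (1 / K) by apply/p_gt0/divr_gt0.
have eK : 0 < etai (p (1 / K)) by exact: etai_gt0.
pose c1 := eta (r1 / etai (p (1 / K))) / r0.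
have c10 : 0 <= c1 by apply: divr_ge0 (ltW r00); apply/ltW/eta_gt0/divr_gt0.
(* Index 0 is the exceptional null set, with value [+oo]; index 1 is the initial interval; the other
   indices form the geometric grid. *)
pose A k : set R := match k with 0 => N | 1 => `[r0, r1]%classic
  | k.+2 => `[T k, T k.+1[%classic end.
pose c k : \bar R := match k with 0 => +oo%E | 1 => c1%:E | k.+2 => (cj k)%:E end.
have c0 k : (0 <= c k)%E by case: k => [|[|k]] //=; rewrite lee_fin.
apply: (@le_lt_trans _ _ (\sum_(k <oo) c k * mu (A k))%E).
  apply: integral_step_le => //.
  - by case=> [|[|k]] //=; exact: completed_itv_measurable.
  - move=> r; rewrite /= in_itv/= andbT => rr; have rp : 0 < r by exact: lt_le_trans rr.
    by rewrite lee_fin; apply: divr_ge0 (ltW rp); exact: X0.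
  move=> r; rewrite /= in_itv/= andbT => rr; have rp : 0 < r by exact: lt_le_trans rr.
  have [r1r|rr1] := leP r1 r.
    have [j /andP[jr rj]] : exists j, T j <= r < T j.+1.
      have [|j h] := @geometric_index _ lam (r / r1) l1; first by rewrite ler_pdivlMr// mul1r.
      exists j; move: h; rewrite ler_pdivlMr// ltr_pdivrMr// -!(mulrC r1)//.
    exists j.+2; first by rewrite /= in_itv/= jr.
    rewrite lee_fin; apply: le_trans (_ : X r / T j <= _).
      by apply: ler_wpM2l; [exact: X0|rewrite lef_pV2 ?posrE].
    rewrite /cj; apply: ler_wpM2r; first by rewrite invr_ge0 ltW.
    apply: le_trans (hX _ r1r) _; rewrite ler_wpM2l ?(ltW C0)// lerB//; apply: Qm => //.
      by rewrite (le_trans r1r)// ler_peMl// ltW.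
    by rewrite TS ler_wpM2l ?ltW.
  have [Nr|Nr] := pselect (N r); first by exists 0%N => //=; rewrite leey.
  exists 1%N; first by rewrite /= in_itv/= rr ltW.
  have fK : `|f r| <= K0.
    apply: contrapT => h; apply: Nr; apply: hN => /= h'; apply: h; apply: h'.
    by rewrite /= in_itv/= rr ltW.
  rewrite /= lee_fin; apply: ler_pM; [exact: X0|by rewrite invr_ge0 ltW| |by rewrite lef_pV2].
  case: eqP => [_|/eqP fr]; first by apply/ltW/eta_gt0/divr_gt0.
  have fr0 : 0 < f r by rewrite lt_def fr f0.
  have fK' : f r <= K by rewrite le_max (le_trans (ler_norm _) fK).
  have pp : p (1 / K) <= p (1 / f r).
    apply: (phi_inv_le phi_bij phi_incr); first exact/ltW/divr_gt0.
    by rewrite ler_pM2l// lef_pV2.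
  have ee := eta_inv_le phi_bij phi_incr pK0 pp.
  have e0 : 0 < etai (p (1 / f r)) by exact: lt_le_trans ee.
  apply: (eta_le phi_bij phi_incr); first exact: divr_gt0.
  by apply: ler_pM => //; rewrite ?invr_ge0 ?(ltW rp) ?(ltW e0) ?lef_pV2 ?(ltW rr1).
apply: (@le_lt_trans _ _ (c1 * (r1 - r0) + C * (lam - 1) * (2 * S))%:E); last exact: ltry.
have term0 k : (0 <= c k * mu (A k))%E by rewrite mule_ge0.
apply: lime_le; first by apply: is_cvg_nneseries => *; exact: term0.
apply: nearW => n.
apply: (@le_trans _ _ (\sum_(0 <= k < n.+2) c k * mu (A k))%E).
  rewrite (@big_cat_nat _ _ _ n 0%N n.+2)//=; last by rewrite -addn2 leq_addr.
  by rewrite leeDl// sume_ge0.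
rewrite big_nat_recl//= big_nat_recl//= N0 mule0 add0e.
rewrite completed_measure_itv// [leRHS]EFinD; apply: leeD; first by rewrite -EFinM.
have -> : (\sum_(0 <= k < n) (cj k)%:E * mu `[T k, T k.+1[%classic =
    (C * (lam - 1) * \sum_(0 <= k < n) (Q (T k.+2) - Q (T k)))%:E)%E.
  rewrite mulr_sumr -sumEFin; apply: eq_bigr => k _.
  rewrite completed_measure_itv// -EFinM /cj; congr EFin.
  set q := Q _ - Q _; rewrite (TS k).
  by field; rewrite gt_eqF.
rewrite lee_fin ler_wpM2l ?mulr_ge0 ?(ltW C0) ?subr_ge0 ?(ltW l1)//.
(* Two telescoping sums, each bounded by [S]. *)
have -> : \sum_(0 <= k < n) (Q (T k.+2) - Q (T k)) =
    \sum_(0 <= k < n) (Q (T k.+2) - Q (T k.+1)) + \sum_(0 <= k < n) (Q (T k.+1) - Q (T k)).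
  by rewrite -big_split/=; apply: eq_bigr => k _; rewrite addrA subrK.
rewrite (@telescope_sumr _ 0 n (fun k => Q (T k.+1)))//.
rewrite (@telescope_sumr _ 0 n (fun k => Q (T k)))// mulrDl mul1r.
have Qb r : 0 <= Q r <= S by exact: Pb.
have Qd a b : Q a - Q b <= S.
  have /andP[_ h] := Qb a; have /andP[h' _] := Qb b.
  by rewrite lerBlDr (le_trans h)// lerDl.
by rewrite lerD.
Qed.

End blow_up.

(** * Comparison principles *)

Section almost_everywhere.
Context {R : realType} {n : nat}.
Local Notation E := 'rV[R]_n.
Local Notation mu := (@lebesgue_rV R n).
Implicit Types (A : set E) (f g : E -> R).

Lemma measf_min2 A f g : measf A f -> measf A g -> measf A (fun x => Num.min (f x) (g x)).
Proof. by rewrite measfE => *; exact: measurable_minr. Qed.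

(** [min |f| |g|] is dominated everywhere and agrees with [|f|] almost everywhere on [A]. *)
Lemma L1_dom_ae A f g : meas_set A -> measf A f -> L1 A g ->
  {ae mu, forall x, A x -> `|f x| <= g x} -> L1 A f.
Proof.
move=> mA mf ig fg.
have mh : measf A (fun x => Num.min `|f x| `|g x|).
  by apply: measf_min2; apply: measf_norm => //; exact: L1_measf.
have ih : L1 A (fun x => Num.min `|f x| `|g x|).
  apply: (L1_dom mA mh (L1_norm ig)) => x _.
  by rewrite ger0_norm ?le_min ?normr_ge0// ge_min lexx orbT.
have inf : L1 A (fun x => `|f x|).
  apply: (L1_ae mA (measf_norm mf) ih); apply: (ae_mono fg) => x h Ax.
  by apply/min_idPl; exact: le_trans (h Ax) (ler_norm _).
exact: (L1_dom mA mf inf).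
Qed.

Lemma intOn_ae_eq0 A f : meas_set A -> L1 A f ->
  {ae mu, forall x, A x -> 0 <= f x} -> intOn A f = 0 ->
  {ae mu, forall x, A x -> f x = 0}.
Proof.
move=> mA fi f0 i0; have inf := L1_norm fi.
have fn : {ae mu, forall x, A x -> `|f x| = f x}.
  by apply: (ae_mono f0) => x h Ax; rewrite ger0_norm ?h.
have i0' : intOn A (fun x => `|f x|) = 0.
  by rewrite -i0; apply: intOn_ae => //; exact: L1_measf.
have := intOn_eq0_ae mA inf (fun x _ => normr_ge0 (f x)) i0'.
by move=> h; apply: (ae_mono h) => x hx Ax; apply/normr0_eq0/hx.
Qed.

End almost_everywhere.

Section flux.
Context {R : realType} {n : nat}.
Local Notation E := 'rV[R]_n.
Variables (phi : R -> R).
Hypothesis phi_bij : set_bij `[0, +oo[%classic `[0, +oo[%classic phi.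
Hypothesis phi_incr : forall s t, 0 <= s -> s < t -> phi s < phi t.
Hypothesis phi_monotone : forall xi zeta : E, xi != zeta ->
  0 < dotv (flux phi xi - flux phi zeta) (xi - zeta).
Implicit Types x y : E.

Lemma flux0 : flux phi (0 : E) = 0.
Proof. by rewrite /flux scaler0. Qed.

Lemma dotv_flux_self x : dotv (flux phi x) x = phi (enorm x) * enorm x.
Proof.
rewrite /flux dotvZl -enorm2; have [x0|x0] := eqVneq (enorm x) 0.
  by rewrite x0 mulr0 expr0n mulr0.
by field.
Qed.

Lemma enorm_flux x : enorm (flux phi x) = phi (enorm x).
Proof.
have p0 : 0 <= phi (enorm x) by apply: (phi_ge0 phi_bij); exact: enorm_ge0.
rewrite /flux enormZ; have [x0|x0] := eqVneq (enorm x) 0.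
  by rewrite x0 mulr0 (phi0 phi_bij).
by rewrite ger0_norm ?divfK// divr_ge0// enorm_ge0.
Qed.

Lemma flux_le x y : `|dotv (flux phi x) y| <= phi (enorm x) * enorm y.
Proof. by rewrite -enorm_flux; exact: normr_dotv. Qed.

Lemma flux_monotone x y : 0 <= dotv (flux phi x - flux phi y) (x - y).
Proof.
have [->|xy] := eqVneq x y; first by rewrite !subrr /dotv sumr_ge0// => i _; rewrite mxE mul0r.
exact/ltW/phi_monotone.
Qed.

Lemma measf_phi_enorm A (G : E -> E) : (forall i, measf A (fun x => G x 0 i)) ->
  measf A (fun x => phi (enorm (G x))).
Proof.
(* [phi] is monotone on [[0, +oo[] only; composing with [max t 0] makes it monotone on the line and
   keeps its values at norms. *)
move=> mG; have -> : (fun x => phi (enorm (G x))) = (fun x => phi (Num.max (enorm (G x)) 0)).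
  by apply/funext => x; rewrite max_l// enorm_ge0.
apply: (measf_comp_mono (h := fun t => phi (Num.max t 0))); last exact: measf_enorm.
move=> s t st; apply: (phi_le phi_incr); first by rewrite le_max lexx orbT.
by rewrite ge_max !le_max st lexx orbT.
Qed.

Lemma measf_flux A (G : E -> E) i : (forall i, measf A (fun x => G x 0 i)) ->
  measf A (fun x => flux phi (G x) 0 i).
Proof.
move=> mG; rewrite /flux; under eq_fun do rewrite mxE.
apply: measfM => //; apply: measfM; first exact: measf_phi_enorm.
by apply: measf_inv; [move=> x; exact: enorm_ge0|exact: measf_enorm].
Qed.

End flux.

Section ess_support.
Context {R : realType} {n : nat}.
Local Notation E := 'rV[R]_n.
Local Notation mu := (@lebesgue_rV R n).

Lemma compact_ess_support (Om : set E) (f : E -> R) (z : E) (h : R) :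
  (forall x, h <= enorm (x - z) -> f x = 0) -> compact (ess_support (patch (fun=> 0) Om f)).
Proof.
move=> f0; apply: (@subclosed_compact _ _ [set x | enorm (x - z) <= h]).
- rewrite -openC (_ : ~` _ = \bigcup_(U in [set U | open U /\
    {ae mu, forall y, U y -> patch (fun=> 0) Om f y = 0}]) U).
    by apply: bigcup_open => U [].
  apply/seteqP; split => x /=.
    by move=> /contrapT [U [oU Ux aeU]]; exists U.
  by move=> [U [oU aeU] Ux]; case; exists U.
- exact: compact_dist_le.
- move=> x /= hx; rewrite leNgt; apply/negP => xh; apply: hx.
  exists [set y | h < enorm (y - z)]; split => //; first exact: open_dist_gt.
  apply: ae_forall => y /= hy; rewrite /patch; case: ifPn => // _.
  by rewrite f0// ltW.
Qed.

End ess_support.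

(** The barrier flux uses up one of the two copies of [q * p]; the other is left to be bounded by
    the error [eH]. *)
Lemma absorb_half (R : realFieldType) (q p I eH : R) :
  2 * q * p <= - I -> - (q * p) - eH <= I -> q * p <= eH.
Proof. by move=> *; lra. Qed.

Lemma Phi_mono (R : realType) (a b : R) : a <= b -> Phi a <= Phi b.
Proof.
rewrite le_eqVlt => /predU1P[->//|ab].
have [c _ hc] := is_derive_MVT Phi chi _ _ ab is_derive_Phi.
by rewrite -subr_ge0 hc mulr_ge0 ?chi_ge0// subr_ge0 ltW.
Qed.

Section radial.
Context {R : realType} {n : nat}.
Local Notation E := 'rV[R]_n.
Variables (phi : R -> R) (q : R).
Hypothesis phi_bij : set_bij `[0, +oo[%classic `[0, +oo[%classic phi.
Hypothesis phi_incr : forall s t, 0 <= s -> s < t -> phi s < phi t.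
Hypothesis q0 : 0 <= q.

(** The radial slope for which the flux is exactly [(q / n) (x - z)], a field of divergence [q]. *)
Definition profile (s : R) := phi_inv phi (q * s / n%:R).

Lemma profile0 : profile 0 = 0.
Proof. by rewrite /profile mulr0 mul0r (phi_inv0 phi_bij phi_incr). Qed.

Lemma profile_ge0 s : 0 <= s -> 0 <= profile s.
Proof. by move=> s0; apply: (phi_inv_ge0 phi_bij); rewrite divr_ge0 ?mulr_ge0. Qed.

Lemma profile_mono s t : 0 <= s -> s <= t -> profile s <= profile t.
Proof.
move=> s0 st; apply: (phi_inv_le phi_bij phi_incr); first by rewrite divr_ge0 ?mulr_ge0.
by rewrite ler_wpM2r ?invr_ge0// ler_wpM2l.
Qed.

Variables (z : E) (w v0 : R) (J : nat).
Hypotheses (w0 : 0 < w) (v00 : 0 < v0).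
Local Notation c := (incr profile w \o val : 'I_J -> R).
Local Notation v := (barrier z w v0 J c).

Lemma grad_barrier x : grad v x = (slope w J c (enorm (x - z)) / enorm (x - z)) *: (x - z).
Proof. by apply/rowP => i; rewrite !mxE partial_barrier. Qed.

Lemma enorm_grad_barrier x : x != z -> enorm (grad v x) = slope w J c (enorm (x - z)).
Proof.
move=> xz; have d0 : enorm (x - z) != 0.
  by apply: contra_neq xz => /enorm_eq0/eqP; rewrite subr_eq0 => /eqP.
have s0 : 0 <= slope w J c (enorm (x - z)) by apply: slope_incr_ge0 => //; exact: profile_mono.
by rewrite grad_barrier enormZ ger0_norm ?divr_ge0 ?enorm_ge0// divfK.
Qed.

Lemma enorm_grad_barrier_le x : enorm (grad v x) <= profile (J%:R * w).
Proof.
have [->|xz] := eqVneq x z.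
  rewrite grad_barrier subrr scaler0 enorm0.
  by apply: profile_ge0; apply: mulr_ge0; [exact: ler0n|exact: ltW].
rewrite enorm_grad_barrier//; apply: slope_incr_max => //; [exact: profile0|exact: profile_mono].
Qed.

(** Both fields are radial. The staircase lies between [profile] at [t - 2 w] and at [t], where [t]
    is the distance to [z]; [phi] turns this into the linear bounds [q (t - 2 w) / n] and
    [q t / n]. *)
Lemma flux_barrier x : (0 < n)%N -> enorm (x - z) < J%:R * w ->
  enorm (flux phi (grad v x) - (q / n%:R) *: (x - z)) <= 2 * q * w / n%:R.
Proof.
move=> n0 xJ; have nR : 0 < n%:R :> R by rewrite ltr0n.
have B0 : 0 <= 2 * q * w / n%:R by rewrite divr_ge0 ?(ltW nR)// !mulr_ge0// ltW.
have [->|xz] := eqVneq x z.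
  by rewrite grad_barrier subrr !scaler0 flux0 subr0 enorm0.
set t := enorm (x - z) in xJ *.
have t0 : 0 < t.
  rewrite lt_def enorm_ge0 andbT; apply: contra_neq xz => /enorm_eq0/eqP.
  by rewrite subr_eq0 => /eqP.
have s0 : 0 <= slope w J c t by apply: slope_incr_ge0 => //; exact: profile_mono.
have -> : flux phi (grad v x) - (q / n%:R) *: (x - z) =
    ((phi (slope w J c t) - q * t / n%:R) / t) *: (x - z).
  rewrite /flux enorm_grad_barrier// grad_barrier -/t scalerA -scalerBl; congr (_ *: _).
  have [sl0|sl0] := eqVneq (slope w J c t) 0.
    by rewrite sl0 (phi0 phi_bij phi_incr) !mul0r; field; rewrite !gt_eqF.
  by field; rewrite sl0 !gt_eqF.
rewrite enormZ -/t normrM normfV (ger0_norm (ltW t0)) divfK ?gt_eqF//.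
pose m := Num.truncn (t / w).
have tw : 0 <= t / w by rewrite divr_ge0 ?ltW.
have /andP[m1 m2] := truncn_itv tw; rewrite -/m in m1 m2.
have mt : m%:R * w <= t by rewrite -ler_pdivlMr.
have tm : t <= m.+1%:R * w by rewrite -ler_pdivrMr// ltW.
have mJ : (m <= J)%N.
  by rewrite -(ler_nat R) -(ler_pM2r w0) (le_trans mt)// ltW.
have pmono := profile_mono; have prof0 := profile0.
have phiprof s : 0 <= s -> phi (profile s) = q * s / n%:R.
  by move=> ss; rewrite /profile (phi_invK phi_bij)// divr_ge0 ?mulr_ge0.
have up : phi (slope w J c t) <= q * (m%:R * w) / n%:R.
  rewrite -phiprof ?mulr_ge0 ?(ltW w0)//; apply: (phi_le phi_incr) => //.
  by apply: slope_incr_le.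
have low : q * (t - 2 * w) / n%:R <= phi (slope w J c t).
  (* In the first mesh cell [t - 2 w] is negative and the lower bound is just [phi >= 0]. *)
  case: m m1 m2 mt tm mJ up => [|m] m1 m2 mt tm mJ up.
    apply: le_trans (phi_ge0 phi_bij s0); rewrite pmulr_lle0 ?invr_gt0// mulr_ge0_le0//.
    by rewrite subr_le0 (le_trans tm)// ler_pM2r// ler_nat.
  apply: le_trans (_ : q * (m%:R * w) / n%:R <= _).
    rewrite ler_pM2r ?invr_gt0// ler_wpM2l// lerBlDr -mulrDl.
    by apply: le_trans tm _; rewrite ler_pM2r// -natrD ler_nat addn2.
  rewrite -phiprof ?mulr_ge0 ?(ltW w0)//; apply: (phi_le phi_incr).
    by apply: profile_ge0; rewrite mulr_ge0// ltW.
  by apply: slope_incr_ge => //; exact: ltnW.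
have up' : phi (slope w J c t) <= q * t / n%:R.
  by apply: le_trans up _; rewrite ler_pM2r ?invr_gt0// ler_wpM2l.
rewrite ler0_norm ?subr_le0// opprB lerBlDr.
apply: le_trans (_ : 2 * q * w / n%:R + q * (t - 2 * w) / n%:R <= _); last by rewrite lerD2l.
by rewrite le_eqVlt; apply/orP; left; apply/eqP; ring.
Qed.

Lemma partial_barrier_le i x : `|partial i v x| <= profile (J%:R * w).
Proof.
have -> : partial i v x = grad v x 0 i by rewrite mxE.
exact: le_trans (coord_le_enorm _ _) (enorm_grad_barrier_le x).
Qed.

End radial.

(** * Testing the inequality with truncations in a ball *)

Section comparison.
Context {R : realType} {n : nat}.
Local Notation E := 'rV[R]_n.
Local Notation mu := (@lebesgue_rV R n).
Variables (Om : set E) (phi : R -> R) (F : E -> R -> R) (u : E -> R) (G : E -> E).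
Hypothesis oOm : open Om.
Hypothesis phi_bij : set_bij `[0, +oo[%classic `[0, +oo[%classic phi.
Hypothesis phi_incr : forall s t, 0 <= s -> s < t -> phi s < phi t.
Hypothesis phi_monotone : forall xi zeta : E, xi != zeta ->
  0 < dotv (flux phi xi - flux phi zeta) (xi - zeta).
Hypothesis u_ge0 : {ae mu, forall x, Om x -> 0 <= u x}.
Hypothesis u_loc : Linfty_loc Om u.
Hypothesis u_grad : W11loc_grad Om u G.
Hypothesis F_loc : L1loc Om (fun x => F x (u x)).
Hypothesis flux_loc : L1loc Om (fun x => phi (enorm (G x)) * enorm (G x)).
Hypothesis u_weak : forall psi H,
  W11_grad Om psi H -> W11_0 Om psi -> Linfty mu Om psi ->
  {ae mu, forall x, Om x -> 0 <= psi x} ->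
  compact (ess_support (patch (fun=> 0) Om psi)) ->
  (\int[mu]_(x in Om) (phi (enorm (G x)) * enorm (H x))%:E < +oo)%E ->
  (\int[mu]_(x in Om) (F x (u x) * psi x)%:E <=
   - \int[mu]_(x in Om) (dotv (flux phi (G x)) (H x))%:E)%E.
Hypothesis u_boundary : zero_on_boundary Om u.

Let mOm : meas_set Om. Proof. exact: open_meas. Qed.

Let mG i : measf Om (fun x => G x 0 i).
Proof.
apply: measf_local => // r r0; have [_ G1 _] := u_grad r0; exact: L1_measf (G1 i).
Qed.

Let mu' : measf Om u.
Proof. apply: measf_local => // r r0; have [u1 _ _] := u_grad r0; exact: L1_measf u1. Qed.

Let mF : measf Om (fun x => F x (u x)).
Proof. by apply: measf_local => // r r0; exact: L1_measf (F_loc r0). Qed.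

Section test.
Variables (z : E) (h1 h : R) (v : E -> R) (v0 Cv : R).
Hypotheses (h10 : 0 <= h1) (h1h : h1 < h).
Hypotheses (sv : smooth v) (v00 : 0 < v0) (v_ge : forall x, v0 <= v x).
Hypothesis v_bd : forall i x, `|partial i v x| <= Cv.
Hypothesis u_le_v : {ae mu, forall x, Om x -> h1 <= enorm (x - z) -> enorm (x - z) < h ->
  u x <= v x}.

Let h0 : 0 < h. Proof. exact: le_lt_trans h1h. Qed.
Let gam := cutoff z h1 h.
Let r := enorm z + h + 1.
Let r0 : 0 < r. Proof. by rewrite /r ltr_wpDl// addr_ge0 ?enorm_ge0 ?ltW. Qed.

Let in_ball x : enorm (x - z) <= h -> eball r x.
Proof.
move=> xh; have := enorm_dist x z 0; rewrite !subr0 => /le_lt_trans; apply.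
by rewrite /r addrC -addrA ltrD2l ltr_pwDr.
Qed.

Let tgam A : (forall x, enorm (x - z) <= h -> A x) -> test_function A gam.
Proof. by move=> hA; exact: test_function_cutoff. Qed.

(** In effect [Phi (u - v)] on the ball of radius [h1] about [z], extended by 0. The cutoff makes
    the boundary condition applicable and the support compact; it equals 1 within radius [h1], and
    [u <= v] removes the truncation on the ring between [h1] and [h]. *)
Definition cut_test : E -> R := trunc (fun x => gam x * u x) v.
Definition cut_test_grad : E -> E := trunc_grad (fun x => gam x * u x) v (prod_grad u G gam).
Local Notation psi := cut_test.
Local Notation H := cut_test_grad.

Let w_grad : W11_grad Om (fun x => gam x * u x) (prod_grad u G gam).
Proof. exact: (W11_grad_prod oOm (u_grad r0) (tgam in_ball)). Qed.

Let psi_grad : W11_grad Om psi H.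
Proof.
have [K wK wapp] : W11_0 Om (fun x => gam x * u x).
  by apply: u_boundary; apply: tgam.
exact: (trunc_W11_grad oOm wK wapp w_grad sv v00 v_ge v_bd).
Qed.

Let psi_0 : W11_0 Om psi.
Proof.
have [K wK wapp] : W11_0 Om (fun x => gam x * u x).
  by apply: u_boundary; apply: tgam.
exact: (trunc_W11_0 oOm wK wapp sv v00 v_ge v_bd).
Qed.

Let v_gt0 x : 0 < v x. Proof. exact: lt_le_trans (v_ge x). Qed.

Let psi_off x : h <= enorm (x - z) -> psi x = 0 /\ H x = 0.
Proof.
move=> hx; have g0 : gam x = 0 by apply: cutoff0.
have le0 : gam x * u x - v x <= 0 by rewrite g0 mul0r sub0r oppr_le0 ltW.
split; first by rewrite /cut_test /trunc Phi_le0.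
by apply/rowP => i; rewrite !mxE chi_le0// mul0r.
Qed.

Lemma cut_testE : {ae mu, forall x, Om x ->
  (enorm (x - z) < h1 -> psi x = Phi (u x - v x) /\ H x = chi (u x - v x) *: (G x - grad v x))
  /\ (h1 <= enorm (x - z) -> psi x = 0 /\ H x = 0)}.
Proof.
apply: (ae_mono (ae_and u_ge0 u_le_v)) => x [ux0 uxv] Omx; split => hx.
  have g1 : gam x = 1 by apply: cutoff1 => //; exact: ltW.
  split; first by rewrite /cut_test /trunc g1 mul1r.
  apply/rowP => i; rewrite !mxE g1 !mul1r; congr (_ * _).
  by rewrite /gam partial_cutoff// mulr0 addr0.
have [xh|xh] := leP h (enorm (x - z)); first exact: psi_off.
have le0 : gam x * u x - v x <= 0.
  rewrite subr_le0 (le_trans _ (uxv Omx hx xh))// ler_piMl ?ux0//; exact: cutoff_le1.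
split; first by rewrite /cut_test /trunc Phi_le0.
by apply/rowP => i; rewrite !mxE chi_le0// mul0r.
Qed.

Let psi_ge0 x : 0 <= psi x. Proof. exact: Phi_ge0. Qed.

Let mH i : measf Om (fun x => H x 0 i).
Proof. by have [_ H1 _] := psi_grad; exact: L1_measf (H1 i). Qed.

Let mpsi : measf Om psi.
Proof. by have [p1 _ _] := psi_grad; exact: L1_measf p1. Qed.

Let u_bound : exists2 C, 0 <= C & {ae mu, forall x, Om x -> eball r x -> `|u x| <= C}.
Proof.
have [_ [C hC]] := u_loc r0; exists `|C| => //.
by apply: (ae_mono hC) => x hx Omx xr; apply: le_trans (hx _) (ler_norm _).
Qed.

Lemma cut_test_bounded : exists2 C, 0 <= C & {ae mu, forall x, Om x -> `|psi x| <= C}.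
Proof.
have [C C0 hC] := u_bound; exists C => //.
apply: (ae_mono hC) => x hx Omx; rewrite ger0_norm//.
have [xh|xh] := leP h (enorm (x - z)); first by have [-> _] := psi_off xh.
have xr : eball r x by apply: in_ball; exact: ltW.
rewrite /cut_test /trunc; have [l0|/ltW l0] := leP (gam x * u x - v x) 0.
  by rewrite Phi_le0.
apply: le_trans (Phi_le _ l0) _; apply: le_trans (_ : gam x * u x <= _).
  by rewrite gerBl ltW.
apply: le_trans (ler_norm _) _; rewrite normrM ger0_norm ?cutoff_ge0//.
by apply: le_trans (hx Omx xr); rewrite ler_piMl// cutoff_le1.
Qed.

Lemma enorm_grad_le x : enorm (grad v x) <= n%:R * Cv.
Proof.
have hi i : `|grad v x 0 i| <= Cv by rewrite mxE.
apply: le_trans (enorm_le_sum _) _; apply: le_trans (ler_sum _ (fun i _ => hi i)) _.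
by rewrite sumr_const card_ord mulr_natl.
Qed.

Let H_le : {ae mu, forall x, Om x -> enorm (H x) <= enorm (G x) + n%:R * Cv}.
Proof.
apply: (ae_mono cut_testE) => x hx Omx; have [h2 h3] := hx Omx.
have B0 : 0 <= enorm (G x) + n%:R * Cv.
  by rewrite addr_ge0 ?enorm_ge0// (le_trans (enorm_ge0 _) (enorm_grad_le x)).
have [xh|xh] := leP h1 (enorm (x - z)); first by have [_ ->] := h3 xh; rewrite enorm0.
have [_ ->] := h2 xh; rewrite enormZ; apply: le_trans (_ : enorm (G x - grad v x) <= _).
  by rewrite ler_piMl ?enorm_ge0// chi_norm.
by apply: le_trans (enormD _ _) _; rewrite enormN lerD2l enorm_grad_le.
Qed.

Let mB : meas_set (Om `&` eball r).
Proof. by apply: meas_setI => //; exact: meas_eball. Qed.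

Let off_ball (f : E -> R) : (forall x, psi x = 0 -> H x = 0 -> f x = 0) ->
  forall x, Om x -> ~ eball r x -> f x = 0.
Proof.
move=> f0 x _ xr; have [h'|h'] := leP h (enorm (x - z)).
  by have [? ?] := psi_off h'; exact: f0.
by case: xr; apply: in_ball; exact: ltW.
Qed.

(** [|H| <= |G| + n Cv], and the constant is harmless: [phi |G| <= phi 1] where [|G| <= 1], while
    [phi |G| <= phi |G| |G|] elsewhere. *)
Lemma L1_phi_grad : L1 Om (fun x => phi (enorm (G x)) * enorm (H x)).
Proof.
have mf : measf Om (fun x => phi (enorm (G x)) * enorm (H x)).
  by apply: measfM; [exact: (measf_phi_enorm phi_incr)|exact: measf_enorm].
apply: (proj1 (L1_extend mOm (meas_eball r) _ _)); last first.
  by apply: off_ball => x _ ->; rewrite enorm0 mulr0.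
pose D x := (1 + n%:R * Cv) * (phi (enorm (G x)) * enorm (G x)) + phi 1 * (n%:R * Cv).
have Cv0 : 0 <= n%:R * Cv by exact: le_trans (enorm_ge0 _) (enorm_grad_le 0).
have iD : L1 (Om `&` eball r) D.
  by apply: L1D => //; [apply: L1Z => //; exact: flux_loc|exact: L1_cst].
apply: (L1_dom_ae mB (measf_sub mOm _ mf) iD) => [x []//|].
apply: (ae_mono H_le) => x hx [Omx _]; have {hx} hx := hx Omx.
have p0 : 0 <= phi (enorm (G x)) by apply: (phi_ge0 phi_bij); exact: enorm_ge0.
rewrite ger0_norm ?mulr_ge0 ?enorm_ge0//.
apply: le_trans (ler_wpM2l p0 hx) _; rewrite mulrDr /D mulrDl mul1r -addrA lerD2l.
have [g1|g1] := leP 1 (enorm (G x)).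
  apply: le_trans (_ : n%:R * Cv * (phi (enorm (G x)) * enorm (G x)) <= _).
    by rewrite mulrC ler_wpM2l// ler_peMr.
  by rewrite lerDl mulr_ge0// (phi_ge0 phi_bij).
apply: le_trans (_ : phi 1 * (n%:R * Cv) <= _).
  by rewrite ler_wpM2r// (phi_le phi_incr)// ?enorm_ge0// ltW.
by rewrite lerDr mulr_ge0// mulr_ge0// enorm_ge0.
Qed.

Lemma L1_flux_grad : L1 Om (fun x => dotv (flux phi (G x)) (H x)).
Proof.
apply: (L1_dom mOm _ L1_phi_grad).
  by apply: measf_dotv => // i; exact: (measf_flux phi_incr).
by move=> x _; exact: (flux_le phi_bij).
Qed.

Lemma L1_F_test : L1 Om (fun x => F x (u x) * psi x).
Proof.
have [C C0 hC] := cut_test_bounded.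
apply: (proj1 (L1_extend mOm (meas_eball r) _ _)); last first.
  by apply: off_ball => x -> _; rewrite mulr0.
have iD : L1 (Om `&` eball r) (fun x => C * `|F x (u x)|).
  by apply: L1Z => //; apply: L1_norm; exact: F_loc.
apply: (L1_dom_ae mB _ iD).
  by apply: (measf_sub mOm); [move=> x []|exact: measfM].
apply: (ae_mono hC) => x hx [Omx _].
by rewrite normrM mulrC ler_wpM2r// hx.
Qed.

Lemma weak_inequality : intOn Om (fun x => F x (u x) * psi x) <=
  - intOn Om (fun x => dotv (flux phi (G x)) (H x)).
Proof.
have i1 := L1_F_test; have i2 := L1_flux_grad.
rewrite -lee_fin EFinN !EFin_intOn//; apply: u_weak => //.
- split; first by move: mpsi; rewrite measfE.
  by have [C _ hC] := cut_test_bounded; exists C.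
- exact: ae_forall.
- by apply: (@compact_ess_support _ _ _ _ z h) => x /psi_off[].
- by rewrite -EFin_intOn ?ltry//; exact: L1_phi_grad.
Qed.

Let mgradv i : measf Om (fun x => grad v x 0 i).
Proof. by under eq_fun do rewrite mxE; apply: measf_smooth; exact: smooth_partial. Qed.

Let dotv0 (x : E) : dotv x 0 = 0.
Proof. by rewrite /dotv big1// => i _; rewrite mxE mulr0. Qed.

Lemma L1_enorm_test_grad : L1 Om (fun x => enorm (H x)).
Proof.
have [_ H1 _] := psi_grad.
apply: (L1_dom mOm (measf_enorm mH) (L1_sum mOm (index_enum 'I_n) (fun i => L1_norm (H1 i)))).
by move=> x _; rewrite ger0_norm ?enorm_ge0//; exact: enorm_le_sum.
Qed.

Lemma L1_flux_smooth_grad : L1 Om (fun x => dotv (flux phi (grad v x)) (H x)).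
Proof.
apply: (L1_dom mOm _ (L1Z mOm (phi (n%:R * Cv)) L1_enorm_test_grad)).
  by apply: measf_dotv => // i; exact: (measf_flux phi_incr).
move=> x _; apply: (le_trans (flux_le phi_bij phi_incr (grad v x) (H x))).
apply: ler_wpM2r; first exact: enorm_ge0.
by apply: (phi_le phi_incr); [exact: enorm_ge0|exact: enorm_grad_le].
Qed.

(** On the ball [H = chi (u - v) (G - grad v)], so monotonicity of the flux allows [flux (grad v)]
    in place of [flux G]. *)
Lemma weak_inequality_smooth : intOn Om (fun x => F x (u x) * psi x) <=
  - intOn Om (fun x => dotv (flux phi (grad v x)) (H x)).
Proof.
apply: le_trans weak_inequality _; rewrite lerN2.
have i1 := L1_flux_smooth_grad; have i2 := L1_flux_grad.
apply: intOn_le_ae => //; apply: (ae_mono cut_testE) => x hx Omx.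
have [h2 h3] := hx Omx; have [xh|xh] := leP h1 (enorm (x - z)).
  by have [_ ->] := h3 xh; rewrite !dotv0.
have [_ ->] := h2 xh; rewrite !dotvZr ler_wpM2l ?chi_ge0//.
by rewrite -subr_ge0 -dotvNl -dotvDl; exact: flux_monotone.
Qed.

(** The field [x - z] has divergence [n], and [trunc_ibp] leaves no boundary term. Beyond radius
    [h], where [psi] and [H] vanish, the field is cut off so that its components become test
    functions. *)
Lemma test_divergence :
  n%:R * intOn Om psi = - intOn Om (fun x => dotv (H x) (x - z)).
Proof.
have hh : h < h + 1 by rewrite ltrDl.
have h0' : 0 <= h by exact: ltW.
pose X (i : 'I_n) (x : E) : R := (x 0 i - z 0 i) * cutoff z h (h + 1) x.
have sX i : smooth (fun x : E => x 0 i - z 0 i : R) by exact: smooth_coordB.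
have tX i : test_function setT (X i).
  by apply: (test_functionM _ _ _ _ (sX i)); apply: test_function_cutoff.
have X1 i (x : E) : enorm (x - z) < h -> X i x = x 0 i - z 0 i.
  by move=> xh; rewrite /X cutoff1 ?mulr1// ltW.
have dX i (x : E) : enorm (x - z) < h -> partial i (X i) x = 1.
  move=> xh; rewrite /X partialM; [|exact: sX|exact: smooth_cutoff].
  rewrite partial_cutoff// mulr0 add0r partial_coordB eqxx mulr1 cutoff1//; exact: ltW.
have [K wK wapp] : W11_0 Om (fun x => gam x * u x).
  by apply: u_boundary; apply: tgam.
have ibp i : intOn Om psi = - intOn Om (fun x => H x 0 i * X i x).
  rewrite -(trunc_ibp oOm wK wapp w_grad sv v00 v_ge v_bd i (tX i)).
  apply: intOn_eq => x _; have [xh|xh] := leP h (enorm (x - z)).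
    by have [p0 _] := psi_off xh; rewrite -/(psi x) p0 mul0r.
  by rewrite dX// mulr1.
have iHX i : L1 Om (fun x => H x 0 i * X i x).
  have [C _ XC] := test_function_bounded _ _ (tX i); have [_ H1 _] := psi_grad.
  under eq_fun do rewrite mulrC.
  by apply: (L1M mOm (C := C)) => //; apply: measf_smooth; case: (tX i).
have -> : intOn Om (fun x => dotv (H x) (x - z)) = \sum_(i < n) intOn Om (fun x => H x 0 i * X i x).
  rewrite -(intOn_sum mOm)//; apply: intOn_eq => x _; apply: eq_bigr => i _.
  have [xh|xh] := leP h (enorm (x - z)); first by have [_ ->] := psi_off xh; rewrite !mxE !mul0r.
  by rewrite X1// !mxE.
rewrite -sumrN (eq_bigr (fun=> intOn Om psi)) => [|i _]; last by rewrite -ibp.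
by rewrite sumr_const card_ord mulr_natl.
Qed.

Lemma L1_cut_test : L1 Om psi. Proof. by have [] := psi_grad. Qed.

(** As [grad v = 0], [flux G . H = chi (u - v) phi |G| |G| >= 0], while the weak inequality makes
    its integral nonpositive; hence [H = 0] almost everywhere. By [test_divergence] the integral of
    [psi] then vanishes. *)
Lemma test_eq0 : (0 < n)%N -> (forall x, grad v x = 0) ->
  {ae mu, forall x, Om x -> 0 <= F x (u x)} -> {ae mu, forall x, Om x -> psi x = 0}.
Proof.
move=> n0 gv0 F0; have L1p := L1_cut_test.
have dotH0 : {ae mu, forall x, Om x -> 0 <= dotv (flux phi (G x)) (H x)}.
  apply: (ae_mono cut_testE) => x hx Omx; have [h2 h3] := hx Omx.
  have [xh|xh] := leP h1 (enorm (x - z)); first by have [_ ->] := h3 xh; rewrite dotv0.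
  have [_ ->] := h2 xh; rewrite gv0 subr0 dotvZr mulr_ge0 ?chi_ge0//.
  by rewrite dotv_flux_self mulr_ge0 ?enorm_ge0// (phi_ge0 phi_bij)// enorm_ge0.
have i0 : intOn Om (fun x => dotv (flux phi (G x)) (H x)) = 0.
  apply/eqP; rewrite eq_le; apply/andP; split.
    rewrite -oppr_ge0; apply: le_trans weak_inequality.
    have <- : intOn Om (fun=> 0) = 0 :> R.
      apply: intOn_EFin; under eq_integral do rewrite (_ : 0%:E = 0%E)//.
      by rewrite integral0.
    have := L1Z mOm 0 L1_cut_test; under eq_fun do rewrite mul0r; move=> i00.
    apply: intOn_le_ae => //; first exact: L1_F_test.
    by apply: (ae_mono F0) => x hx Omx; rewrite mulr_ge0// hx.
  have := L1Z mOm 0 L1_cut_test; under eq_fun do rewrite mul0r; move=> i00.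
  have <- : intOn Om (fun=> 0) = 0 :> R.
    apply: intOn_EFin; under eq_integral do rewrite (_ : 0%:E = 0%E)//.
    by rewrite integral0.
  by apply: intOn_le_ae => //; exact: L1_flux_grad.
have H0 : {ae mu, forall x, Om x -> H x = 0}.
  have d0 := intOn_ae_eq0 mOm L1_flux_grad dotH0 i0.
  apply: (ae_mono (ae_and cut_testE d0)) => x [hx dx] Omx; have [h2 h3] := hx Omx.
  have [xh|xh] := leP h1 (enorm (x - z)); first by have [_ ->] := h3 xh.
  have [_ HE] := h2 xh; move: (dx Omx); rewrite HE gv0 subr0 dotvZr dotv_flux_self.
  move/eqP; rewrite !mulf_eq0 => /or3P[/eqP->|/eqP p0|/eqP/enorm_eq0->].
  - by rewrite scale0r.
  - suff -> : G x = 0 by rewrite scaler0.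
    apply: enorm_eq0; rewrite -(phiK phi_bij (enorm_ge0 _)) p0; exact: (phi_inv0 phi_bij phi_incr).
  - by rewrite scaler0.
have n0' : n%:R != 0 :> R by rewrite pnatr_eq0 -lt0n.
have p0 : intOn Om psi = 0.
  apply: (mulfI n0'); rewrite mulr0 test_divergence.
  have -> : intOn Om (fun x => dotv (H x) (x - z)) = intOn Om (fun x => 0 * psi x).
    apply: intOn_ae => //.
    - apply: measf_dotv => // i; under eq_fun do rewrite !mxE.
      by apply: measf_smooth; exact: smooth_coordB.
    - by apply: measfM => //; exact: measf_cst.
    - by apply: (ae_mono H0) => x hx Omx; rewrite hx// dotvC dotv0 mul0r.
  by rewrite intOnZ// mul0r oppr0.
exact: (intOn_eq0_ae mOm L1_cut_test (fun x _ => psi_ge0 x) p0).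
Qed.

(** The bound for [F] puts [2 q] times the integral of [psi] on the left. On the right the main part
    [(q / n) (x - z)] of the barrier flux contributes [q] times that integral, by [test_divergence],
    and the rest is at most [e |H|]. *)
Lemma test_small (q e : R) : (0 < n)%N -> 0 <= q -> 0 <= e ->
  (forall x, enorm (x - z) < h1 ->
    enorm (flux phi (grad v x) - (q / n%:R) *: (x - z)) <= e) ->
  {ae mu, forall x, Om x -> enorm (x - z) < h1 -> v0 < u x -> 2 * q <= F x (u x)} ->
  q * intOn Om psi <= e * intOn Om (fun x => enorm (H x)).
Proof.
move=> n0 q0 e0 he Fq; have L1p := L1_cut_test; have nR : n%:R != 0 :> R by rewrite pnatr_eq0 -lt0n.
have i1 := L1_F_test; have i2 := L1_flux_smooth_grad; have i3 := L1_enorm_test_grad.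
have i4 : L1 Om (fun x => dotv (H x) (x - z)).
  have ib : L1 Om (fun x => (h * 1) * enorm (H x)) by exact: L1Z.
  apply: (L1_dom mOm _ ib).
    apply: measf_dotv => // i; under eq_fun do rewrite !mxE.
    by apply: measf_smooth; exact: smooth_coordB.
  move=> x _; have [xh|/ltW xh] := leP h (enorm (x - z)).
    by have [_ ->] := psi_off xh; rewrite dotvC dotv0 normr0 enorm0 mulr0.
  by apply: le_trans (normr_dotv _ _) _; rewrite mulr1 mulrC ler_wpM2r ?enorm_ge0.
have s1 : 2 * q * intOn Om psi <= intOn Om (fun x => F x (u x) * psi x).
  rewrite -intOnZ//; apply: intOn_le_ae => //; first exact: L1Z.
  apply: (ae_mono (ae_and cut_testE Fq)) => x [hx Fx] Omx; have [h2 h3] := hx Omx.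
  have [xh|xh] := leP h1 (enorm (x - z)); first by have [-> _] := h3 xh; rewrite !mulr0.
  have [p0 _] := h2 xh; have [uv|uv] := leP (u x) (v0).
    rewrite p0 Phi_le0 ?mulr0// subr_le0; exact: le_trans uv (v_ge x).
  by rewrite ler_wpM2r// Fx.
have s2 : q / n%:R * intOn Om (fun x => dotv (H x) (x - z)) - e * intOn Om (fun x => enorm (H x)) <=
    intOn Om (fun x => dotv (flux phi (grad v x)) (H x)).
  have i5 := L1Z mOm (q / n%:R) i4; have i6 := L1Z mOm e i3.
  rewrite -!intOnZ// -intOnB//; apply: intOn_le_ae => //; first exact: L1B.
  apply: (ae_mono cut_testE) => x hx Omx; have [h2 h3] := hx Omx.
  have [xh|xh] := leP h1 (enorm (x - z)).
    by have [_ ->] := h3 xh; rewrite enorm0 !(dotvC 0) !dotv0 !mulr0 subr0.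
  rewrite lerBlDr -lerBlDl (dotvC (H x)) -dotvZl -dotvNl -dotvDl.
  rewrite -opprB dotvNl; apply: le_trans (ler_norm _) _; rewrite normrN.
  apply: le_trans (normr_dotv _ _) _; apply: ler_wpM2r; [exact: enorm_ge0|exact: he].
have s3 := le_trans s1 weak_inequality_smooth.
have s4 : q / n%:R * intOn Om (fun x => dotv (H x) (x - z)) = - (q * intOn Om psi).
  have -> : intOn Om (fun x => dotv (H x) (x - z)) = - (n%:R * intOn Om psi).
    by rewrite test_divergence opprK.
  by field.
rewrite s4 in s2; exact: (absorb_half s3 s2).
Qed.

(** The barrier enters the bound only through [L], so for barriers of varying mesh the bound is
    uniform. *)
Lemma test_grad_integral (L : R) : (forall x, enorm (x - z) < h1 -> enorm (grad v x) <= L) ->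
  0 <= L -> intOn Om (fun x => enorm (H x)) <=
    intOn (Om `&` eball (enorm z + h + 1)) (fun x => enorm (G x) + L).
Proof.
move=> gL L0.
have [_ G1 _] := u_grad r0.
have iG : L1 (Om `&` eball r) (fun x => enorm (G x)).
  apply: (L1_dom mB _ (L1_sum mB (index_enum 'I_n) (fun i => L1_norm (G1 i)))).
    by apply: measf_enorm => i; exact: L1_measf (G1 i).
  by move=> x _; rewrite ger0_norm ?enorm_ge0//; exact: enorm_le_sum.
have iH := L1_enorm_test_grad.
have sB : Om `&` eball r `<=` Om by move=> x [].
have [|_ ->] := L1_extend mOm (meas_eball r) (L1_sub mOm mB sB iH).
  by apply: off_ball => x _ ->; rewrite enorm0.
apply: intOn_le_ae => //; [exact: L1_sub iH|by apply: L1D => //; exact: L1_cst|].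
apply: (ae_mono cut_testE) => x hx [Omx _]; have [h2 h3] := hx Omx.
have [xh|xh] := leP h1 (enorm (x - z)).
  by have [_ ->] := h3 xh; rewrite enorm0 addr_ge0 ?enorm_ge0.
have [_ ->] := h2 xh; rewrite enormZ.
apply: le_trans (_ : enorm (G x - grad v x) <= _).
  by rewrite ler_piMl ?enorm_ge0// chi_norm.
by apply: le_trans (enormD _ _) _; rewrite enormN lerD2l gL.
Qed.

End test.
Hypothesis n_gt0 : (0 < n)%N.
Hypothesis F_ge0 : forall x t, Om x -> 0 <= t -> 0 <= F x t.

Let Fu_ge0 : {ae mu, forall x, Om x -> 0 <= F x (u x)}.
Proof. by apply: (ae_mono u_ge0) => x ux Omx; apply: F_ge0 => //; exact: ux. Qed.

(** An application of [test_eq0] with centre 0 and the constant barrier [k]: the bound on the shell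
    makes the truncation above [k] admissible, and the truncation vanishes. *)
Lemma max_principle (s a k : R) : 0 <= s -> s < a -> 0 < k ->
  {ae mu, forall x, Om x -> s <= enorm x -> enorm x < a -> u x <= k} ->
  {ae mu, forall x, Om x -> enorm x < a -> u x <= k}.
Proof.
move=> s0 sa k0 uk.
have uv : {ae mu, forall x, Om x -> s <= enorm (x - 0) -> enorm (x - 0) < a -> u x <= k}.
  by apply: (ae_mono uk) => x; rewrite subr0.
have vb (i : 'I_n) (x : E) : `|partial i (fun=> k) x| <= 0 by rewrite partial_cst normr0.
have gv0 (x : E) : grad (fun=> k) x = 0.
  by apply/rowP => i; rewrite !mxE partial_cst.
have p0 := test_eq0 s0 sa (smooth_cst k) k0 (fun=> lexx k) vb uv n_gt0 gv0 Fu_ge0.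
have cE := cut_testE s0 sa k0 (fun=> lexx k) uv.
apply: (ae_mono (ae_and (ae_and cE uk) p0)) => x [[hx ux] px] Omx xa.
have [xs|xs] := leP s (enorm x); first exact: ux.
have [h2 _] := hx Omx; move: h2; rewrite subr0 => /(_ xs) [+ _]; rewrite px// => P0.
rewrite leNgt; apply/negP; rewrite -subr_gt0 => /Phi_gt0; by rewrite -P0 ltxx.
Qed.

(** Barriers of mesh [w N] lie above [k] on the ring [3 h / 4 <= |x - z| < h], hence above [u]. The
    integral of the truncation above them is [O(w N)], and all of them lie below the cone of slope
    [p h]; as [N] grows, [u] is seen to stay below the cone. *)
Lemma barrier_comparison (z : E) (h q v0 k : R) : 0 < h -> 0 < q -> 0 < v0 ->
  {ae mu, forall x, Om x -> enorm (x - z) < h -> u x <= k} ->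
  k <= v0 + h / 4 * profile (n := n) phi q (h / 4) ->
  {ae mu, forall x, Om x -> enorm (x - z) < h -> v0 < u x -> 2 * q <= F x (u x)} ->
  {ae mu, forall x, Om x -> enorm (x - z) < 3 * h / 4 ->
    u x <= v0 + enorm (x - z) * profile (n := n) phi q h}.
Proof.
move=> h0 q0 v00 uk kv Fq; have q0' := ltW q0.
pose p := profile (n := n) phi q.
have nR : 0 < n%:R :> R by rewrite ltr0n.
have p_mono := profile_mono (n := n) phi_bij phi_incr q0'.
have p00 := profile0 (n := n) q phi_bij phi_incr.
have p_ge0 := profile_ge0 (n := n) phi_bij q0'.
pose h1 := 3 * h / 4.
have h10 : 0 < h1 by rewrite divr_gt0// mulr_gt0.
have h1h : h1 < h by rewrite /h1 ltr_pdivrMr// mulrC ltr_pM2l// ltr_nat.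
(* The mesh divides [h / 4], so that both [h / 4] and [h] are nodes. *)
pose w (N : nat) := h / (4 * N.+1)%:R.
pose J (N : nat) := (4 * N.+1)%N.
have w0 N : 0 < w N by rewrite divr_gt0// ltr0n.
have Jw N : (J N)%:R * w N = h by rewrite mulrC divfK// pnatr_eq0.
have Nw N : N.+1%:R * w N = h / 4.
  have n1 : N.+1%:R != 0 :> R by rewrite pnatr_eq0.
  by rewrite /w natrM; move: n1; move: (N.+1%:R) => m m0; field.
have Nw2 N : N.+2%:R * w N <= h / 2.
  rewrite -addn1 natrD mulrDl mul1r Nw.
  have hw : w N <= h / 4.
    by rewrite /w ler_pM2l// lef_pV2 ?posrE ?ltr0n// ler_nat leq_pmulr.
  rewrite [leRHS](_ : _ = h / 4 + h / 4); last by field.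
  by rewrite lerD2l.
pose v N := barrier z (w N) v0 (J N) (incr p (w N) \o val).
have c0 N (j : 'I_(J N)) : 0 <= (incr p (w N) \o val) j by apply: incr_ge0.
have sv N : smooth (v N) by apply: smooth_barrier.
have v_ge N x : v0 <= v N x by apply: barrier_ge.
have gvN N x : enorm (grad (v N) x) <= p h by rewrite -(Jw N); apply: enorm_grad_barrier_le.
have vb N i x : `|partial i (v N) x| <= p h.
  by rewrite -(Jw N); apply: partial_barrier_le.
have uv N : {ae mu, forall x, Om x -> h1 <= enorm (x - z) -> enorm (x - z) < h -> u x <= v N x}.
  apply: (ae_mono uk) => x hx Omx x1 x2; apply: le_trans (hx Omx x2) _.
  apply: le_trans kv _.
  have NJ : (N.+1 <= J N)%N by rewrite /J leq_pmull.
  (* From distance [h / 2] on the slope is at least [p (h / 4)], and the ring lies at least [h / 4]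
     further out; this yields the height that bounds [k]. *)
  apply: le_trans (_ : v0 + (enorm (x - z) - h / 2) * p (N.+1%:R * w N) <= _); last first.
    by apply: barrier_incr_ge.
  rewrite Nw lerD2l; apply: ler_wpM2r; first by apply: p_ge0; rewrite divr_ge0 ?ltW.
  rewrite lerBrDr; apply: le_trans x1; rewrite /h1 [leRHS](_ : _ = h / 4 + h / 2)//; by field.
pose C0 := intOn (Om `&` eball (enorm z + h + 1)) (fun x => enorm (G x) + p h).
have Fq1 : {ae mu, forall x, Om x -> enorm (x - z) < h1 -> v0 < u x -> 2 * q <= F x (u x)}.
  by apply: (ae_mono Fq) => x hx Omx xh; apply: hx => //; exact: lt_trans h1h.
have psi_small N : intOn Om (cut_test z h1 h (v N)) <= 2 * w N / n%:R * C0.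
  have e0 : 0 <= 2 * q * w N / n%:R by rewrite divr_ge0 ?(ltW nR)// !mulr_ge0// ltW.
  have he x : enorm (x - z) < h1 ->
      enorm (flux phi (grad (v N) x) - (q / n%:R) *: (x - z)) <= 2 * q * w N / n%:R.
    by move=> xh; apply: flux_barrier => //; rewrite Jw; exact: lt_trans h1h.
  have := test_small (ltW h10) h1h (sv N) v00 (v_ge N) (vb N) (uv N) n_gt0 q0' e0 he Fq1.
  have ph0 : 0 <= p h by apply: p_ge0; exact: ltW.
  have := test_grad_integral (ltW h10) h1h (sv N) v00 (v_ge N) (vb N) (uv N) (fun x _ => gvN N x) ph0.
  move=> /(ler_wpM2l e0) b1 /le_trans/(_ b1); rewrite -/C0 => b2.
  rewrite -(ler_pM2l q0); apply: le_trans b2 _.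
  by rewrite le_eqVlt; apply/orP; left; apply/eqP; ring.
pose D := [set x : E | enorm (x - z) < h1].
have mD : meas_set D by apply: open_meas; exact: open_dist_lt.
have mA : meas_set (Om `&` D) by exact: meas_setI.
have sA : Om `&` D `<=` Om by move=> x [].
(* A common upper bound of all the barriers: truncating above it gives a function below every
   [cut_test]. *)
pose vhat x := v0 + enorm (x - z) * p h.
pose phat x := Phi (u x - vhat x).
have mphat : measf Om phat.
  apply: measf_comp_mono; first by move=> a b; exact: Phi_mono.
  apply: measfB => //; apply: measfD; first exact: measf_cst.
  apply: measfM; [by apply: measf_continuous; exact: continuous_dist|exact: measf_cst].
have ipsi N := L1_cut_test z (ltW h10) h1h (sv N) v00 (v_ge N) (vb N).
have cE N := cut_testE (ltW h10) h1h v00 (v_ge N) (uv N).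
have le_psi N : {ae mu, forall x, (Om `&` D) x -> phat x <= cut_test z h1 h (v N) x}.
  apply: (ae_mono (cE N)) => x hx [Omx Dx]; have [h2 _] := hx Omx.
  have [-> _] := h2 Dx; apply: Phi_mono; rewrite lerD2l lerN2 /vhat -(Jw N).
  by apply: barrier_incr_le.
have iA N := L1_sub mOm mA sA (ipsi N).
have iphat : L1 (Om `&` D) phat.
  apply: (L1_dom_ae mA (measf_sub mOm sA mphat) (iA 0%N)).
  by apply: (ae_mono (le_psi 0%N)) => x hx Ax; rewrite ger0_norm ?Phi_ge0// hx.
have phat_le N : intOn (Om `&` D) phat <= 2 * w N / n%:R * C0.
  apply: le_trans (psi_small N).
  have [|_ ->] := L1_extend_ae mOm mD (L1_measf (ipsi N)) (iA N).
    apply: (ae_mono (cE N)) => x hx Omx /negP; rewrite -leNgt => xh.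
    by have [_ h3] := hx Omx; have [] := h3 xh.
  exact: (intOn_le_ae mA iphat (iA N) (le_psi N)).
have p0 : intOn (Om `&` D) phat = 0.
  have I0 : 0 <= intOn (Om `&` D) phat by apply: intOn_ge0 => x _; exact: Phi_ge0.
  have C00 : 0 <= C0.
    by apply: intOn_ge0 => x _; rewrite addr_ge0 ?enorm_ge0// p_ge0// ltW.
  apply: (@small_eq0 _ _ (2 / n%:R * C0)) => e e0; rewrite ger0_norm//.
  have [N hN] : exists N, w N <= e.
    exists (Num.bound (h / e)); rewrite /w ler_pdivrMr ?ltr0n// mulrC -ler_pdivrMr//.
    apply: ltW; apply: lt_le_trans (archi_boundP _) _; first by rewrite divr_ge0 ?ltW.
    by rewrite ler_nat (leq_trans (leqnSn _))// leq_pmull.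
  apply: le_trans (phat_le N) _.
  have -> : 2 * w N / n%:R * C0 = 2 / n%:R * C0 * w N by ring.
  by rewrite ler_wpM2l// mulr_ge0// divr_ge0 ?(ltW nR).
have := intOn_eq0_ae mA iphat (fun x _ => Phi_ge0 _) p0.
move=> hp; apply: (ae_mono hp) => x hx Omx xh; rewrite leNgt; apply/negP.
by rewrite -subr_gt0 => /Phi_gt0; rewrite -/(vhat x) -/(phat x) hx// ltxx.
Qed.

End comparison.

(** * The essential supremum over balls *)

Section ess_sup_ball.
Context {R : realType} {n : nat}.
Local Notation E := 'rV[R]_n.
Local Notation mu := (@lebesgue_rV R n).
Variables (Om : set E) (u : E -> R).
Hypothesis u_loc : Linfty_loc Om u.

(** The condition [0 <= k] keeps the set bounded below even when [Om] meets the ball in a null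
    set. *)
Let bounds (r : R) : set R :=
  [set k | 0 <= k /\ {ae mu, forall x, Om x -> enorm x < r -> u x <= k}].

Definition ess_sup_ball (r : R) : R := inf (bounds r).

Let has_inf_bounds r : 0 < r -> has_inf (bounds r).
Proof.
move=> r0; split; last by exists 0 => k [].
have [_ [C hC]] := u_loc r0; exists `|C|; split => //.
apply: (ae_mono hC) => x hx Omx xr; apply: le_trans (ler_norm _) _.
by apply: le_trans (hx _) (ler_norm _).
Qed.

(** The infimum is attained: the bounds [ess_sup_ball r + 1 / k.+1] hold off a countable union of
    null sets. *)
Lemma ess_sup_ball_ae r : 0 < r ->
  {ae mu, forall x, Om x -> enorm x < r -> u x <= ess_sup_ball r}.
Proof.
move=> r0.
have h (k : nat) : {ae mu, forall x, Om x -> enorm x < r -> u x <= ess_sup_ball r + k.+1%:R^-1}.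
  have [|e [e0 he] hek] := @inf_adherent _ (bounds r) k.+1%:R^-1 _ (has_inf_bounds r0).
    by rewrite invr_gt0.
  by apply: (ae_mono he) => x hx Omx xr; apply: le_trans (hx Omx xr) (ltW hek).
apply: (ae_mono (ae_nat h)) => x hx Omx xr.
rewrite leNgt; apply/negP; rewrite -subr_gt0 => d0.
have := hx (Num.bound (u x - ess_sup_ball r)^-1) Omx xr; rewrite -lerBlDl leNgt => /negP; apply.
rewrite -[ltRHS]invrK ltf_pV2 ?posrE ?invr_gt0//.
have dV : 0 <= (u x - ess_sup_ball r)^-1 by rewrite invr_ge0 ltW.
by apply: lt_trans (archi_boundP dV) _; rewrite ltr_nat.
Qed.

Lemma ess_sup_ball_le r k : 0 <= k ->
  {ae mu, forall x, Om x -> enorm x < r -> u x <= k} -> ess_sup_ball r <= k.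
Proof. by move=> k0 hk; apply: ge_inf => //; exists 0 => j []. Qed.

Lemma ess_sup_ball_ge0 r : 0 < r -> 0 <= ess_sup_ball r.
Proof. by move=> r0; apply: lb_le_inf => [|k []//]; have [] := has_inf_bounds r0. Qed.

Lemma ess_sup_ball_mono a b : 0 < a -> a <= b -> ess_sup_ball a <= ess_sup_ball b.
Proof.
move=> a0 ab; have b0 : 0 < b by exact: lt_le_trans ab.
apply: ess_sup_ball_le; first exact: ess_sup_ball_ge0.
by apply: (ae_mono (ess_sup_ball_ae b0)) => x hx Omx xa; apply: hx => //; exact: lt_le_trans ab.
Qed.

(** Finitely many local gaps have a positive minimum; points of [s] outside [P] carry no information
    and are skipped. *)
Lemma ae_finite_cover (a M : R) (P : E -> Prop) (rho : E -> R) (eps : E -> R) (s : seq E) :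
  (forall z, P z -> 0 < eps z /\ {ae mu, forall x, Om x -> enorm x < a ->
     enorm (x - z) < rho z -> u x <= M - eps z}) ->
  exists2 e, 0 < e & {ae mu, forall x, Om x -> enorm x < a ->
    (exists2 z, z \in s & P z /\ enorm (x - z) < rho z) -> u x <= M - e}.
Proof.
move=> hP; elim: s => [|z s [e e0 he]]; first by exists 1 => //; apply: ae_forall => x _ _ [].
have [Pz|nPz] := pselect (P z); last first.
  exists e => //; apply: (ae_mono he) => x hx Omx xa [y]; rewrite inE => /predU1P[->[]//|ys hy].
  by apply: hx => //; exists y.
have [ez hz] := hP z Pz; exists (Num.min e (eps z)); first by rewrite lt_min e0.
apply: (ae_mono (ae_and he hz)) => x [hx hxz] Omx xa [y]; rewrite inE => ys [Py hy].
move: ys => /predU1P[yz|ys].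
  rewrite yz in hy; apply: le_trans (hxz Omx xa hy) _.
  by rewrite lerD2l lerN2 ge_min lexx orbT.
apply: le_trans (hx Omx xa _) _; first by exists y.
by rewrite lerD2l lerN2 ge_min lexx.
Qed.

End ess_sup_ball.

Section arith.
Context {R : realFieldType}.

Lemma inner_radius_le (r a b l t : R) : r <= a -> b <= l -> 2 * r - l - t <= a - t - (b - a).
Proof. by move=> *; lra. Qed.

Lemma half_sub_le1 (x : R) : 0 <= x -> 2^-1 - x / 2 <= 1.
Proof. by move=> *; lra. Qed.

Lemma half_le_sub (m d : R) : d <= m / 2 -> m / 2 <= m - d.
Proof. by move=> *; lra. Qed.

Lemma le_sub_add (d T b a : R) : d <= T - (b - a) -> b <= a - d + T.
Proof. by move=> *; lra. Qed.

Lemma sub_add_half_le (m d e : R) : e <= d / 2 -> m - d + e <= m - d / 2.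
Proof. by move=> *; lra. Qed.

End arith.

(** * The growth step for the essential supremum *)

Section doubling_step.
Context {R : realType} {n : nat}.
Local Notation E := 'rV[R]_n.
Local Notation mu := (@lebesgue_rV R n).
Variables (Om : set E) (phi : R -> R) (F : E -> R -> R) (u : E -> R) (G : E -> E).
Hypothesis oOm : open Om.
Hypothesis phi_bij : set_bij `[0, +oo[%classic `[0, +oo[%classic phi.
Hypothesis phi_incr : forall s t, 0 <= s -> s < t -> phi s < phi t.
Hypothesis phi_monotone : forall xi zeta : E, xi != zeta ->
  0 < dotv (flux phi xi - flux phi zeta) (xi - zeta).
Hypothesis u_ge0 : {ae mu, forall x, Om x -> 0 <= u x}.
Hypothesis u_loc : Linfty_loc Om u.
Hypothesis u_grad : W11loc_grad Om u G.
Hypothesis F_loc : L1loc Om (fun x => F x (u x)).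
Hypothesis flux_loc : L1loc Om (fun x => phi (enorm (G x)) * enorm (G x)).
Hypothesis u_weak : forall psi H,
  W11_grad Om psi H -> W11_0 Om psi -> Linfty mu Om psi ->
  {ae mu, forall x, Om x -> 0 <= psi x} ->
  compact (ess_support (patch (fun=> 0) Om psi)) ->
  (\int[mu]_(x in Om) (phi (enorm (G x)) * enorm (H x))%:E < +oo)%E ->
  (\int[mu]_(x in Om) (F x (u x) * psi x)%:E <=
   - \int[mu]_(x in Om) (dotv (flux phi (G x)) (H x))%:E)%E.
Hypothesis u_boundary : zero_on_boundary Om u.
Hypothesis n_gt0 : (0 < n)%N.
Hypothesis F_ge0 : forall x t, Om x -> 0 <= t -> 0 <= F x t.
Local Notation M := (ess_sup_ball Om u).

(** If near every point of the shell [u] stayed below [M a] by a margin, compactness would make the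
    margin uniform and the maximum principle would carry it to the whole ball, against the
    definition of [M a]. *)
Lemma exists_peak (s a : R) : 0 <= s -> s < a -> 0 < M a ->
  exists z, [/\ s <= enorm z, enorm z <= a & forall rho e, 0 < rho -> 0 < e ->
    ~ {ae mu, forall x, Om x -> enorm x < a -> enorm (x - z) < rho -> u x <= M a - e}].
Proof.
move=> s0 sa Ma0; apply: contrapT => nope; have a0 : 0 < a by exact: le_lt_trans sa.
pose shell := [set z : E | s <= enorm z /\ enorm z <= a].
have h (z : E) : exists re : R * R, shell z -> [/\ 0 < re.1, 0 < re.2 &
    {ae mu, forall x, Om x -> enorm x < a -> enorm (x - z) < re.1 -> u x <= M a - re.2}].
  have [[sz za]|?] := pselect (shell z); last by exists (0, 0).
  apply: contrapT => h; apply: nope; exists z; split => // rho e rho0 e0 hae.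
  by apply: h; exists (rho, e).
have [re hre] := choice h.
pose rho z := (re z).1; pose eps z := (re z).2.
have cshell : compact shell.
  apply: (@subclosed_compact _ _ [set x | enorm (x - 0) <= a]).
  - rewrite (_ : shell = [set x | enorm (x - 0) <= a] `&` ~` [set x | enorm (x - 0) < s]).
      by apply: closedI; [exact: closed_dist_le|rewrite closedC; exact: open_dist_lt].
    apply/seteqP; split => x /=; rewrite /shell /= subr0.
      by move=> [sx xa]; split => //; apply/negP; rewrite -leNgt.
    by move=> [xa /negP]; rewrite -leNgt.
  - exact: compact_dist_le.
  - by move=> x [_]; rewrite /= subr0.
have [||x sx|D Dsub Dcov] := (_ : cover_compact shell) E shell (fun z => [set x | enorm (x - z) < rho z]).
- by rewrite -compact_cover.
- by move=> z _; exact: open_dist_lt.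
- exists x => //=; rewrite subrr enorm0; by have [] := hre x sx.
have [e e0 he] := @ae_finite_cover R n Om u a (M a) shell rho eps D
  (fun z sz => let: And3 _ e0 ae := hre z sz in conj e0 ae).
(* The cap [M a / 2] keeps the level [M a - d] positive, as the maximum principle requires. *)
pose d := Num.min e (M a / 2).
have d0 : 0 < d by rewrite lt_min e0 divr_gt0.
have k0 : 0 < M a - d.
  by rewrite subr_gt0 (le_lt_trans (_ : d <= M a / 2))// ?ge_min ?lexx ?orbT// gtr_pMr// invf_lt1// ltr1n.
have uk : {ae mu, forall x, Om x -> s <= enorm x -> enorm x < a -> u x <= M a - d}.
  apply: (ae_mono he) => x hx Omx sx xa; apply: le_trans (hx Omx xa _) _; last first.
    by rewrite lerD2l lerN2 ge_min lexx.
  have [z zD xz] := Dcov x (conj sx (ltW xa)).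
  by exists z => //; split => //; apply: set_mem; exact: Dsub.
have := max_principle oOm phi_bij phi_incr u_ge0 u_loc u_grad F_loc flux_loc u_weak
  u_boundary n_gt0 F_ge0 s0 sa k0 uk.
move=> /(ess_sup_ball_le (ltW k0)); rewrite leNgt => /negP; apply.
by rewrite gtrBl.
Qed.

Variables (f g : R -> R) (r0 sigma : R).
Hypothesis r0_gt0 : 0 < r0.
Hypothesis sigma_gt1 : 1 < sigma.
Hypothesis F_lower : forall r t, r0 <= r -> 0 < t ->
  ((f r * g t)%:E <= ereal_inf [set (F x t)%:E | x in annulus Om sigma r])%E.
Hypothesis g_semi : almost_semi_multiplicative g.
Hypothesis g_bounded : forall K : set R, compact K -> K `<=` `]0, +oo[%classic ->
  has_ubound [set g t | t in K].

(** With [t = (sigma - 1) / (2 sigma)] one has [1 - 2 t = 1 / sigma]: if [r <= a < b <= lam r], an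
    open ball of radius [b - a] centred at distance between [a - t r] and [a] from 0 lies outside
    radius [r / sigma] and inside radius [sigma r]. *)
Let lam := 1 + (sigma - 1) / (2 * sigma).

Lemma F_annulus_ge r x t : r0 <= r -> Om x -> r / sigma < enorm x -> enorm x < sigma * r -> 0 < t ->
  f r * g t <= F x t.
Proof.
move=> rr Omx rx xr t0; rewrite -lee_fin; apply: le_trans (F_lower rr t0) _.
apply: ereal_inf_lbound; exists x => //; split; first by split.
have cl : closure (eball (r / sigma)) `<=` [set y : E | enorm (y - 0) <= r / sigma].
  have /closure_id -> := @closed_dist_le R n 0 (r / sigma).
  by apply: closureS => y /=; rewrite subr0 => /ltW.
by move=> /cl /=; rewrite subr0 leNgt rx.
Qed.

Lemma annulus_radii r a b : 0 < r -> r <= a -> b <= lam * r ->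
  let s := a - (sigma - 1) / (2 * sigma) * r in
  [/\ 0 <= s, s < a, r / sigma <= s - (b - a) & b < sigma * r].
Proof.
move=> rp ra bl s; have sg0 : 0 < sigma by exact: lt_trans sigma_gt1.
have t0 : 0 < (sigma - 1) / (2 * sigma) by rewrite divr_gt0 ?subr_gt0// mulr_gt0.
have tE : (sigma - 1) / (2 * sigma) = 2^-1 - sigma^-1 / 2.
  by field; rewrite gt_eqF.
have sV : sigma^-1 < 1 by rewrite invf_lt1.
have sV0 : 0 < sigma^-1 by rewrite invr_gt0.
have tr0 := mulr_gt0 t0 rp.
have low : r / sigma <= s - (b - a).
  have : r / sigma <= 2 * r - (lam * r) - (sigma - 1) / (2 * sigma) * r.
    by rewrite le_eqVlt; apply/orP; left; apply/eqP; rewrite /lam; field; rewrite gt_eqF.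
  by move=> /le_trans; apply; exact: inner_radius_le.
split => //.
- rewrite subr_ge0 (le_trans _ ra)// ler_piMl ?(ltW rp)// tE.
  by apply: half_sub_le1; exact: ltW.
- by rewrite gtrBl.
apply: le_lt_trans bl _; rewrite ltr_pM2r// /lam -ltrBrDl ltr_pdivrMr ?mulr_gt0//.
rewrite ltr_pMr ?subr_gt0//; apply: lt_trans sigma_gt1 _.
by rewrite ltr_pMl// ltr1n.
Qed.

(** If the growth were smaller, a barrier starting at [v0 = M a - d] would rise to [M b] before the
    boundary of the ball about the peak, and the comparison would give [u <= M a - d / 2] near the
    peak. *)
Lemma doubling_step : exists2 kap, 0 < kap & forall r a b, r0 <= r -> 0 < f r -> r <= a -> a < b ->
  b <= lam * r -> 0 < M a -> M b <= 2 * M a ->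
  (b - a) / 4 * phi_inv phi (kap * (b - a) * f r * g (M a)) <= M b - M a.
Proof.
have half0 : 0 < 2^-1 :> R by rewrite invr_gt0.
have [C C0 hC] := g_scale g_semi g_bounded 2 half0.
have nR : 0 < n%:R :> R by rewrite ltr0n.
(* [8 n C] is the [2 C] in [q] times the [4 n] from [profile q (h / 4)], so that [T] is exactly the
   height of the barrier. *)
exists (8 * n%:R * C)^-1 => [|r a b rr fr ra ab bl Ma0 Mb2].
  by rewrite invr_gt0 !mulr_gt0.
rewrite leNgt; apply/negP; set h := b - a; set T := h / 4 * _ => MT.
have rp : 0 < r by exact: lt_le_trans rr.
have a0 : 0 < a by exact: lt_le_trans ra.
have b0 : 0 < b by exact: lt_trans ab.
have h0 : 0 < h by rewrite subr_gt0.
have [s0 sa slow bs] := annulus_radii rp ra bl; set s := a - _ in s0 sa slow.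
have [z [sz za peak]] := exists_peak s0 sa Ma0.
have gM : 0 < g (M a) by exact: (g_gt0 g_semi).
(* Half of a lower bound for [F x (u x)] where [u x > v0]: there [u x] is within a factor 2 of
   [M a], so [g (M a) <= C * g (u x)]. *)
pose q := f r * g (M a) / (2 * C).
have q0 : 0 < q by rewrite divr_gt0 ?mulr_gt0.
(* The first bound gives [M b <= v0 + T], the second [v0 >= M a / 2]. *)
pose d := Num.min (T - (M b - M a)) (M a / 2).
have d0 : 0 < d by rewrite lt_min subr_gt0 MT divr_gt0.
have dT : d <= T - (M b - M a) by rewrite ge_min lexx.
have dM : d <= M a / 2 by rewrite ge_min lexx orbT.
pose v0 := M a - d.
have v0M : M a / 2 <= v0 by exact: half_le_sub.
have v00 : 0 < v0 by apply: lt_le_trans v0M; rewrite divr_gt0.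
have in_b x : enorm (x - z) < h -> enorm x < b.
  move=> xz; have := enorm_dist x z 0; rewrite !subr0 => /le_lt_trans; apply.
  by rewrite -(subrK a b) ltr_leD.
have off_s x : enorm (x - z) < h -> r / sigma < enorm x.
  move=> xz; apply: le_lt_trans slow _; rewrite ltrBlDr.
  have := enorm_dist z x 0; rewrite !subr0 enormB => /(le_trans sz)/le_lt_trans; apply.
  by rewrite addrC ltrD2l.
have uMb : {ae mu, forall x, Om x -> enorm (x - z) < h -> u x <= M b}.
  by apply: (ae_mono (ess_sup_ball_ae u_loc b0)) => x hx Omx /in_b; exact: hx.
have TE : T = h / 4 * profile (n := n) phi q (h / 4).
  by rewrite /T /profile; congr (_ * phi_inv phi _); rewrite /q; field; rewrite !gt_eqF.
have Mbv : M b <= v0 + h / 4 * profile (n := n) phi q (h / 4).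
  by rewrite -TE; exact: le_sub_add.
have Fq : {ae mu, forall x, Om x -> enorm (x - z) < h -> v0 < u x -> 2 * q <= F x (u x)}.
  apply: (ae_mono uMb) => x hx Omx xz vu.
  have u0 : 0 < u x by exact: lt_trans vu.
  have uM2 : u x <= 2 * M a by exact: le_trans (hx Omx xz) Mb2.
  have Mu2 : M a <= 2 * u x by rewrite -ler_pdivrMl// mulrC (le_trans v0M)// ltW.
  have := hC (M a / u x) (u x); rewrite divfK ?gt_eqF// => hg.
  have {}hg : g (M a) <= C * g (u x).
    by apply: hg => //; [rewrite ler_pdivlMr// ler_pdivrMl|rewrite ler_pdivrMr].
  apply: le_trans (F_annulus_ge rr Omx (off_s x xz) (lt_trans (in_b x xz) bs) u0).
  have -> : 2 * q = f r * (g (M a) / C) by rewrite /q; field; rewrite gt_eqF.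
  by rewrite ler_wpM2l ?(ltW fr)// ler_pdivrMr// mulrC.
have := barrier_comparison oOm phi_bij phi_incr phi_monotone u_ge0 u_loc u_grad F_loc flux_loc u_weak
  u_boundary n_gt0 h0 q0 v00 uMb Mbv Fq.
set p := profile phi q h => cmp.
have p0 : 0 <= p by apply: (profile_ge0 phi_bij); exact: ltW.
(* So close to [z] the cone rises by at most [d / 2]; the [+ 1] keeps the divisor positive. *)
pose rho := Num.min (3 * h / 4) (d / 2 / (p + 1)).
have p1 : 0 < p + 1 by rewrite ltr_wpDl.
have rho0 : 0 < rho by rewrite lt_min !divr_gt0 ?mulr_gt0.
apply: (peak rho (d / 2)) => //; first by rewrite divr_gt0.
apply: (ae_mono cmp) => x hx Omx _ xz; apply: le_trans (hx Omx _) _.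
  by apply: lt_le_trans xz _; rewrite ge_min lexx.
have : enorm (x - z) * p <= d / 2.
  have xr : enorm (x - z) <= d / 2 / (p + 1) by rewrite (le_trans (ltW xz))// ge_min lexx orbT.
  rewrite ler_pdivlMr// in xr; apply: le_trans xr.
  by rewrite ler_wpM2l ?enorm_ge0// lerDl.
exact: sub_add_half_le.
Qed.

End doubling_step.

Unset Implicit Arguments.

Theorem theorem2p1 (R : realType) (n : nat) (Om : set 'rV[R]_n)
    (phi f g : R -> R) (F : 'rV[R]_n -> R -> R) (r0 sigma : R)
    (n_ge2 : (2 <= n)%N)
    (Om_nonempty : Om !=set0) (Om_open : open Om)
    (Om_unbounded : ~ bounded_set Om)
    (r0_gt0 : 0 < r0)
    (Om_sphere : forall r, r0 <= r -> Om `&` esphere r !=set0)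
    (phi_bij : set_bij `[0, +oo[%classic `[0, +oo[%classic phi)
    (phi_incr : forall s t, 0 <= s -> s < t -> phi s < phi t)
    (phi_monotone : forall xi zeta : 'rV[R]_n, xi != zeta ->
      0 < dotv (flux phi xi - flux phi zeta) (xi - zeta))
    (F_ge0 : forall x t, Om x -> 0 <= t -> 0 <= F x t)
    (sigma_gt1 : 1 < sigma)
    (F_lower : forall r t, r0 <= r -> 0 < t ->
      ((f r * g t)%:E <=
       ereal_inf [set (F x t)%:E | x in annulus Om sigma r])%E)
    (f_Linfty_loc : Linfty_loc_itv `[r0, +oo[%classic f)
    (f_ge0 : forall r, r0 <= r -> 0 <= f r)
    (g_Linfty_loc : Linfty_loc_itv `]0, +oo[%classic g)
    (g_ge0 : forall t, 0 < t -> 0 <= g t)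
    (g_bounded : forall K : set R, compact K -> K `<=` `]0, +oo[%classic ->
      has_ubound [set g t | t in K])
    (g_inf : forall K : set R, compact K -> K `<=` `]0, +oo[%classic ->
      (0 < ereal_inf [set (g t)%:E | t in K])%E)
    (g_semi_mult : almost_semi_multiplicative g)
    (phi_inv_semi_mult : almost_semi_multiplicative (phi_inv phi))
    (eta_convex : @convex_function R R^o `]0, +oo[%classic (eta_of phi))
    (g_integral :
      (\int[@completed_lebesgue_measure R]_(t in `[1%R, +oo[%classic)
         (eta_inv phi (t / phi_inv phi (g t)) / t)%:E < +oo)%E)
    (f_integral :
      (\int[@completed_lebesgue_measure R]_(r in `[r0, +oo[%classic)
         ((if f r == 0 then 0
           else eta_of phi (r / eta_inv phi (phi_inv phi (1 / f r)))) / r)%:E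
       = +oo)%E)
    (u : 'rV[R]_n -> R)
    (u_ge0 : {ae @lebesgue_rV R n, forall x, Om x -> 0 <= u x})
    (u_solution : weak_solution Om phi F u)
    (u_boundary : zero_on_boundary Om u) :
  {ae @lebesgue_rV R n, forall x, Om x -> u x = 0}.
Proof.
have [u_loc [G [uG F_loc flux_loc u_weak]]] := u_solution.
have n_gt0 : (0 < n)%N by exact: leq_trans n_ge2.
have [kap kap0 step] := doubling_step Om_open phi_bij phi_incr phi_monotone u_ge0 u_loc uG F_loc
  flux_loc u_weak u_boundary n_gt0 F_ge0 r0_gt0 sigma_gt1 F_lower g_semi_mult g_bounded.
pose M := ess_sup_ball Om u.
(* If [M r1 > 0] for some [r1 >= r0], then [M] is positive from [r1] on and the growth estimate
   makes the divergent integral finite. Otherwise [u <= 0] on every ball. *)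
have [[r1 r01 M1]|no_growth] := pselect (exists2 r, r0 <= r & 0 < M r).
  exfalso; have r1_gt0 : 0 < r1 by exact: lt_le_trans r01.
  have lam1 : 1 < 1 + (sigma - 1) / (2 * sigma).
    by rewrite ltrDl divr_gt0 ?subr_gt0// mulr_gt0// (lt_trans _ sigma_gt1).
  have M_mono a b : r1 <= a -> a <= b -> M a <= M b.
    by move=> ra ab; apply: ess_sup_ball_mono => //; exact: lt_le_trans ra.
  have M_step r a b : r1 <= r -> 0 < f r -> r <= a -> a < b ->
      b <= (1 + (sigma - 1) / (2 * sigma)) * r -> M b <= 2 * M a ->
      (b - a) / 4 * phi_inv phi (kap * (b - a) * f r * g (M a)) <= M b - M a.
    move=> r1r fr ra ab bl; apply: (step r) => //; first exact: le_trans r1r.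
    by apply: lt_le_trans M1 _; apply: M_mono => //; exact: le_trans ra.
  have := finite_growth phi_bij phi_incr phi_inv_semi_mult g_semi_mult g_bounded g_integral
    lam1 kap0 r0_gt0 r01 f_Linfty_loc f_ge0 M_mono M1 M_step.
  by rewrite f_integral ltxx.
(* The balls of radius [r0 + k] exhaust the space, so countably many null sets suffice. *)
have u_le0 (k : nat) :
    {ae @lebesgue_rV R n, forall x, Om x -> enorm x < r0 + k%:R -> u x <= 0}.
  have rk : 0 < r0 + k%:R by rewrite ltr_wpDr.
  apply: (ae_mono (ess_sup_ball_ae u_loc rk)) => x hx Omx xk; apply: le_trans (hx Omx xk) _.
  rewrite leNgt; apply/negP => Mk; apply: no_growth; exists (r0 + k%:R) => //.
  by rewrite lerDl.
apply: (ae_mono (ae_and u_ge0 (ae_nat u_le0))) => x [ux0 uxk] Omx.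
apply/le_anti; rewrite ux0// andbT; apply: (uxk (Num.bound (enorm x))) => //.
by apply: lt_le_trans (archi_boundP (enorm_ge0 x)) _; rewrite lerDr ltW.
Qed.
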